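(* Suppose $g$ and $\bar g$ are projectively equivalent metrics on a manifold $M^n$ of dimension $n\ge2$. If $$\mathsf P_{ij}-Bg_{ij}=\bar{\mathsf P}_{ij}-\bar B\bar g_{ij}$$ holds for smooth functions $B,\bar B$ on $M$, then $$\lambda^s\,W^i{}_{sjk}=0,$$ where, in local coordinates, $$\lambda^s=-e^{2\Upsilon}\bar g^{si}\frac{\partial}{\partial x^i}\Upsilon,\qquad \Upsilon=\frac1{2(n+1)}\log\left(\left|\frac{\det(\bar g)}{\det(g)}\right|\right).$$ If, in particular, the metrics are non-affinely projectively related, then there is Weyl nullity on the open set where $\Upsilon$ is non-constant (i.e. where $d\Upsilon\ne0$).
   Context: Manifolds are smooth and connected; metrics are smooth, pseudo-Riemannian, of arbitrary signature. Two metrics are projectively equivalent if they have the same geodesics up to reparametrisation, and affinely equivalent if their Levi-Civita connections coincide; non-affinely projectively related means projectively but not affinely equivalent. $\bar g^{si}$ is the inverse of $\bar g_{ij}$; $\det(g)$ is the determinant of the component matrix of $g$ in the given coordinates (the ratio $\det(\bar g)/\det(g)$ is coordinate independent). For the Levi-Civita connection $\nabla$ of $g$: $[\nabla_\ell,\nabla_k]v^j=R^j{}_{i\ell k}v^i$, $R_{jk}=R^a{}_{jak}$, $\mathsf P_{jk}=\frac1{n-1}R_{jk}$ (projective Schouten tensor); $\bar{\mathsf P}$ is the corresponding tensor of $\bar g$. The projective Weyl tensor $W^i{}_{jk\ell}=R^i{}_{jk\ell}+\delta^i_\ell\mathsf P_{jk}-\delta^i_k\mathsf P_{j\ell}$ is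 the same for projectively equivalent metrics. There is Weyl nullity at $x$ if there is $0\ne v\in T_xM$ with $W^i{}_{jk\ell}v^j=0$ at $x$. *)

(* Defs.v *)
From HB Require Import structures.
From mathcomp Require Import all_boot all_order all_algebra.
From mathcomp Require Import all_classical all_reals all_analysis.

Set Implicit Arguments.
Unset Strict Implicit.
Unset Printing Implicit Defensive.

Import Order.TTheory GRing.Theory Num.Theory.
Import numFieldNormedType.Exports.

Local Open Scope classical_set_scope.
Local Open Scope ring_scope.

Section smoothness.
Context {R : realType} {n : nat}.
Implicit Types (U : set 'rV[R]_n) (f : 'rV[R]_n -> R).

Definition partial (i : 'I_n) f : 'rV[R]_n -> R :=
  fun u => 'D_(delta_mx 0 i) f u.

(* Intended for open U, so that [partial i f] on U only depends on f on U. *)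
Fixpoint class_C (k : nat) U f : Prop :=
  (forall u, U u -> {for u, continuous f}) /\
  (if k is k'.+1 then
     forall i : 'I_n, (forall u, U u -> derivable f u (delta_mx 0 i)) /\
                      class_C k' U (partial i f)
   else True).

Definition smooth_on U f : Prop := forall k, class_C k U f.

End smoothness.

(* [cinv] is total; only its values on the open set [cmap @` cdom] matter. *)
Record chart (R : realType) (M : topologicalType) (n : nat) := Chart {
  cdom : set M;
  cmap : M -> 'rV[R]_n;
  cinv : 'rV[R]_n -> M;
  cdom_open : open cdom;
  cimg_open : open (cmap @` cdom);
  cmapK : forall x, cdom x -> cinv (cmap x) = x;
  cmap_continuous : forall x, cdom x -> {for x, continuous cmap};
  cinv_continuous : forall u, (cmap @` cdom) u -> {for u, continuous cinv} }.

Record manifold (R : realType) (n : nat) := Manifold {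
  carrier :> topologicalType;
  atlas : set (chart R carrier n);
  manifold_hausdorff : hausdorff_space carrier;
  manifold_second_countable : @second_countable carrier;
  manifold_connected : connected [set: carrier];
  atlas_cover : forall x : carrier, exists2 c, atlas c & cdom c x;
  atlas_smooth : forall c d, atlas c -> atlas d -> forall a : 'I_n,
    smooth_on (cmap c @` (cdom c `&` cdom d))
              (fun u => cmap d (cinv c u) 0 a) }.

Section tensors.
Context {R : realType} {n : nat} (M : manifold R n).
Implicit Types (c d : chart R M n) (x : M).

Definition smooth_in_chart c (f : M -> R) : Prop :=
  smooth_on (cmap c @` cdom c) (fun u => f (cinv c u)).

Definition smooth_fun (f : M -> R) : Prop :=
  forall c, atlas c -> smooth_in_chart c f.

Definition pd c (i : 'I_n) (f : M -> R) x : R :=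
  partial i (fun u => f (cinv c u)) (cmap c x).

(* Row convention of ['J]: the entry (i, a) is the derivative of the a-th
   coordinate of d with respect to the i-th coordinate of c. *)
Definition transition c d x : 'M[R]_n :=
  'J (fun u => cmap d (cinv c u)) (cmap c x).

(* A tensor field is given by its components in each chart of the atlas,
   related by the transformation law on overlaps. *)
Record metric := Metric {
  gcoef :> chart R M n -> M -> 'M[R]_n;
  metric_sym : forall c x, atlas c -> cdom c x -> (gcoef c x)^T = gcoef c x;
  metric_nondegenerate : forall c x, atlas c -> cdom c x ->
    gcoef c x \in unitmx;
  metric_smooth : forall c (i j : 'I_n), atlas c ->
    smooth_in_chart c (fun x => gcoef c x i j);
  metric_transform : forall c d x, atlas c -> atlas d ->
    cdom c x -> cdom d x ->
    gcoef c x = transition c d x *m gcoef d x *m (transition c d x)^T }.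

Record tangent x := Tangent {
  tcoef :> chart R M n -> 'rV[R]_n;
  tangent_transform : forall c d, atlas c -> atlas d ->
    cdom c x -> cdom d x -> tcoef d = tcoef c *m transition c d x }.

End tensors.

Section curvature.
Context {R : realType} {n : nat} {M : manifold R n} (g : metric M).
Implicit Types (c : chart R M n) (x : M) (i j k l : 'I_n).

(* Gamma^k_{ij} *)
Definition christoffel c k i j x : R :=
  2^-1 * \sum_(l < n) invmx (g c x) k l *
    (pd c i (fun y => g c y j l) x + pd c j (fun y => g c y i l) x
     - pd c l (fun y => g c y i j) x).

(* R^j_{ilk}, with [nabla_l, nabla_k] v^j = R^j_{ilk} v^i *)
Definition riemann c j i l k x : R :=
  pd c l (christoffel c j k i) x - pd c k (christoffel c j l i) x
  + \sum_(a < n) (christoffel c j l a x * christoffel c a k i x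
                  - christoffel c j k a x * christoffel c a l i x).

(* R_{jk} = R^a_{jak} *)
Definition ricci c j k x : R := \sum_(a < n) riemann c a j a k x.

Definition schouten c j k x : R := (n%:R - 1)^-1 * ricci c j k x.

(* W^i_{jkl} *)
Definition weyl c i j k l x : R :=
  riemann c i j k l x + (i == l)%:R * schouten c j k x
  - (i == k)%:R * schouten c j l x.

Definition weyl_nullity x : Prop :=
  exists v : tangent x, forall c, atlas c -> cdom c x ->
    v c != 0 /\ forall i k l, \sum_(j < n) weyl c i j k l x * v c 0 j = 0.

(* Affinely parametrised geodesics; twice differentiable solutions of the
   geodesic equation are automatically smooth.  Constant curves are allowed. *)
Definition geodesic (I : set R) (gamma : R -> M) : Prop :=
  (forall t, I t -> {for t, continuous gamma}) /\
  forall c t, atlas c -> I t -> cdom c (gamma t) ->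
    let u k : R -> R := fun s => cmap c (gamma s) 0 k in
    (forall k, derivable (u k) t 1 /\ derivable (derive1 (u k)) t 1) /\
    forall k, derive1 (derive1 (u k)) t
      + \sum_(i < n) \sum_(j < n)
          christoffel c k i j (gamma t) * derive1 (u i) t * derive1 (u j) t = 0.

End curvature.

Section equivalence.
Context {R : realType} {n : nat} {M : manifold R n}.
Implicit Types (g gbar : metric M).

Definition open_interval (I : set R) : Prop :=
  [/\ open I, is_interval I & I !=set0].

(* phi is onto I, and injective because its derivative does not vanish. *)
Definition reparametrisation (J I : set R) (phi : R -> R) : Prop :=
  phi @` J = I /\
  forall t, J t ->
    [/\ derivable phi t 1, derivable (derive1 phi) t 1 & derive1 phi t != 0].

Definition geodesics_reparametrise g gbar : Prop :=
  forall I gamma, open_interval I -> geodesic g I gamma ->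
  exists J phi, [/\ open_interval J, reparametrisation J I phi
                  & geodesic gbar J (gamma \o phi)].

Definition projectively_equivalent g gbar : Prop :=
  geodesics_reparametrise g gbar /\ geodesics_reparametrise gbar g.

Definition affinely_equivalent g gbar : Prop :=
  forall c x k i j, atlas c -> cdom c x ->
    christoffel g c k i j x = christoffel gbar c k i j x.

(* The determinant ratio does not depend on the chart c around x. *)
Definition Upsilon g gbar (c : chart R M n) (x : M) : R :=
  (2 * (n%:R + 1))^-1 * ln `|\det (gbar c x) / \det (g c x)|.

Definition lambda g gbar (c : chart R M n) (s : 'I_n) (x : M) : R :=
  - expR (2 * Upsilon g gbar c x) *
    \sum_(i < n) invmx (gbar c x) s i * pd c i (Upsilon g gbar c) x.

Definition dUpsilon_neq0 g gbar : set M :=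
  [set x | exists c i, [/\ atlas c, cdom c x
                         & pd c i (Upsilon g gbar c) x != 0]].

End equivalence.

(* Main.v *)
Require Import Defs.
From HB Require Import structures.
From mathcomp Require Import all_boot all_order all_algebra.
From mathcomp Require Import all_classical all_reals all_analysis.
From mathcomp Require Import perm zify ring lra.

(* Write phi = dUpsilon.  A geodesic of g starts in every direction and is also
   a geodesic of gbar up to parameter, so the difference of the connections is
   Gammabar^i_kj = Gamma^i_kj + delta^i_j phi_k + delta^i_k phi_j.  Comparing
   Ricci tensors, the hypothesis on the Schouten tensors becomes
   nabla_k phi_j = phi_k phi_j + B g_kj - Bbar gbar_kj.  Hence
   S = e^(2 Upsilon) gbar^-1 and lambda = - S phi solve the closed system
     nabla_k S = e_k lambda^T + lambda e_k^T,
     nabla_k lambda = rho e_k - B L e_k        with L = S g.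
   Let V be the curvature of g minus the constant curvature tensor of B.  The
   Ricci identities give [V, L] = 0 and express V lambda by e_k and L e_k, the
   latter with coefficient dB.  If dB = 0 or L is scalar, V lambda is a pure
   trace, and the tracefree part W lambda vanishes.  Suppose W lambda does not
   vanish, hence on an open set.  There the pair symmetry of V forces a
   quadratic equation on the traceless part L0 of L.  Differentiating it gives
   an algebraic identity which for n >= 3 forces L0 = e lambda lambda^flat; since V
   commutes with L0, lambda is null, so L0^2 = 0, and differentiating this last
   equation is absurd.  For n = 2 the projective Weyl tensor is zero. *)

Set Implicit Arguments.
Unset Strict Implicit.
Unset Printing Implicit Defensive.

Import Order.TTheory GRing.Theory Num.Theory.
Import numFieldNormedType.Exports.

Local Open Scope classical_set_scope.
Local Open Scope ring_scope.

(** * Smooth functions *)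

(** The obstacle is that [B] is not assumed constant: for constant [B] the Ricci identity for lambda
    alone would settle the matter. The differential of [B] does harm only where it is nonzero and L
    is not scalar. The constraints on L at such a point become contradictory only after
    differentiation, so they must hold on an open set; this set is cut out by a component of W
    lambda, which is smooth. The quadratic equation arises because L passes through either index
    pair of V: contracted with lambda, this produces a tensor symmetric in two slots and skew in two
    overlapping slots, hence zero. Removing traces leaves only the statement that the tracefree
    square of L is proportional to L0. Cross-multiplied, it can be differentiated whatever the
    regularity of the factor. The final absurdity is a comparison of coefficients, 2 against 4/n.
    Since projective equivalence is stated through curves, the pointwise formula for the connections
    needs a geodesic with arbitrary initial velocity, hence an existence theorem for differential
    equations and the transformation law of the geodesic equation between charts. *)

Section smooth_closure.
Context {R : realType} {n : nat}.
Implicit Types (U : set 'rV[R]_n) (f g : 'rV[R]_n -> R) (h : R -> R).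

Lemma near_in_open U u (P : set 'rV[R]_n) : open U -> U u ->
  (forall v, U v -> P v) -> \forall v \near u, P v.
Proof. by move=> oU Uu UP; apply: filterS (open_nbhs_nbhs (conj oU Uu)). Qed.

Lemma partial_eq_on U f g i u : open U -> U u -> (forall v, U v -> f v = g v) ->
  partial i f u = partial i g u.
Proof. by move=> oU Uu fg; apply: near_eq_derive; exact: near_in_open fg. Qed.

Lemma class_C_eq k U f g : open U -> (forall u, U u -> f u = g u) ->
  class_C k U f -> class_C k U g.
Proof.
move=> oU; elim: k f g => [|k IH] f g fg /=.
  move=> [cf _]; split=> // u Uu.
  have nfg : \forall v \near u, f v = g v by exact: near_in_open fg.
  rewrite /prop_for /continuous_at -(fg u Uu).
  by apply: cvg_trans (cf u Uu); exact: near_eq_cvg nfg.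
move=> [cf df]; split.
  move=> u Uu.
  have nfg : \forall v \near u, f v = g v by exact: near_in_open fg.
  rewrite /prop_for /continuous_at -(fg u Uu).
  by apply: cvg_trans (cf u Uu); exact: near_eq_cvg nfg.
move=> i; have [dfi Ci] := df i; split.
  move=> u Uu; apply: near_eq_derivable (dfi u Uu).
  exact: near_in_open fg.
by apply: (IH (partial i f)) => // u Uu; exact: partial_eq_on fg.
Qed.

Lemma class_CW k U f : class_C k.+1 U f -> class_C k U f.
Proof.
elim: k f => [|k IH] f [cf df]; split=> // i.
by have [dfi Ci] := df i; split=> //; exact: IH.
Qed.

Lemma class_C_cst k U (a : R) : class_C k U (cst a).
Proof.
elim: k a => [|k IH] a; split=> //; try by move=> u Uu; exact: cst_continuous.
move=> i; split=> [u Uu|]; first exact: derivable_cst.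
have -> : partial i (cst a) = cst 0 by apply/funext => u; rewrite /partial derive_cst.
exact: IH.
Qed.

Lemma class_CD k U f g : open U -> class_C k U f -> class_C k U g ->
  class_C k U (fun u => f u + g u).
Proof.
move=> oU; elim: k f g => [|k IH] f g [cf df] [cg dg]; split=> //.
- by move=> u Uu; exact: continuousD (cf u Uu) (cg u Uu).
- by move=> u Uu; exact: continuousD (cf u Uu) (cg u Uu).
move=> i; have [dfi fi] := df i; have [dgi gi] := dg i; split.
  by move=> u Uu; apply: derivableD; [exact: dfi|exact: dgi].
apply: class_C_eq (IH _ _ fi gi) => // u Uu.
by rewrite /partial -deriveD; [|exact: dfi|exact: dgi].
Qed.

Lemma class_CM k U f g : open U -> class_C k U f -> class_C k U g ->
  class_C k U (fun u => f u * g u).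
Proof.
move=> oU; elim: k f g => [|k IH] f g fC gC; have [cf df] := fC;
  have [cg dg] := gC; split=> //.
- by move=> u Uu; exact: continuousM (cf u Uu) (cg u Uu).
- by move=> u Uu; exact: continuousM (cf u Uu) (cg u Uu).
move=> i; have [dfi fi] := df i; have [dgi gi] := dg i; split.
  by move=> u Uu; apply: derivableM; [exact: dfi|exact: dgi].
apply: (class_C_eq oU _ (class_CD oU (IH _ _ (class_CW fC) gi)
                                     (IH _ _ (class_CW gC) fi))) => u Uu.
by rewrite /partial (deriveM (dfi u Uu) (dgi u Uu)).
Qed.

End smooth_closure.

(** * Chain rule and mean value theorem along a line *)

Section directional_derivatives.
Context {R : realType} {V : normedModType R}.
Implicit Types (f : V -> R) (h : R -> R).

Lemma is_derive_line f (a v : V) (t : R) : derivable f (t *: v + a) v ->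
  is_derive t (1 : R) (fun s => f (s *: v + a)) ('D_v f (t *: v + a)).
Proof.
move=> df.
have E : (fun h : R => h^-1 *: (((fun s => f (s *: v + a)) \o shift t) (h *: 1) - f (t *: v + a)))
       = (fun h : R => h^-1 *: ((f \o shift (t *: v + a)) (h *: v) - f (t *: v + a))).
  by apply/funext => h /=; rewrite [_%:A]mulr1 scalerDl addrA.
by split; rewrite /derivable /derive E.
Qed.

(** Only the derivative of [f] along [v] is available, so the chain rule is applied to the
    restriction of [f] to the line through [a]. *)
Lemma is_derive_comp_scalar f h (a v : V) (df dh : R) :
  is_derive a v f df -> is_derive (f a) (1 : R) h dh ->
  is_derive a v (h \o f) (dh * df).
Proof.
move=> [dfa dfE] [dha dhE].
have [dl lE] : is_derive (0 : R) (1 : R) (fun s => f (s *: v + a)) df.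
  by rewrite -dfE -{2}[a]add0r -(scale0r v); apply: is_derive_line; rewrite scale0r add0r.
have dha' : derivable h (f (0 *: v + a)) 1.
  rewrite scale0r add0r; exact: dha.
split.
  apply/derivable1P; apply/derivable1_diffP.
  change (differentiable (h \o (fun s : R => f (s *: v + a))) 0).
  by apply: differentiable_comp; apply/derivable1_diffP; [exact: dl|exact: dha'].
have -> : 'D_v (h \o f) a = (h \o (fun s : R => f (s *: v + a)))^`()%classic 0.
  rewrite derive1E /derive; set g1 := fun k => k^-1 *: _; set g2 := fun k => k^-1 *: _.
  suff -> : g1 = g2 by [].
  by apply/funext => s; rewrite /g1 /g2 /= [_%:A]mulr1 addr0 scale0r add0r.
rewrite derive1_comp; [|exact: dl|exact: dha'].
by rewrite !derive1E lE scale0r add0r dhE.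
Qed.

(** Scaling the intermediate point to [[0, 1]] gives one statement for both signs of [s]. *)
Lemma mean_value_scaled (g dg : R -> R) (s : R) :
  (forall t, 0 <= t <= 1 -> is_derive (t * s) (1 : R) g (dg (t * s))) ->
  exists2 t, 0 <= t <= 1 & g s - g 0 = dg (t * s) * s.
Proof.
move=> gd.
have [s0|s0|<-] := ltgtP 0 s; last first.
- by exists 0; rewrite ?lexx ?ler01// mulr0 subrr.
- have ints (c : R) : c \in `[s, 0] -> 0 <= c / s <= 1 /\ c = (c / s) * s.
    rewrite in_itv /= => /andP[sc c0]; rewrite divfK ?lt_eqF//.
    by rewrite ler_ndivlMr// ler_ndivrMr// mul0r mul1r sc c0.
  have [||c cI E] := @MVT_segment R g dg s 0 (ltW s0).
  + move=> x xI; have [] := ints x.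
      by move: xI; rewrite !in_itv /= => /andP[/ltW -> /ltW ->].
    by move=> xs xE; rewrite xE; exact: gd.
  + apply: derivable_within_continuous => x xI.
    by have [xs ->] := ints x xI; apply: ex_derive; exact: gd.
  + have [cs cE] := ints c cI; exists (c / s) => //.
    by rewrite -cE -opprB E sub0r mulrN opprK.
- have ints (c : R) : c \in `[0, s] -> 0 <= c / s <= 1 /\ c = (c / s) * s.
    rewrite in_itv /= => /andP[sc c0]; rewrite divfK ?gt_eqF//.
    by rewrite ler_pdivlMr// ler_pdivrMr// mul0r mul1r sc c0.
  have [||c cI E] := @MVT_segment R g dg 0 s (ltW s0).
  + move=> x xI; have [] := ints x.
      by move: xI; rewrite !in_itv /= => /andP[/ltW -> /ltW ->].
    by move=> xs xE; rewrite xE; exact: gd.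
  + apply: derivable_within_continuous => x xI.
    by have [xs ->] := ints x xI; apply: ex_derive; exact: gd.
  + have [cs cE] := ints c cI; exists (c / s) => //.
    by rewrite -cE E subr0.
Qed.

End directional_derivatives.

(** * Smoothness of sums, products, inverses, exponentials and logarithms *)

Section smooth_composition.
Context {R : realType} {n : nat}.
Implicit Types (U : set 'rV[R]_n) (f g : 'rV[R]_n -> R).

(** The condition on [h'] stops below [k], so functions whose derivative involves themselves, such
    as the inverse and the exponential, can be treated by strong induction on [k]. *)
Lemma class_C_comp k U f (h h' : R -> R) : open U ->
  (forall u, U u -> is_derive (f u) (1 : R) h (h' (f u))) ->
  class_C k U f -> (forall j, (j < k)%N -> class_C j U (h' \o f)) ->
  class_C k U (h \o f).
Proof.
move=> oU hd.
have ch u : {for u, continuous f} -> U u -> {for u, continuous (h \o f)}.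
  move=> cf Uu; apply: continuous_comp => //.
  apply: differentiable_continuous; apply/derivable1_diffP.
  by apply: ex_derive; exact: hd.
case: k => [|k] [cf df] h'C; split; try by move=> u Uu; apply: ch (cf u Uu) Uu.
  by [].
move=> i; have [dfi fi] := df i.
have D u : U u -> is_derive u (delta_mx 0 i) (h \o f) (h' (f u) * partial i f u).
  by move=> Uu; apply: is_derive_comp_scalar; [exact/derivableP/dfi|exact: hd].
split; first by move=> u Uu; apply: ex_derive; exact: D.
apply: class_C_eq (class_CM oU (h'C k _) fi) => // u Uu.
by rewrite /partial (derive_val (is_derive := D u Uu)).
Qed.

Lemma smooth_derivable U f i u : smooth_on U f -> U u ->
  derivable f u (delta_mx 0 i).
Proof. by move=> sf Uu; have [_ /(_ i)[d _]] := sf 1%N; exact: d. Qed.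

Lemma smooth_continuous U f u : smooth_on U f -> U u -> {for u, continuous f}.
Proof. by move=> sf Uu; have [c _] := sf 0%N; exact: c. Qed.

Lemma smooth_partial U f i : smooth_on U f -> smooth_on U (partial i f).
Proof. by move=> sf k; have [_ /(_ i)[_ c]] := sf k.+1; exact: c. Qed.

Lemma smooth_eq U f g : open U -> (forall u, U u -> f u = g u) ->
  smooth_on U f -> smooth_on U g.
Proof. by move=> oU fg sf k; exact: class_C_eq (sf k). Qed.

Lemma smooth_cst U (a : R) : smooth_on U (cst a).
Proof. by move=> k; exact: class_C_cst. Qed.

Lemma smoothD U f g : open U -> smooth_on U f -> smooth_on U g ->
  smooth_on U (fun u => f u + g u).
Proof. by move=> oU sf sg k; exact: class_CD. Qed.

Lemma smoothM U f g : open U -> smooth_on U f -> smooth_on U g ->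
  smooth_on U (fun u => f u * g u).
Proof. by move=> oU sf sg k; exact: class_CM. Qed.

Lemma smoothZ U (a : R) f : open U -> smooth_on U f -> smooth_on U (fun u => a * f u).
Proof. by move=> oU; apply: smoothM => //; exact: smooth_cst. Qed.

Lemma smoothN U f : open U -> smooth_on U f -> smooth_on U (fun u => - f u).
Proof.
move=> oU sf; apply: smooth_eq (smoothZ (-1) oU sf) => // u Uu.
by rewrite mulN1r.
Qed.

Lemma smoothB U f g : open U -> smooth_on U f -> smooth_on U g ->
  smooth_on U (fun u => f u - g u).
Proof. by move=> oU sf sg; apply: smoothD => //; exact: smoothN. Qed.

Lemma smooth_sum (I : Type) (r : seq I) (P : pred I) U (F : I -> 'rV[R]_n -> R) :
  open U -> (forall i, P i -> smooth_on U (F i)) ->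
  smooth_on U (fun u => \sum_(i <- r | P i) F i u).
Proof.
move=> oU sF; elim: r => [|i r IH].
  by apply: smooth_eq (smooth_cst U 0) => // u _; rewrite big_nil.
case Pi: (P i); last by apply: smooth_eq IH => // u _; rewrite big_cons Pi.
by apply: smooth_eq (smoothD oU (sF i Pi) IH) => // u _; rewrite big_cons Pi.
Qed.

Lemma smooth_prod (I : Type) (r : seq I) (P : pred I) U (F : I -> 'rV[R]_n -> R) :
  open U -> (forall i, P i -> smooth_on U (F i)) ->
  smooth_on U (fun u => \prod_(i <- r | P i) F i u).
Proof.
move=> oU sF; elim: r => [|i r IH].
  by apply: smooth_eq (smooth_cst U 1) => // u _; rewrite big_nil.
case Pi: (P i); last by apply: smooth_eq IH => // u _; rewrite big_cons Pi.
by apply: smooth_eq (smoothM oU (sF i Pi) IH) => // u _; rewrite big_cons Pi.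
Qed.

Lemma smoothV U f : open U -> (forall u, U u -> f u != 0) -> smooth_on U f ->
  smooth_on U (fun u => (f u)^-1).
Proof.
move=> oU f0 sf k; elim/ltn_ind: k => k IH.
apply: (class_C_comp (h := GRing.inv) (h' := fun x => - x ^- 2)) => //.
  move=> u Uu; apply: (@is_derive_eq _ _ _ _ _ _ _ (- (f u) ^- 2 *: (1 : R))).
    by apply: DeriveDef; [apply: derivableV => //; exact: f0|
      rewrite deriveV ?derive_id //; exact: f0].
  by rewrite [LHS]mulr1.
move=> j jk; have Vj := IH j jk.
have := class_CM oU (class_C_cst j U (-1)) (class_CM oU Vj Vj).
apply: class_C_eq => // u Uu /=.
by rewrite mulN1r -invfM.
Qed.

Lemma smooth_expR U f : open U -> smooth_on U f -> smooth_on U (fun u => expR (f u)).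
Proof.
move=> oU sf k; elim/ltn_ind: k => k IH.
by apply: (class_C_comp (h := expR) (h' := expR)).
Qed.

Lemma is_derive_ln_norm (x : R) : x != 0 ->
  is_derive x (1 : R) (fun y => ln `|y|) x^-1.
Proof.
move=> x0; have [xp|xn] : 0 < x \/ x < 0 by move/lt_total: x0 => /orP[]; [right|left].
  apply: (near_eq_is_derive (f := @ln R)) => //; last exact: is_derive1_ln.
  by near=> y; rewrite gtr0_norm//; near: y; exact: lt_nbhsr.
apply: (near_eq_is_derive (f := @ln R \o -%R)) => //.
  by near=> y; rewrite /= ltr0_norm//; near: y; exact: lt_nbhsl.
apply: (@is_derive_eq _ _ _ _ _ _ _ ((- x)^-1 * (- 1))); last by rewrite invrN mulrNN mulr1.
by apply: is_derive_comp_scalar => //; apply: is_derive1_ln; rewrite oppr_gt0.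
Unshelve. all: by end_near. Qed.

Lemma smooth_ln_norm U f : open U -> (forall u, U u -> f u != 0) -> smooth_on U f ->
  smooth_on U (fun u => ln `|f u|).
Proof.
move=> oU f0 sf k; apply: (class_C_comp (h := fun y => ln `|y|) (h' := GRing.inv)) => //.
  by move=> u Uu; apply: is_derive_ln_norm; exact: f0.
by move=> j jk; exact: smoothV.
Qed.

End smooth_composition.

(** * Consequences of continuous partial derivatives: Lipschitz bounds, differentiability, symmetry
    of second partials *)

Section continuously_differentiable.
Context {R : realType} {n : nat}.
Implicit Types (U : set 'rV[R]_n) (f : 'rV[R]_n -> R) (a b u : 'rV[R]_n).

Lemma coord_le_mx_norm u i : `|u 0 i| <= `|u|.
Proof.
rewrite [leRHS]/Num.Def.normr/= mx_normrE.
exact: (le_bigmax _ (fun p : 'I_1 * 'I_n => `|u p.1 p.2|) (0, i)).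
Qed.

Lemma mx_norm_le_coord u (e : R) : 0 <= e -> (forall i, `|u 0 i| <= e) -> `|u| <= e.
Proof.
move=> e0 ue; rewrite [leLHS]/Num.Def.normr/= mx_normrE.
by apply: bigmax_le => // -[i j] _ /=; rewrite (ord1 i).
Qed.

Lemma mx_norm_lt_coord u (e : R) : 0 < e -> (forall i, `|u 0 i| < e) -> `|u| < e.
Proof.
move=> e0 ue; rewrite [ltLHS]/Num.Def.normr/= mx_normrE.
by apply: bigmax_lt => // -[i j] _ /=; rewrite (ord1 i).
Qed.

Let hybrid a b (k : nat) : 'rV[R]_n := \row_j (if (j < k)%N then b 0 j else a 0 j).

Let hybridS a b (i : 'I_n) : hybrid a b i.+1 = (b 0 i - a 0 i) *: delta_mx 0 i + hybrid a b i.
Proof.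
apply/rowP => j; rewrite !mxE eqxx /= ltnS leq_eqVlt.
have [->|/= ij] := eqVneq j i; first by rewrite eqxx ltnn /= mulr1 subrK.
by rewrite (inj_eq val_inj) (negbTE ij) mulr0 add0r.
Qed.

Lemma convex_norm_lt (t p q r : R) : 0 <= t <= 1 -> `|p| < r -> `|q| < r ->
  `|t * (p - q) + q| < r.
Proof.
move=> /andP[t0 t1] pr qr; apply: (@le_lt_trans _ _ (Num.max `|p| `|q|)); last first.
  by rewrite gt_max pr qr.
have : `|p| <= Num.max `|p| `|q| by rewrite le_max lexx.
have : `|q| <= Num.max `|p| `|q| by rewrite le_max lexx orbT.
move: (Num.max _ _) => m; rewrite !ler_norml => /andP[? ?] /andP[? ?].
by apply/andP; split; nra.
Qed.

(** The path from [a] to [b] changes one coordinate at a time, and the mean value theorem applies on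
    each segment. The path stays in the ball because the norm is the maximum norm. *)
Lemma increment_estimate f (c : 'I_n -> R) u (r e : R) :
  (forall z i, `|z - u| < r -> derivable f z (delta_mx 0 i) /\ `|partial i f z - c i| <= e) ->
  forall a b, `|a - u| < r -> `|b - u| < r ->
  `|f b - f a - \sum_i c i * (b 0 i - a 0 i)| <= e * \sum_i `|b 0 i - a 0 i|.
Proof.
move=> fd a b ua ub.
have r0 : 0 < r by apply: le_lt_trans ua.
have step (i : 'I_n) : `|f (hybrid a b i.+1) - f (hybrid a b i) - c i * (b 0 i - a 0 i)|
    <= e * `|b 0 i - a 0 i|.
  set s := b 0 i - a 0 i.
  have near_u t : 0 <= t <= 1 -> `|(t * s) *: delta_mx 0 i + hybrid a b i - u| < r.
    move=> /andP[t0 t1]; apply: mx_norm_lt_coord => // j.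
    have aj : `|a 0 j - u 0 j| < r.
      by apply: le_lt_trans ua; have := coord_le_mx_norm (a - u) j; rewrite !mxE.
    have bj : `|b 0 j - u 0 j| < r.
      by apply: le_lt_trans ub; have := coord_le_mx_norm (b - u) j; rewrite !mxE.
    rewrite !mxE eqxx /=; have [->|ji] := eqVneq j i.
      rewrite ltnn mulr1 -/s.
      have ai : `|a 0 i - u 0 i| < r.
        by apply: le_lt_trans ua; have := coord_le_mx_norm (a - u) i; rewrite !mxE.
      have bi : `|b 0 i - u 0 i| < r.
        by apply: le_lt_trans ub; have := coord_le_mx_norm (b - u) i; rewrite !mxE.
      have -> : t * s + a 0 i - u 0 i
        = t * ((b 0 i - u 0 i) - (a 0 i - u 0 i)) + (a 0 i - u 0 i) by rewrite /s; ring.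
      by apply: convex_norm_lt => //; rewrite t0 t1.
    by rewrite mulr0 add0r; case: ifP.
  have [t t01 E] := @mean_value_scaled R (fun x => f (x *: delta_mx 0 i + hybrid a b i))
    (fun x => partial i f (x *: delta_mx 0 i + hybrid a b i)) s
    (fun t t01 => is_derive_line (fd _ i (near_u t t01)).1).
  rewrite hybridS -/s; move: E; rewrite scale0r add0r => ->.
  by rewrite -mulrBl normrM ler_wpM2r// (fd _ i (near_u t t01)).2.
have -> : f b - f a = \sum_(i < n) (f (hybrid a b i.+1) - f (hybrid a b i)).
  rewrite -(big_mkord xpredT (fun k => f (hybrid a b k.+1) - f (hybrid a b k))) telescope_sumr//.
  congr (f _ - f _); apply/rowP => j; rewrite !mxE ?ltn0//.
  by rewrite ltn_ord.
rewrite -sumrB mulr_sumr; apply: le_trans (ler_norm_sum _ _ _) _.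
by apply: ler_sum => i _; exact: step.
Qed.

Lemma partials_near U f u (e : R) : open U -> U u -> class_C 1 U f -> 0 < e ->
  exists2 r, 0 < r & forall z i, `|z - u| < r ->
    [/\ U z, derivable f z (delta_mx 0 i) & `|partial i f z - partial i f u| <= e].
Proof.
move=> oU Uu [_ df] e0.
have : \forall z \near u, forall i, U z /\ `|partial i f z - partial i f u| <= e.
  apply: (@filter_forall _ 'I_n (fun i z => U z /\ `|partial i f z - partial i f u| <= e)
    (nbhs u) _) => i.
  have [_ [ci _]] := df i.
  have /cvgrPdist_le/(_ e e0) := ci u Uu.
  move=> H; near=> z; split.
    by near: z; exact: open_nbhs_nbhs.
  by rewrite distrC; near: z; exact: H.
move=> /nbhs_normP[r /= r0 rP]; exists r => // z i zu.
have /(_ i)[Uz pz] : forall i, U z /\ `|partial i f z - partial i f u| <= e.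
  by apply: rP; rewrite /ball_ /= distrC.
by split => //; exact: (df i).1.
Unshelve. all: by end_near. Qed.

Lemma sum_coord_le_norm u : \sum_i `|u 0 i| <= n%:R * `|u|.
Proof.
rewrite mulr_natl -[X in _ *+ X]card_ord -sumr_const.
by apply: ler_sum => i _; exact: coord_le_mx_norm.
Qed.

Lemma class_C1_lipschitz U f u : open U -> U u -> class_C 1 U f ->
  exists L r, [/\ 0 <= L, 0 < r & forall a b, `|a - u| < r -> `|b - u| < r ->
    `|f b - f a| <= L * `|b - a|].
Proof.
move=> oU Uu Cf; have [r r0 H] := partials_near oU Uu Cf ltr01.
pose C := \sum_i `|partial i f u|.
have C0 : 0 <= C by exact: sumr_ge0.
exists (n%:R + C), r; split=> //; first exact: addr_ge0.
move=> a b ua ub.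
have := increment_estimate (c := fun i => partial i f u) (e := 1) (u := u) (r := r) (f := f) _ ua ub.
move=> /(_ (fun z i zu => let: And3 _ h1 h2 := H z i zu in conj h1 h2)).
rewrite mul1r => est.
have ab i : b 0 i - a 0 i = (b - a) 0 i by rewrite !mxE.
have s1 : \sum_i `|b 0 i - a 0 i| <= n%:R * `|b - a|.
  by under eq_bigr do rewrite ab; exact: sum_coord_le_norm.
have s2 : `|\sum_i partial i f u * (b 0 i - a 0 i)| <= C * `|b - a|.
  apply: le_trans (ler_norm_sum _ _ _) _; rewrite mulr_suml; apply: ler_sum => i _.
  by rewrite normrM ler_wpM2l// ab coord_le_mx_norm.
rewrite -[f b - f a](subrK (\sum_i partial i f u * (b 0 i - a 0 i))).
apply: le_trans (ler_normD _ _) _; rewrite mulrDl lerD//.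
exact: le_trans est s1.
Qed.

Lemma class_C1_differentiable U f u : open U -> U u -> class_C 1 U f ->
  differentiable f u.
Proof.
move=> oU Uu Cf.
pose df (v : 'rV[R]_n) := \sum_i partial i f u * v 0 i.
have lin_df : linear df.
  move=> a v w; rewrite /df scaler_sumr -big_split /=; apply: eq_bigr => i _.
  by rewrite !mxE mulrDr /GRing.scale /= mulrCA.
pose dfL : {linear 'rV[R]_n -> R} := HB.pack df (GRing.isLinear.Build _ _ _ _ df lin_df).
have cdf : continuous dfL.
  move=> v; apply: differentiable_continuous.
  have -> : (dfL : _ -> _) = \sum_i (partial i f u *: (fun w : 'rV[R]_n => w 0 i)).
    by apply/funext => w; rewrite fct_sumE.
  by apply: differentiable_sum => i; apply: differentiableZ; exact: differentiable_coord.
apply/diffP.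
(* The differential is a chosen value, so it suffices to exhibit one continuous linear map with the
   required expansion. *)
apply: (@getPex _ (fun (df : {linear 'rV[R]_n -> R}) => continuous df /\
  forall y, f y = f (lim (nbhs u)) + df (y - lim (nbhs u))
                  +o_(y \near u) (y - lim (nbhs u)))).
exists dfL; split=> //; rewrite lim_id //.
have H : f = (fun y => f u + dfL (y - u)) +o_ (nbhs u) (center u).
  apply/eqaddoP => e e0.
  (* The sum of the [n] coordinate increments is at most [n] times the norm; dividing by [n.+1] also
     covers [n = 0]. *)
  have e'0 : 0 < e / n.+1%:R by rewrite divr_gt0.
  have [r r0 Hr] := partials_near oU Uu Cf e'0.
  have : \forall z \near u, `|z - u| < r.
    by apply/nbhs_normP; exists r => // z; rewrite /ball_ /= distrC.
  apply: filterS => z zu.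
  have := increment_estimate (c := fun i => partial i f u) (e := e / n.+1%:R) (u := u)
    (r := r) (f := f) (fun z i zu => let: And3 _ h1 h2 := Hr z i zu in conj h1 h2)
    (a := u) (b := z).
  rewrite subrr normr0 => /(_ r0 zu) est.
  have -> : (f - (fun y => f u + dfL (y - u))) z
    = f z - f u - \sum_i partial i f u * (z 0 i - u 0 i).
    rewrite -[LHS]/(f z - (f u + df (z - u))) opprD addrA /df; congr (_ - _).
    by apply: eq_bigr => i _; rewrite !mxE.
  apply: (le_trans est).
  have : \sum_i `|z 0 i - u 0 i| <= n.+1%:R * `|z - u|.
    apply: (@le_trans _ _ (n%:R * `|z - u|)).
      have -> : \sum_i `|z 0 i - u 0 i| = \sum_i `|(z - u) 0 i|.
        by apply: eq_bigr => i _; rewrite !mxE.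
      exact: sum_coord_le_norm.
    by rewrite ler_wpM2r// ler_nat.
  move=> h; have := ler_wpM2l (ltW e'0) h.
  by rewrite mulrA divfK// pnatr_eq0.
by move=> y; exact: (congr1 (fun h => h y) H).
Qed.

(** Two mean value theorems, first along [j], then along [i]. The second difference is symmetric in
    [i] and [j], which is how the symmetry of second partials is obtained. *)
Lemma second_difference f u (r s : R) i j : 0 < s -> s + s < r ->
  (forall z, `|z - u| < r -> derivable f z (delta_mx 0 j) /\
     derivable (partial j f) z (delta_mx 0 i)) ->
  exists2 z, `|z - u| < r &
    f (s *: delta_mx 0 j + (s *: delta_mx 0 i + u)) - f (s *: delta_mx 0 j + u)
    - (f (s *: delta_mx 0 i + u) - f u) = partial i (partial j f) z * s * s.
Proof.
move=> s0 sr fd.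
have dn k : `|delta_mx 0 k : 'rV[R]_n| <= 1.
  by apply: mx_norm_le_coord => // l; rewrite mxE eqxx /=; case: eqP => _; rewrite ?normr1 ?normr0.
have tn (t : R) k : 0 <= t <= 1 -> `|(t * s) *: delta_mx 0 k : 'rV[R]_n| <= s.
  move=> /andP[t0 t1]; rewrite normrZ normrM (ger0_norm t0) (gtr0_norm s0).
  by rewrite mulrAC ler_piMl ?(ltW s0)// mulr_ile1.
have near_u t t' : 0 <= t <= 1 -> 0 <= t' <= 1 ->
    `|(t' * s) *: delta_mx 0 i + ((t * s) *: delta_mx 0 j + u) - u| < r.
  move=> t01 t'01; rewrite addrA addrK; apply: le_lt_trans (ler_normD _ _) _.
  by apply: le_lt_trans sr; apply: lerD; exact: tn.
have o01 : 0 <= (1 : R) <= 1 by rewrite lexx ler01.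
have z01 : 0 <= (0 : R) <= 1 by rewrite lexx ler01.
have fd1 t : 0 <= t <= 1 ->
    derivable f ((t * s) *: delta_mx 0 j + (s *: delta_mx 0 i + u)) (delta_mx 0 j).
  move=> t01; have := (fd _ (near_u t 1 t01 o01)).1.
  by rewrite mul1r addrCA; apply.
have fd0 t : 0 <= t <= 1 -> derivable f ((t * s) *: delta_mx 0 j + u) (delta_mx 0 j).
  move=> t01; have := (fd _ (near_u t 0 t01 z01)).1.
  by rewrite mul0r scale0r add0r; apply.
have [t t01] := @mean_value_scaled R
  (fun x => f (x *: delta_mx 0 j + (s *: delta_mx 0 i + u)) - f (x *: delta_mx 0 j + u))
  (fun x => partial j f (x *: delta_mx 0 j + (s *: delta_mx 0 i + u))
            - partial j f (x *: delta_mx 0 j + u)) s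
  (fun t t01 => is_deriveB (is_derive_line (fd1 t t01)) (is_derive_line (fd0 t t01))).
rewrite scale0r !add0r => ->.
have [t' t'01] := @mean_value_scaled R
  (fun x => partial j f (x *: delta_mx 0 i + ((t * s) *: delta_mx 0 j + u)))
  (fun x => partial i (partial j f) (x *: delta_mx 0 i + ((t * s) *: delta_mx 0 j + u))) s
  (fun t' t'01 => is_derive_line (fd _ (near_u t t' t01 t'01)).2).
rewrite scale0r add0r [s *: _ + _]addrCA => ->.
by exists ((t' * s) *: delta_mx 0 i + ((t * s) *: delta_mx 0 j + u)) => //; exact: near_u.
Qed.

Lemma partialC U f u i j : open U -> U u -> class_C 2 U f ->
  partial i (partial j f) u = partial j (partial i f) u.
Proof.
move=> oU Uu Cf; have [_ df] := Cf.
have Cp k : class_C 1 U (partial k f) by exact: (df k).2.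
apply/eqP; rewrite -subr_eq0 -normr_le0; apply/ler_addgt0Pl => e e0; rewrite addr0.
have e2 : 0 < e / 2 by rewrite divr_gt0.
have close (a b c : R) : `|c - a| <= e / 2 -> `|c - b| <= e / 2 -> `|a - b| <= e.
  rewrite !ler_norml => /andP[? ?] /andP[? ?].
  by apply/andP; split; lra.
have [r1 r10 H1] := partials_near oU Uu (Cp j) e2.
have [r2 r20 H2] := partials_near oU Uu (Cp i) e2.
pose r := Num.min r1 r2; have r0 : 0 < r by rewrite lt_min r10.
have [s s0 sr] : exists2 s, 0 < s & s + s < r.
  by exists (r / 4); [rewrite divr_gt0|lra].
have H z : `|z - u| < r -> [/\ U z, `|partial i (partial j f) z - partial i (partial j f) u| <= e / 2
    & `|partial j (partial i f) z - partial j (partial i f) u| <= e / 2].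
  rewrite lt_min => /andP[z1 z2]; have [Uz _ p1] := H1 z i z1.
  by have [_ _ p2] := H2 z j z2.
have D k l z : `|z - u| < r -> derivable f z (delta_mx 0 l) /\
    derivable (partial l f) z (delta_mx 0 k).
  move=> zr; have [Uz _ _] := H z zr; split; first exact: (df l).1.
  by have [_ /(_ k)[dk _]] := Cp l; exact: dk.
have [z1 z1r E1] := second_difference s0 sr (D i j).
have [z2 z2r E2] := second_difference s0 sr (D j i).
have [_ h1 _] := H z1 z1r; have [_ _ h2] := H z2 z2r.
have E : partial i (partial j f) z1 = partial j (partial i f) z2.
  apply: (mulIf (lt0r_neq0 s0)); apply: (mulIf (lt0r_neq0 s0)).
  have sw (a b c d : R) : a - b - (c - d) = a - c - (b - d) by ring.
  rewrite (addrCA (s *: delta_mx 0 i) (s *: delta_mx 0 j) u) in E2.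
  by apply: etrans (esym E1) (etrans (sw _ _ _ _) E2).
move: h1 h2; rewrite E => h1 h2.
exact: close h1 h2.
Qed.

Lemma derive_line0 (V : normedModType R) (f : V -> R) p v :
  'D_v f p = 'D_1 (fun s : R => f (s *: v + p)) 0.
Proof.
rewrite /derive; set g1 := fun k => k^-1 *: _; set g2 := fun k => k^-1 *: _.
suff -> : g1 = g2 by [].
by apply/funext => s; rewrite /g1 /g2 /= [_%:A]mulr1 addr0 scale0r add0r.
Qed.

Lemma diff_partial f u (v : 'rV[R]_n) : differentiable f u ->
  'd f u v = \sum_i v 0 i * partial i f u.
Proof.
move=> df; rewrite {1}[v]row_sum_delta linear_sum /=; apply: eq_bigr => i _.
by rewrite linearZ /partial deriveE.
Qed.

Lemma is_derive_chain (V : normedModType R) (w : V -> 'rV[R]_n) f p v :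
  (forall i, derivable (fun x => w x 0 i) p v) -> differentiable f (w p) ->
  is_derive p v (f \o w) (\sum_i 'D_v (fun x => w x 0 i) p * partial i f (w p)).
Proof.
move=> wd fd.
pose c (s : R) := w (s *: v + p).
have cd : differentiable c 0.
  apply/derivable1_diffP/derivable_mxP => k i; rewrite (ord1 k).
  exact: (derivable1P (fun x => w x 0 i) p v).1 (wd i).
have c0 : c 0 = w p by rewrite /c scale0r add0r.
have fd' : differentiable f (c 0) by rewrite c0.
have fcd : differentiable (f \o c) 0 by exact: differentiable_comp.
split; first by apply/derivable1P/derivable1_diffP.
rewrite derive_line0 -[LHS]/('D_1 (f \o c) 0) deriveE// diff_comp// -[LHS]/('d f (c 0) ('d c 0 1)).
rewrite (diff_partial _ fd') c0; apply: eq_bigr => i _; congr (_ * _).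
rewrite derive_line0 -deriveE// derive_mx ?mxE//.
exact/derivable1_diffP.
Qed.

End continuously_differentiable.

(** * Computation rules for partial derivatives of smooth functions *)

Section partial_rules.
Context {R : realType} {n : nat} (U : set 'rV[R]_n).
Implicit Types (f g : 'rV[R]_n -> R) (i j : 'I_n) (u : 'rV[R]_n).

Lemma partialD f g i u : smooth_on U f -> smooth_on U g -> U u ->
  partial i (fun v => f v + g v) u = partial i f u + partial i g u.
Proof. by move=> sf sg Uu; apply: deriveD; exact: smooth_derivable. Qed.

Lemma partialN f i u : smooth_on U f -> U u ->
  partial i (fun v => - f v) u = - partial i f u.
Proof. by move=> sf Uu; apply: deriveN; exact: smooth_derivable. Qed.

Lemma partialB f g i u : smooth_on U f -> smooth_on U g -> U u ->
  partial i (fun v => f v - g v) u = partial i f u - partial i g u.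
Proof. by move=> sf sg Uu; apply: deriveB; exact: smooth_derivable. Qed.

Lemma partialM f g i u : smooth_on U f -> smooth_on U g -> U u ->
  partial i (fun v => f v * g v) u = partial i f u * g u + f u * partial i g u.
Proof.
move=> sf sg Uu; rewrite /partial (deriveM (smooth_derivable sf Uu) (smooth_derivable sg Uu)).
by rewrite addrC [X in X + _ = _]mulrC.
Qed.

Lemma partial_cst (a : R) i u : partial i (fun=> a) u = 0.
Proof. exact: derive_cst. Qed.

Lemma partial_comp_scalar (h : R -> R) f i u dh : smooth_on U f -> U u ->
  is_derive (f u) (1 : R) h dh -> partial i (fun v => h (f v)) u = dh * partial i f u.
Proof.
move=> sf Uu hd; have fd := derivableP (smooth_derivable (i := i) sf Uu).
by have [] := is_derive_comp_scalar fd hd.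
Qed.

Lemma partialZ (a : R) f i u : smooth_on U f -> U u ->
  partial i (fun v => a * f v) u = a * partial i f u.
Proof.
move=> sf Uu; rewrite (partialM _ (smooth_cst U a) sf Uu) partial_cst.
by rewrite mul0r add0r.
Qed.

Hypothesis oU : open U.

Lemma partial_sum (I : Type) (r : seq I) (P : pred I) (F : I -> 'rV[R]_n -> R) i u :
  (forall k, P k -> smooth_on U (F k)) -> U u ->
  partial i (fun v => \sum_(k <- r | P k) F k v) u
  = \sum_(k <- r | P k) partial i (F k) u.
Proof.
move=> sF Uu; elim: r => [|k r IH].
  have -> : (fun v => \sum_(k <- [::] | P k) F k v) = (fun=> 0).
    by apply/funext => v; rewrite big_nil.
  by rewrite big_nil partial_cst.
rewrite big_cons -IH; case: ifP => Pk.
  rewrite -(partialD _ (sF k Pk) (smooth_sum r oU sF) Uu); congr (partial i _ u).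
  by apply/funext => v; rewrite big_cons Pk.
by congr (partial i _ u); apply/funext => v; rewrite big_cons Pk.
Qed.

Lemma smooth_partialC f i j u : smooth_on U f -> U u ->
  partial i (partial j f) u = partial j (partial i f) u.
Proof. by move=> sf Uu; exact: partialC (sf 2%N). Qed.

Lemma smooth_differentiable f u : smooth_on U f -> U u -> differentiable f u.
Proof. by move=> sf Uu; exact: class_C1_differentiable (sf 1%N). Qed.

End partial_rules.

(* Unfolding [partial] into a limit makes failing unifications very slow. *)
Opaque partial.

(** * Derivatives of matrix-valued functions *)

Section matrix_calculus.
Context {R : realType} {n : nat} (U : set 'rV[R]_n).
Implicit Types (i j : 'I_n) (u : 'rV[R]_n) (p q r : nat).

Definition dmx p q i (F : 'rV[R]_n -> 'M[R]_(p, q)) u : 'M[R]_(p, q) :=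
  \matrix_(a, b) partial i (fun v => F v a b) u.

Lemma dmxE p q i (F : 'rV[R]_n -> 'M[R]_(p, q)) u a b :
  dmx i F u a b = partial i (fun v => F v a b) u.
Proof. by rewrite mxE. Qed.

Definition smooth_mx p q (F : 'rV[R]_n -> 'M[R]_(p, q)) :=
  forall a b, smooth_on U (fun v => F v a b).

Hypothesis oU : open U.

Lemma dmx_cst p q (A : 'M[R]_(p, q)) i u : dmx i (fun=> A) u = 0.
Proof. by apply/matrixP => a b; rewrite !mxE partial_cst. Qed.

Lemma smooth_mx_cst p q (A : 'M[R]_(p, q)) : smooth_mx (fun=> A).
Proof. by move=> a b; exact: smooth_cst. Qed.

Lemma smooth_mx_eq p q (F G : 'rV[R]_n -> 'M[R]_(p, q)) :
  (forall u, U u -> F u = G u) -> smooth_mx F -> smooth_mx G.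
Proof. by move=> FG sF a b; apply: smooth_eq (sF a b) => // u Uu; rewrite FG. Qed.

Lemma dmx_eq p q (F G : 'rV[R]_n -> 'M[R]_(p, q)) i u :
  U u -> (forall v, U v -> F v = G v) -> dmx i F u = dmx i G u.
Proof.
move=> Uu FG; apply/matrixP => a b; rewrite !mxE.
by apply: partial_eq_on oU Uu _ => v Uv; rewrite FG.
Qed.

Lemma smooth_dmx p q (F : 'rV[R]_n -> 'M[R]_(p, q)) i : smooth_mx F -> smooth_mx (dmx i F).
Proof.
move=> sF a b; apply: smooth_eq (smooth_partial i (sF a b)) => // u Uu.
by rewrite mxE.
Qed.

Lemma dmxC p q (F : 'rV[R]_n -> 'M[R]_(p, q)) i j u : smooth_mx F -> U u ->
  dmx i (dmx j F) u = dmx j (dmx i F) u.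
Proof.
move=> sF Uu; apply/matrixP => a b; rewrite [LHS]dmxE [RHS]dmxE.
have E k : (fun v => dmx k F v a b) = partial k (fun v => F v a b).
  by apply/funext => v; rewrite dmxE.
by rewrite !E; exact: smooth_partialC (sF a b) Uu.
Qed.

Lemma smooth_mxD p q (F G : 'rV[R]_n -> 'M[R]_(p, q)) :
  smooth_mx F -> smooth_mx G -> smooth_mx (fun v => F v + G v).
Proof.
move=> sF sG a b; apply: smooth_eq (smoothD oU (sF a b) (sG a b)) => // u Uu.
by rewrite mxE.
Qed.

Lemma dmxD p q (F G : 'rV[R]_n -> 'M[R]_(p, q)) i u :
  smooth_mx F -> smooth_mx G -> U u ->
  dmx i (fun v => F v + G v) u = dmx i F u + dmx i G u.
Proof.
move=> sF sG Uu; apply/matrixP => a b; rewrite !mxE -(partialD _ (sF a b) (sG a b) Uu).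
by congr (partial i _ u); apply/funext => v; rewrite mxE.
Qed.

Lemma smooth_mxN p q (F : 'rV[R]_n -> 'M[R]_(p, q)) :
  smooth_mx F -> smooth_mx (fun v => - F v).
Proof.
move=> sF a b; apply: smooth_eq (smoothN oU (sF a b)) => // u Uu.
by rewrite mxE.
Qed.

Lemma dmxN p q (F : 'rV[R]_n -> 'M[R]_(p, q)) i u : smooth_mx F -> U u ->
  dmx i (fun v => - F v) u = - dmx i F u.
Proof.
move=> sF Uu; apply/matrixP => a b; rewrite !mxE -(partialN _ (sF a b) Uu).
by congr (partial i _ u); apply/funext => v; rewrite mxE.
Qed.

Lemma smooth_mxB p q (F G : 'rV[R]_n -> 'M[R]_(p, q)) :
  smooth_mx F -> smooth_mx G -> smooth_mx (fun v => F v - G v).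
Proof. by move=> sF sG; apply: smooth_mxD => //; exact: smooth_mxN. Qed.

Lemma dmxB p q (F G : 'rV[R]_n -> 'M[R]_(p, q)) i u :
  smooth_mx F -> smooth_mx G -> U u ->
  dmx i (fun v => F v - G v) u = dmx i F u - dmx i G u.
Proof. by move=> sF sG Uu; rewrite dmxD ?dmxN//; exact: smooth_mxN. Qed.

Lemma smooth_mx_tr p q (F : 'rV[R]_n -> 'M[R]_(p, q)) :
  smooth_mx F -> smooth_mx (fun v => (F v)^T).
Proof. by move=> sF a b; apply: smooth_eq (sF b a) => // u Uu; rewrite mxE. Qed.

Lemma dmx_tr p q (F : 'rV[R]_n -> 'M[R]_(p, q)) i u :
  dmx i (fun v => (F v)^T) u = (dmx i F u)^T.
Proof.
apply/matrixP => a b; rewrite !mxE.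
by congr (partial i _ u); apply/funext => v; rewrite mxE.
Qed.

Lemma smooth_mxM p q r (F : 'rV[R]_n -> 'M[R]_(p, q)) (G : 'rV[R]_n -> 'M[R]_(q, r)) :
  smooth_mx F -> smooth_mx G -> smooth_mx (fun v => F v *m G v).
Proof.
move=> sF sG a b.
apply: (smooth_eq (f := fun u => \sum_k F u a k * G u k b)) => //.
  by move=> u Uu; rewrite mxE.
by apply: smooth_sum => // k _; exact: smoothM.
Qed.

Lemma dmxM p q r (F : 'rV[R]_n -> 'M[R]_(p, q)) (G : 'rV[R]_n -> 'M[R]_(q, r)) i u :
  smooth_mx F -> smooth_mx G -> U u ->
  dmx i (fun v => F v *m G v) u = dmx i F u *m G u + F u *m dmx i G u.
Proof.
move=> sF sG Uu; apply/matrixP => a b; rewrite !mxE.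
have -> : (fun v => (F v *m G v) a b) = (fun v => \sum_k F v a k * G v k b).
  by apply/funext => v; rewrite mxE.
rewrite (partial_sum oU) //; last by move=> k _; exact: smoothM.
rewrite -big_split /=; apply: eq_bigr => k _.
by rewrite (partialM _ (sF a k) (sG k b) Uu) !mxE.
Qed.

Lemma smooth_mxZ p q (f : 'rV[R]_n -> R) (F : 'rV[R]_n -> 'M[R]_(p, q)) :
  smooth_on U f -> smooth_mx F -> smooth_mx (fun v => f v *: F v).
Proof.
move=> sf sF a b; apply: smooth_eq (smoothM oU sf (sF a b)) => // u Uu.
by rewrite mxE.
Qed.

Lemma dmxZ p q (f : 'rV[R]_n -> R) (F : 'rV[R]_n -> 'M[R]_(p, q)) i u :
  smooth_on U f -> smooth_mx F -> U u ->
  dmx i (fun v => f v *: F v) u = partial i f u *: F u + f u *: dmx i F u.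
Proof.
move=> sf sF Uu; apply/matrixP => a b; rewrite !mxE -(partialM _ sf (sF a b) Uu).
by congr (partial i _ u); apply/funext => v; rewrite mxE.
Qed.

Lemma smooth_det p (F : 'rV[R]_n -> 'M[R]_p) : smooth_mx F -> smooth_on U (fun v => \det (F v)).
Proof.
move=> sF; apply: smooth_sum => // s _; apply: smoothZ => //.
by apply: smooth_prod => // k _; exact: sF.
Qed.

Lemma smooth_invmx p (F : 'rV[R]_n -> 'M[R]_p) : (forall u, U u -> F u \in unitmx) ->
  smooth_mx F -> smooth_mx (fun v => invmx (F v)).
Proof.
move=> Fu sF a b.
have sad : smooth_on U (fun v => (\adj (F v)) a b).
  apply: (smooth_eq (f := fun v => (-1) ^+ (b + a) * \det (row' b (col' a (F v))))) => //.
    by move=> v Uv; rewrite mxE.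
  apply: smoothZ => //; apply: smooth_det => k l.
  by apply: smooth_eq (sF (lift b k) (lift a l)) => // v Uv; rewrite !mxE.
have sdi : smooth_on U (fun v => (\det (F v))^-1).
  apply: smoothV => //; last exact: smooth_det.
  by move=> u Uu; have := Fu u Uu; rewrite unitmxE unitfE.
apply: smooth_eq (smoothM oU sdi sad) => // u Uu.
by rewrite /invmx Fu// [RHS]mxE.
Qed.

Lemma partial_prod p (F : 'I_p -> 'rV[R]_n -> R) i u :
  (forall k, smooth_on U (F k)) -> U u ->
  partial i (fun v => \prod_k F k v) u
  = \sum_l \prod_k (if k == l then partial i (F k) u else F k u).
Proof.
elim: p F => [|p IH] F sF Uu.
  have -> : (fun v => \prod_k F k v) = (fun=> 1).
    by apply/funext => v; rewrite big_ord0.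
  by rewrite big_ord0 partial_cst.
have -> : (fun v => \prod_k F k v) = (fun v => F ord0 v * \prod_k F (lift ord0 k) v).
  by apply/funext => v; rewrite big_ord_recl.
rewrite (partialM _ (sF ord0) _ Uu); last by apply: smooth_prod => // k _; exact: sF.
rewrite IH// big_ord_recl big_ord_recl eqxx; congr (_ * _ + _).
by rewrite mulr_sumr; apply: eq_bigr => l _; rewrite big_ord_recl /=; congr (_ * _).
Qed.

(** Jacobi's formula: the product rule differentiates one row at a time, and expansion along that
    row produces the cofactors. *)
Lemma partial_det p (F : 'rV[R]_n -> 'M[R]_p) i u : smooth_mx F -> U u ->
  partial i (fun v => \det (F v)) u = \tr (\adj (F u) *m dmx i F u).
Proof.
move=> sF Uu.
rewrite /determinant (partial_sum oU) //; last first.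
  by move=> s _; apply: smoothZ => //; apply: smooth_prod => // k _; exact: sF.
under eq_bigr => s _.
  rewrite (partialZ (U := U)) //; last by apply: smooth_prod => // k _; exact: sF.
  rewrite (partial_prod (F := fun k v => F v k (s k))) // mulr_sumr; over.
rewrite exchange_big /= mxtrace_mulC /mxtrace; apply: eq_bigr => l _.
pose Fl : 'M[R]_p := \matrix_(a, b) if a == l then dmx i F u a b else F u a b.
transitivity (\det Fl).
  rewrite /determinant; apply: eq_bigr => s _; congr (_ * _); apply: eq_bigr => k _.
  by rewrite !mxE; case: eqP => // ->.
rewrite (expand_det_row _ l) mxE; apply: eq_bigr => b _; rewrite !mxE eqxx; congr (_ * _).
rewrite /cofactor; congr (_ * \det _); apply/matrixP => a' b'; rewrite !mxE.
by rewrite eq_sym (negbTE (neq_lift l a')).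
Qed.

Lemma partial_ln_det p (F : 'rV[R]_n -> 'M[R]_p) i u : smooth_mx F -> U u ->
  (forall v, U v -> F v \in unitmx) ->
  partial i (fun v => ln `|\det (F v)|) u = \tr (invmx (F u) *m dmx i F u).
Proof.
move=> sF Uu Fu.
have d0 : \det (F u) != 0 by have := Fu u Uu; rewrite unitmxE unitfE.
rewrite (partial_comp_scalar i (smooth_det sF) Uu (is_derive_ln_norm d0)).
by rewrite partial_det// /invmx Fu// -scalemxAl mxtraceZ.
Qed.

Lemma dmx_invmx p (F : 'rV[R]_n -> 'M[R]_p) i u : (forall u, U u -> F u \in unitmx) ->
  smooth_mx F -> U u ->
  dmx i (fun v => invmx (F v)) u = - (invmx (F u) *m dmx i F u *m invmx (F u)).
Proof.
move=> Fu sF Uu.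
have := dmxM i (smooth_invmx Fu sF) sF Uu.
rewrite (@dmx_eq _ _ _ (fun=> 1%:M) i u Uu); last by move=> v Uv; rewrite mulVmx ?Fu.
rewrite dmx_cst => /esym/eqP; rewrite addr_eq0 => /eqP E.
by rewrite -[LHS](mulmxK (Fu u Uu)) E mulNmx.
Qed.

End matrix_calculus.

(** * Local existence for ordinary differential equations *)

Section picard.
Context {R : realType}.

(** The integral from 0 to [t]; starting both integrals at -1 allows negative [t]. *)
Definition primitive (f : R -> R) (t : R) : R :=
  (\int[lebesgue_measure]_(s in `[(-1), t]) f s)%R
  - (\int[lebesgue_measure]_(s in `[(-1), 0]) f s)%R.

Lemma primitive0 f : primitive f 0 = 0.
Proof. exact: subrr. Qed.

Lemma is_derive_primitive f t : continuous f -> `|t| < 1 ->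
  is_derive t (1 : R) (primitive f) (f t).
Proof.
move=> cf; rewrite ltr_norml => /andP[t1 t2].
have fi : lebesgue_measure.-integrable `[(-1 : R), 1] (EFin \o f).
  apply: continuous_compact_integrable; first exact: segment_compact.
  by apply: continuous_subspaceT.
have [dF FE] := continuous_FTC1_closed t2 fi t1 (cf t).
have -> : primitive f = (fun x => (\int[lebesgue_measure]_(s in `[(-1), x]) f s)%R)
    + cst (- (\int[lebesgue_measure]_(s in `[(-1), 0]) f s)%R) by [].
apply: (@is_derive_eq _ _ _ _ _ _ _ (f t + 0)); last by rewrite addr0.
apply: is_deriveD; split; first exact: dF.
by rewrite -derive1E.
Qed.

(** A mean value argument applied to the difference of the primitives. *)
Lemma primitive_dist (f g : R -> R) (c t : R) : continuous f -> continuous g -> `|t| < 1 ->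
  (forall s, `|f s - g s| <= c) -> `|primitive f t - primitive g t| <= c * `|t|.
Proof.
move=> cf cg t1 fg.
have D s : 0 <= s <= 1 -> is_derive (s * t) (1 : R) (primitive f - primitive g)
    ((fun x => f x - g x) (s * t)).
  move=> /andP[s0 s1]; have st : `|s * t| < 1.
    by apply: le_lt_trans t1; rewrite normrM ger0_norm// ler_piMl.
  by apply: is_deriveB; exact: is_derive_primitive.
have [s _] := mean_value_scaled (dg := fun x => f x - g x) D.
rewrite -[_ t - _]/(primitive f t - primitive g t - (primitive f 0 - primitive g 0)).
rewrite !primitive0 subrr subr0 => ->.
by rewrite normrM ler_wpM2r.
Qed.

(** Nested intervals: the lower ends [lo k] increase, the upper ends [hi k] decrease, and the limit
    is the supremum of the lower ends. The factor 2 is the sum of the geometric tail. *)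
Lemma geometric_limit (x : nat -> R) (C : R) :
  (forall k, `|x k.+1 - x k| <= C / 2 ^+ k) ->
  exists l, forall k, `|l - x k| <= 2 * C / 2 ^+ k.
Proof.
move=> xC.
have p2 k : 0 < (2 : R) ^+ k by rewrite exprn_gt0.
have C0 : 0 <= C by have := le_trans (normr_ge0 _) (xC 0%N); rewrite expr0 divr1.
have step k : 2 * C / 2 ^+ k = C / 2 ^+ k + 2 * C / 2 ^+ k.+1.
  rewrite exprS; have := p2 k; move: (2 ^+ k) => a a0.
  by field; rewrite ?gt_eqF.
pose lo k := x k - 2 * C / 2 ^+ k; pose hi k := x k + 2 * C / 2 ^+ k.
have lohi k : lo k <= hi k.
  have d0 : 0 <= 2 * C / 2 ^+ k by rewrite divr_ge0 ?mulr_ge0// ltW.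
  by rewrite /lo /hi; lra.
have loS k : lo k <= lo k.+1.
  by rewrite /lo step; have := xC k; rewrite ler_norml => /andP[? ?]; lra.
have hiS k : hi k.+1 <= hi k.
  by rewrite /hi (step k); have := xC k; rewrite ler_norml => /andP[? ?]; lra.
have lom k m : lo k <= lo (k + m)%N.
  by elim: m => [|m IH]; rewrite ?addn0// addnS (le_trans IH).
have him k m : hi (k + m)%N <= hi k.
  by elim: m => [|m IH]; rewrite ?addn0// addnS (le_trans _ IH).
have lohi2 k m : lo k <= hi m.
  apply: le_trans (lom k m) _; apply: le_trans (lohi _) _.
  by rewrite addnC.
have ub m : ubound [set lo k | k in [set: nat]] (hi m).
  by move=> _ [k _ <-].
have ne : [set lo k | k in [set: nat]] !=set0 by exists (lo 0%N); exists 0%N.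
exists (sup [set lo k | k in [set: nat]]) => k.
have h1 : lo k <= sup [set lo k | k in [set: nat]].
  apply: sup_upper_bound; last by exists k.
  by split=> //; exists (hi 0%N).
have h2 : sup [set lo k | k in [set: nat]] <= hi k by exact: ge_sup.
by move: h1 h2; rewrite /lo /hi ler_distl => h1 h2; apply/andP; split; lra.
Qed.

Lemma le0_of_geometric (x C : R) : (forall k, x <= C / 2 ^+ k) -> x <= 0.
Proof.
move=> xC; rewrite leNgt; apply/negP => x0.
have Cx k : x * 2 ^+ k <= C by rewrite -ler_pdivlMr ?exprn_gt0.
have C0 : 0 <= C by apply: le_trans (Cx 0%N); rewrite expr0 mulr1 ltW.
have := archi_boundP (divr_ge0 C0 (ltW x0)).
set k := Num.Def.archi_bound _.
rewrite ltr_pdivrMr// ltNge => /negP; apply.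
apply: le_trans (Cx k); rewrite mulrC ler_wpM2l ?(ltW x0)//.
by rewrite -natrX ler_nat ltnW// ltn_expl.
Qed.

Lemma continuous_row N (w : R -> 'rV[R]_N) t :
  (forall i, {for t, continuous (fun s => w s 0 i)}) -> {for t, continuous w}.
Proof.
move=> cw; apply/cvgrPdist_lt => e e0.
have : \forall s \near t, forall i, `|w t 0 i - w s 0 i| < e.
  apply: (@filter_forall _ 'I_N (fun i s => `|w t 0 i - w s 0 i| < e) (nbhs t) _) => i.
  by have /cvgrPdist_lt := cw i; apply.
by apply: filterS => s ws; apply: mx_norm_lt_coord => // i; rewrite !mxE.
Qed.

(** A 1-Lipschitz retraction onto [[a, b]], used to extend both the time interval and the vector
    field so that they are defined everywhere. *)
Definition clamp (a b x : R) : R := Num.max a (Num.min x b).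

Lemma clamp_itv a b x : a <= b -> a <= clamp a b x <= b.
Proof. by move=> ab; rewrite le_max lexx ge_max ab ge_min lexx orbT. Qed.

Lemma clamp_id a b x : a <= x <= b -> clamp a b x = x.
Proof. by move=> /andP[ax xb]; rewrite /clamp (min_idPl xb) (max_idPr ax). Qed.

Lemma clamp_lipschitz a b x y : `|clamp a b x - clamp a b y| <= `|x - y|.
Proof.
rewrite /clamp.
have min_lip : `|Num.min x b - Num.min y b| <= `|x - y|.
  rewrite !minEle; case: (leP x b) => ?; case: (leP y b) => ?; rewrite ?subrr// ler_norml;
  by case: (ger0P (x - y)) => ?; apply/andP; split; lra.
apply: le_trans min_lip; move: (Num.min x b) (Num.min y b) => {x y} x y.
rewrite !maxEle; case: (leP a x) => ?; case: (leP a y) => ?; rewrite ?subrr// ler_norml;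
by case: (ger0P (x - y)) => ?; apply/andP; split; lra.
Qed.

Lemma lipschitz_continuous (V W : normedModType R) (f : V -> W) (L : R) :
  (forall a b, `|f a - f b| <= L * `|a - b|) -> continuous f.
Proof.
move=> fL x; apply/cvgrPdist_lt => e e0.
have L0 : 0 < `|L| + 1 by rewrite ltr_wpDl.
have d0 : 0 < e / (`|L| + 1) by rewrite divr_gt0.
have : \forall y \near x, `|x - y| < e / (`|L| + 1) by exact: cvgr_dist_lt.
apply: filterS => y xy; apply: le_lt_trans (fL x y) _.
move: xy; rewrite ltr_pdivlMr// mulrC; apply: le_lt_trans.
by rewrite ler_wpM2r// (le_trans (ler_norm L))// lerDl.
Qed.

(** * Picard iteration for a globally Lipschitz field *)

Section global.
Variables (N : nat) (F : 'rV[R]_N -> 'rV[R]_N) (L : R) (z0 : 'rV[R]_N).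
Hypothesis F_lip : forall a b, `|F a - F b| <= L * `|a - b|.

(** This length gives [|L| * h <= 1/2], the contraction factor of the iteration, and stays below 1,
    where [primitive] can be differentiated. *)
Let h : R := (2 * (`|L| + 1))^-1.
Let tau := clamp (- h) h.

Let h_gt0 : 0 < h.
Proof. by rewrite invr_gt0 mulr_gt0// ltr_wpDl. Qed.

Let h_lt1 : h < 1.
Proof. by rewrite invf_lt1 ?mulr_gt0// ?ltr_wpDl//; have := normr_ge0 L; lra. Qed.

Let tau_le t : `|tau t| <= h.
Proof. by rewrite ler_norml clamp_itv// ge0_cp// ltW. Qed.

Let tau_lt1 t : `|tau t| < 1.
Proof. exact: le_lt_trans (tau_le t) h_lt1. Qed.

Let Lh : `|L| * h <= 2^-1.
Proof.
rewrite /h invfM mulrA mulrAC -[leRHS]mul1r ler_wpM2r ?invr_ge0//.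
by rewrite ler_pdivrMr ?mul1r ?lerDl// ltr_wpDl.
Qed.

Let field_along (u : R -> 'rV[R]_N) i (s : R) := F (u s) 0 i.

(** Time is clamped by [tau], so the iterates are continuous on the whole line and the bounds hold
    uniformly in [t]. *)
Let picard_step (u : R -> 'rV[R]_N) (t : R) : 'rV[R]_N :=
  \row_i (z0 0 i + primitive (field_along u i) (tau t)).

Let iterate k := iter k picard_step (cst z0).

Let field_along_cont u i : continuous u -> continuous (field_along u i).
Proof.
move=> cu t; apply: (@continuous_comp _ _ _ (F \o u) (fun z : 'rV[R]_N => z 0 i)).
  by apply: continuous_comp; [exact: cu|exact: lipschitz_continuous F_lip _].
exact: coord_continuous.
Qed.

Let step_cont u : continuous u -> continuous (picard_step u).
Proof.
move=> cu t; apply: continuous_row => i.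
have -> : (fun s => picard_step u s 0 i) =
    (cst (z0 0 i) + primitive (field_along u i)) \o tau.
  by apply/funext => s; rewrite /picard_step mxE.
apply: continuous_comp.
  apply: (@lipschitz_continuous R R tau 1) => x y; rewrite mul1r.
  exact: clamp_lipschitz.
apply: differentiable_continuous; apply/derivable1_diffP.
apply: derivableD; first exact: derivable_cst.
by apply: ex_derive; apply: is_derive_primitive => //; exact: field_along_cont.
Qed.

Let iterate_cont k : continuous (iterate k).
Proof. by elim: k => [|k IH]; [exact: cst_continuous|exact: step_cont]. Qed.

Let step_contract u v c : continuous u -> continuous v -> 0 <= c ->
  (forall t, `|u t - v t| <= c) -> forall t, `|picard_step u t - picard_step v t| <= c / 2.
Proof.
move=> cu cv c0 uv t; apply: mx_norm_le_coord; first by rewrite divr_ge0.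
move=> i; rewrite !mxE opprD addrACA subrr add0r.
have := primitive_dist (@field_along_cont u i cu) (@field_along_cont v i cv) (tau_lt1 t)
  (c := `|L| * c).
have fl s : `|field_along u i s - field_along v i s| <= `|L| * c.
  apply: (@le_trans _ _ `|F (u s) - F (v s)|).
    by have := coord_le_mx_norm (F (u s) - F (v s)) i; rewrite !mxE.
  apply: le_trans (F_lip _ _) _.
  apply: (@le_trans _ _ (`|L| * `|u s - v s|)); first by rewrite ler_wpM2r// ler_norm.
  by rewrite ler_wpM2l.
move=> /(_ fl) H; apply: (le_trans H).
apply: (@le_trans _ _ (`|L| * c * h)); first by rewrite ler_wpM2l// mulr_ge0.
by rewrite mulrAC mulrC ler_wpM2l.
Qed.

Let iterate_dist k t :
  `|iterate k.+1 t - iterate k t| <= `|F z0| / 2 ^+ k.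
Proof.
elim: k t => [|k IH] t.
  rewrite expr0 divr1; apply: mx_norm_le_coord => // i.
  rewrite /iterate /= !mxE addrAC subrr add0r.
  have c0 : continuous (fun _ : R => 0 : R) by exact: cst_continuous.
  have := primitive_dist (@field_along_cont _ i (@cst_continuous _ _ z0)) c0 (tau_lt1 t)
    (c := `|F z0|).
  have -> : primitive (fun=> 0) (tau t) = 0.
    by rewrite /primitive /Rintegral !integral0 subrr.
  rewrite subr0 => H; apply: le_trans (H _) _.
    by move=> s; rewrite subr0 /field_along; exact: coord_le_mx_norm.
  by rewrite ler_piMr// ltW// tau_lt1.
rewrite exprSr invfM mulrA.
apply: (@step_contract (iterate k.+1) (iterate k) _ (@iterate_cont k.+1) (@iterate_cont k) _ IH).
by rewrite divr_ge0.
Qed.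

Lemma picard_global : exists2 u : R -> 'rV[R]_N, u 0 = z0 &
  exists2 e, 0 < e & forall t i, `|t| < e ->
    is_derive t (1 : R) (fun s => u s 0 i) (F (u t) 0 i).
Proof.
have lim_ex t : exists l : 'rV[R]_N, forall k, `|l - iterate k t| <= 2 * `|F z0| / 2 ^+ k.
  have coord i : exists l : R, forall k, `|l - iterate k t 0 i| <= 2 * `|F z0| / 2 ^+ k.
    apply: geometric_limit => k; apply: le_trans (iterate_dist k t).
    by have := coord_le_mx_norm (iterate k.+1 t - iterate k t) i; rewrite !mxE.
  have [l lP] := choice coord.
  exists (\row_i l i) => k; apply: mx_norm_le_coord; first by rewrite divr_ge0// mulr_ge0.
  by move=> i; rewrite !mxE.
have [u uP] := choice lim_ex.
have cu : continuous u.
  move=> t; apply/cvgrPdist_lt => e e0.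
  have [k ke] : exists k, 2 * `|F z0| / 2 ^+ k < e / 3.
    apply: contrapT => nk; have e3 : 0 < e / 3 by rewrite divr_gt0.
    suff : e / 3 <= 0 by rewrite leNgt e3.
    apply: (@le0_of_geometric _ (2 * `|F z0|)) => k; rewrite leNgt; apply/negP => H.
    by apply: nk; exists k.
  have e3 : 0 < e / 3 by rewrite divr_gt0.
  have : \forall s \near t, `|iterate k t - iterate k s| < e / 3.
    by have /cvgrPdist_lt := @iterate_cont k t; apply.
  apply: filterS => s ts.
  have -> : u t - u s = (u t - iterate k t) + ((iterate k t - iterate k s) - (u s - iterate k s)).
    by rewrite opprB !addrA !subrK.
  have -> : e = e / 3 + (e / 3 + e / 3) by lra.
  apply: le_lt_trans (ler_normD _ _) _; apply: ltrD; first exact: le_lt_trans (uP t k) ke.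
  apply: le_lt_trans (ler_normB _ _) _; apply: ltrD => //.
  exact: le_lt_trans (uP s k) ke.
(* Both sides are within a multiple of [2^-k] of the iterate [k.+1], for every [k]. *)
have fix_u t : u t = picard_step u t.
  apply/eqP; rewrite -subr_eq0 -normr_le0.
  apply: (@le0_of_geometric _ (2 * `|F z0|)) => k.
  have -> : u t - picard_step u t
      = (u t - iterate k.+1 t) - (picard_step u t - picard_step (iterate k) t).
    by rewrite -[picard_step (iterate k) t]/(iterate k.+1 t) opprB addrA subrK.
  apply: le_trans (ler_normB _ _) _.
  have H := step_contract cu (@iterate_cont k) (c := 2 * `|F z0| / 2 ^+ k) _ (uP ^~ k) t.
  apply: le_trans (lerD (uP t k.+1) (H _)) _; first by rewrite divr_ge0// mulr_ge0.
  by rewrite exprSr invfM mulrA -splitr.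
have tau0 : tau 0 = 0 by rewrite /tau clamp_id// oppr_le0 (ltW h_gt0).
exists u.
  by rewrite fix_u; apply/rowP => i; rewrite mxE tau0 primitive0 addr0.
exists h => // t i th.
have tau_near : \forall s \near t, tau s = s.
  near=> s; rewrite /tau clamp_id// -ler_norml ltW//; near: s.
  apply: (@cvgr_norm_lt _ _ _ (nbhs t) _ id t) => //.
have -> : F (u t) 0 i = 0 + field_along u i t by rewrite add0r.
apply: (near_eq_is_derive (f := cst (z0 0 i) + primitive (field_along u i))).
  near=> s; rewrite fix_u mxE; have -> // : tau s = s by near: s.
apply: is_deriveD; apply: is_derive_primitive; last exact: lt_trans th h_lt1.
exact: field_along_cont.
Unshelve. all: by end_near. Qed.

End global.

(** The retraction [rho] onto the cube of half-side [r / 2] around [z0] makes the field globally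
    Lipschitz. By continuity the solution stays for a short time where [rho] is the identity. *)
Lemma picard_local N (F : 'rV[R]_N -> 'rV[R]_N) (L r : R) z0 : 0 < r ->
  (forall a b, `|a - z0| < r -> `|b - z0| < r -> `|F a - F b| <= L * `|a - b|) ->
  exists2 u : R -> 'rV[R]_N, u 0 = z0 & exists2 e, 0 < e &
    forall t, `|t| < e -> `|u t - z0| < r /\
      forall i, is_derive t (1 : R) (fun s => u s 0 i) (F (u t) 0 i).
Proof.
move=> r0 FL.
pose rho (z : 'rV[R]_N) : 'rV[R]_N := \row_i clamp (z0 0 i - r / 2) (z0 0 i + r / 2) (z 0 i).
have r2 : 0 < r / 2 by rewrite divr_gt0.
have rho_ball z : `|rho z - z0| < r.
  apply: mx_norm_lt_coord => // i; rewrite !mxE.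
  have := @clamp_itv (z0 0 i - r / 2) (z0 0 i + r / 2) (z 0 i) _.
  move=> /(_ _)/andP[]; first by lra.
  by move=> h1 h2; rewrite ltr_norml; apply/andP; split; lra.
have rho_lip a b : `|rho a - rho b| <= `|a - b|.
  apply: mx_norm_le_coord => // i; rewrite !mxE.
  apply: le_trans (clamp_lipschitz _ _ _ _) _.
  by have := coord_le_mx_norm (a - b) i; rewrite !mxE.
have rho_id z : `|z - z0| < r / 2 -> rho z = z.
  move=> zr; apply/rowP => i; rewrite mxE clamp_id//.
  have := le_lt_trans (coord_le_mx_norm (z - z0) i) zr; rewrite !mxE ltr_norml.
  by move=> /andP[h1 h2]; apply/andP; split; lra.
have G_lip a b : `|(F \o rho) a - (F \o rho) b| <= `|L| * `|a - b|.
  apply: le_trans (FL _ _ (rho_ball a) (rho_ball b)) _.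
  apply: (@le_trans _ _ (`|L| * `|rho a - rho b|)); first by rewrite ler_wpM2r// ler_norm.
  by rewrite ler_wpM2l.
have [u u0 [e e0 ue]] := picard_global z0 G_lip.
have cu : {for 0, continuous u}.
  apply: continuous_row => i; apply: differentiable_continuous; apply/derivable1_diffP.
  by apply: ex_derive; apply: ue; rewrite normr0.
have : \forall t \near (0 : R), `|u t - z0| < r / 2.
  move/cvgrPdist_lt: cu => /(_ _ r2); apply: filterS => t.
  by rewrite u0 distrC.
move=> /nbhs_normP[d /= d0 dP].
exists u => //; exists (Num.min d e); first by rewrite lt_min d0.
move=> t; rewrite lt_min => /andP[td te].
have ut : `|u t - z0| < r / 2 by apply: dP; rewrite /ball_ /= sub0r normrN.
split; first by apply: lt_trans ut _; lra.
move=> i; have := ue t i te; rewrite /= rho_id//.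
Qed.

End picard.

(** * Coordinate changes *)

Section charts.
Context {R : realType} {n : nat} {M : manifold R n}.
Implicit Types (c d : chart R M n) (x : M) (u : 'rV[R]_n).

Definition cimg c : set 'rV[R]_n := cmap c @` cdom c.
Definition overlap c d : set 'rV[R]_n := cmap c @` (cdom c `&` cdom d).

Lemma cimg_dom c u : cimg c u -> cdom c (cinv c u).
Proof. by case=> x xc <-; rewrite cmapK. Qed.

Lemma cinvK c u : cimg c u -> cmap c (cinv c u) = u.
Proof. by case=> x xc <-; rewrite cmapK. Qed.

Lemma cimg_cmap c x : cdom c x -> cimg c (cmap c x).
Proof. by move=> xc; exists x. Qed.

Lemma open_cimg c : open (cimg c).
Proof. exact: cimg_open. Qed.
Arguments open_cimg : clear implicits.

Lemma overlapE c d u : overlap c d u <-> cimg c u /\ cdom d (cinv c u).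
Proof.
split=> [[x [xc xd] <-]|[[x xc <-]]]; first by rewrite cmapK//; split=> //; exists x.
by rewrite cmapK// => xd; exists x.
Qed.

Lemma open_overlap c d : open (overlap c d).
Proof.
rewrite openE => u /overlapE[Uu du]; rewrite /interior.
have nU : \forall v \near u, cimg c v by exact: (near_in_open (open_cimg c) Uu (fun v h => h)).
have nd : \forall v \near u, cdom d (cinv c v).
  exact: (cinv_continuous Uu) _ (open_nbhs_nbhs (conj (cdom_open d) du)).
by apply: filterS2 nU nd => v Uv dv; apply/overlapE.
Qed.
Arguments open_overlap : clear implicits.

Lemma overlap_sub c d u : overlap c d u -> cimg c u.
Proof. by move=> /overlapE[]. Qed.

Lemma smooth_sub (U V : set 'rV[R]_n) (f : 'rV[R]_n -> R) :
  (forall u, V u -> U u) -> smooth_on U f -> smooth_on V f.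
Proof.
move=> VU sf k; elim: k f sf => [|k IH] f sf; split=> //.
- by move=> u Vu; exact: smooth_continuous sf (VU u Vu).
- by move=> u Vu; exact: smooth_continuous sf (VU u Vu).
move=> i; split; first by move=> u Vu; exact: smooth_derivable sf (VU u Vu).
by apply: IH; exact: smooth_partial.
Qed.

Definition coords c d (u : 'rV[R]_n) : 'rV[R]_n := cmap d (cinv c u).

Lemma coords_img c d u : overlap c d u -> overlap d c (coords c d u).
Proof.
move=> /overlapE[Uu du]; apply/overlapE; rewrite /coords cmapK//.
by split; [exact: cimg_cmap|exact: cimg_dom].
Qed.

Lemma cinv_coords c d u : overlap c d u -> cinv d (coords c d u) = cinv c u.
Proof. by move=> /overlapE[Uu du]; rewrite /coords cmapK. Qed.

Lemma smooth_coords c d a : atlas c -> atlas d ->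
  smooth_on (overlap c d) (fun u => coords c d u 0 a).
Proof. by move=> ac ad; exact: atlas_smooth. Qed.

(** The transition matrix written with [partial], ready to be differentiated again. *)
Definition jac c d u : 'M[R]_n := \matrix_(i, a) partial i (fun v => coords c d v 0 a) u.

Lemma smooth_jac c d : atlas c -> atlas d -> smooth_mx (overlap c d) (jac c d).
Proof.
move=> ac ad i a; apply: smooth_eq (smooth_partial i (smooth_coords a ac ad)) => //.
  exact: open_overlap.
by move=> u _; rewrite mxE.
Qed.

Lemma transition_jac c d x : atlas c -> atlas d -> cdom c x -> cdom d x ->
  transition c d x = jac c d (cmap c x).
Proof.
move=> ac ad xc xd; set u := cmap c x.
have Ou : overlap c d u by exists x.
have cd : differentiable (coords c d) u.
  have -> : coords c d = \sum_a (fun v => coords c d v 0 a *: delta_mx 0 a).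
    apply/funext => v; rewrite fct_sumE; apply/rowP => b.
    rewrite summxE (bigD1 b)//= !mxE !eqxx mulr1 big1 ?addr0// => a ab.
    by rewrite !mxE eq_sym (negbTE ab) mulr0.
  apply: differentiable_sum => a; apply: differentiableZl.
  exact: (@smooth_differentiable _ _ (overlap c d) (open_overlap c d)
    (fun z => coords c d z 0 a) u (smooth_coords a ac ad) Ou).
apply/matrixP => i a; rewrite /transition /jacobian -/u !mxE.
rewrite -deriveE// derive_mx ?mxE//; exact: diff_derivable.
Qed.

End charts.
Arguments open_cimg {R n M} c.
Arguments open_overlap {R n M} c d.

Section metric_in_chart.
Context {R : realType} {n : nat} {M : manifold R n} (g : metric M).
Implicit Types (c d : chart R M n) (x : M) (u : 'rV[R]_n).

Definition gmx c u : 'M[R]_n := g c (cinv c u).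

Lemma smooth_gmx c : atlas c -> smooth_mx (cimg c) (gmx c).
Proof. by move=> ac i j; exact: metric_smooth. Qed.

Lemma gmx_unit c u : atlas c -> cimg c u -> gmx c u \in unitmx.
Proof. by move=> ac Uu; apply: metric_nondegenerate => //; exact: cimg_dom. Qed.

Lemma gmx_tr c u : atlas c -> cimg c u -> (gmx c u)^T = gmx c u.
Proof. by move=> ac Uu; exact: (Defs.metric_sym g ac (cimg_dom Uu)). Qed.

Lemma gmx_sym c u i j : atlas c -> cimg c u -> gmx c u i j = gmx c u j i.
Proof. by move=> ac Uu; rewrite -[in LHS](gmx_tr ac Uu) mxE. Qed.

Lemma pdE c i (f : M -> R) u : cimg c u ->
  pd c i f (cinv c u) = partial i (fun v => f (cinv c v)) u.
Proof. by move=> Uu; rewrite /pd cinvK. Qed.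

Lemma dmx_gmx_sym c u m i j : atlas c -> cimg c u ->
  dmx m (gmx c) u i j = dmx m (gmx c) u j i.
Proof.
move=> ac Uu; rewrite [LHS]dmxE [RHS]dmxE; apply: partial_eq_on (open_cimg c) Uu _ => v Uv.
exact: gmx_sym.
Qed.

(** Christoffel symbols of the first kind, with [m] the lowered index. *)
Definition christoffel1 c m i j u : R :=
  2^-1 * (dmx i (gmx c) u j m + dmx j (gmx c) u i m - dmx m (gmx c) u i j).

Lemma christoffelE c k i j u : cimg c u ->
  christoffel g c k i j (cinv c u) = \sum_l invmx (gmx c u) k l * christoffel1 c l i j u.
Proof.
move=> Uu; rewrite /christoffel mulr_sumr; apply: eq_bigr => l _.
rewrite !(pdE _ _ Uu) /christoffel1 [dmx i _ _ _ _]dmxE [dmx j _ _ _ _]dmxE [dmx l _ _ _ _]dmxE.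
by rewrite mulrCA.
Qed.

Lemma christoffel_lower c m i j u : atlas c -> cimg c u ->
  \sum_k gmx c u m k * christoffel g c k i j (cinv c u) = christoffel1 c m i j u.
Proof.
move=> ac Uu; under eq_bigr do rewrite (christoffelE _ _ _ Uu) mulr_sumr.
rewrite exchange_big /=.
under eq_bigr do (under eq_bigr do rewrite mulrA; rewrite -mulr_suml).
have E l : \sum_k gmx c u m k * invmx (gmx c u) k l = (m == l)%:R.
  by have := congr1 (fun A : 'M[R]_n => A m l) (mulmxV (gmx_unit ac Uu)); rewrite !mxE.
under eq_bigr do rewrite E.
rewrite (bigD1 m)//= eqxx mul1r big1 ?addr0// => l lm.
by rewrite eq_sym (negbTE lm) mul0r.
Qed.

Lemma christoffel_sym c k i j u : atlas c -> cimg c u ->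
  christoffel g c k i j (cinv c u) = christoffel g c k j i (cinv c u).
Proof.
move=> ac Uu; rewrite !(christoffelE _ _ _ Uu); apply: eq_bigr => l _; congr (_ * _).
by rewrite /christoffel1 (dmx_gmx_sym l i j ac Uu) [dmx i _ _ _ _ + _]addrC.
Qed.

Lemma smooth_christoffel c k i j : atlas c ->
  smooth_on (cimg c) (fun u => christoffel g c k i j (cinv c u)).
Proof.
move=> ac; have oU := open_cimg c; have sg := smooth_gmx ac.
apply: smooth_eq (oU) (fun u Uu => esym (christoffelE k i j Uu)) _.
apply: smooth_sum => // l _; apply: smoothM => //.
  by apply: smooth_invmx => // u Uu; exact: gmx_unit.
apply: smoothZ => //; apply: smoothB => //; first apply: smoothD => //;
  exact: smooth_dmx.
Qed.

Lemma gmx_transform c d u : atlas c -> atlas d -> overlap c d u ->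
  gmx c u = jac c d u *m gmx d (coords c d u) *m (jac c d u)^T.
Proof.
move=> ac ad Ou; have [Uu du] := (overlapE c d u).1 Ou; have cu := cimg_dom Uu.
rewrite /gmx cinv_coords// (metric_transform g ac ad cu du).
by rewrite transition_jac// cinvK.
Qed.

(** The nondegenerate matrix of the metric in [c] is a product containing the Jacobian as a
    factor. *)
Lemma jac_unit c d u : atlas c -> atlas d -> overlap c d u -> jac c d u \in unitmx.
Proof.
move=> ac ad Ou; have := gmx_unit ac (overlap_sub Ou).
by rewrite (gmx_transform ac ad Ou) !unitmx_mul => /andP[/andP[]].
Qed.

End metric_in_chart.

Opaque dmx.

(** * Transformation of the geodesic equation with its index lowered *)

Section lowered_acceleration.
Context {R : realType} {n : nat}.
Implicit Types (v w : 'rV[R]_n) (dF dJ dh : 'I_n -> 'M[R]_n).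

(** With [dF] the partial derivatives of a metric, this is the first-kind Christoffel symbol
    contracted twice with [v]. *)
Definition lower_form dF v : 'rV[R]_n :=
  \sum_i v 0 i *: (v *m dF i) - 2^-1 *: \row_m (v *m dF m *m v^T) 0 0.

(** The second derivatives of the coordinate change contribute [S1] once to the first sum and twice
    to the halved form, so [S1] cancels and only [q] survives. The symmetry of [dJ] identifies these
    contributions. *)
Lemma lower_form_transform dF dJ dh (J H : 'M[R]_n) v :
  (forall i j a, dJ i j a = dJ j i a) -> H^T = H ->
  (forall i, dF i = dJ i *m H *m J^T + J *m (\sum_a J i a *: dh a) *m J^T
                    + J *m H *m (dJ i)^T) ->
  lower_form dF v =
  ((\sum_i v 0 i *: (v *m dJ i)) *m H + lower_form dh (v *m J)) *m J^T.
Proof.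
move=> dJC HT dFE; set w := v *m J; set q := \sum_i _ *: (v *m dJ i).
pose S1 := \sum_i v 0 i *: (w *m H *m (dJ i)^T).
pose S2 := \row_a (w *m dh a *m w^T) 0 0.
have S1E : S1 = \row_m (w *m H *m (dJ m)^T *m v^T) 0 0.
  apply/rowP => m; rewrite /S1 summxE [RHS]mxE [RHS]mxE.
  under eq_bigr do rewrite mxE [(_ *m _) 0 m]mxE mulr_sumr.
  apply: eq_bigr => i _.
  rewrite [(_ *m (dJ m)^T) 0 i]mxE mulr_suml; apply: eq_bigr => a _.
  by rewrite [_^T a m]mxE [_^T a i]mxE [v^T i 0]mxE (dJC i m a) mulrC.
have E1 : \sum_i v 0 i *: (v *m dF i) = q *m H *m J^T + (\sum_a w 0 a *: (w *m dh a)) *m J^T + S1.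
  rewrite /q /S1 !mulmx_suml.
  have -> : \sum_a (w 0 a *: (w *m dh a)) *m J^T
      = \sum_i v 0 i *: (w *m (\sum_a J i a *: dh a) *m J^T).
    under [RHS]eq_bigr do rewrite mulmx_sumr mulmx_suml scaler_sumr.
    rewrite exchange_big /=; apply: eq_bigr => a _.
    rewrite -scalemxAl [w 0 a]mxE scaler_suml; apply: eq_bigr => i _.
    by rewrite -scalemxAr -scalemxAl scalerA.
  rewrite -!big_split /=; apply: eq_bigr => i _.
  by rewrite dFE !mulmxDr !scalerDr !mulmxA -!scalemxAl.
have E2 : \row_m (v *m dF m *m v^T) 0 0 = S1 + S1 + S2 *m J^T.
  rewrite {2}S1E S1E; apply/rowP => m.
  have -> : (\row_m0 (v *m dF m0 *m v^T) 0 0) 0 m = (v *m dF m *m v^T) 0 0 by rewrite mxE.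
  have -> : v *m dF m *m v^T = (w *m H *m (dJ m)^T *m v^T)^T
      + w *m (\sum_a J m a *: dh a) *m w^T + w *m H *m (dJ m)^T *m v^T.
    by rewrite dFE !mulmxDr !mulmxDl !trmx_mul !trmxK HT !mulmxA.
  have S2E : (w *m (\sum_a J m a *: dh a) *m w^T) 0 0 = (S2 *m J^T) 0 m.
    rewrite mulmx_sumr mulmx_suml summxE mxE; apply: eq_bigr => a _.
    by rewrite -scalemxAr -scalemxAl !mxE mulrC.
  have -> (a b c : 'M[R]_1) : (a + b + c) 0 0 = a 0 0 + b 0 0 + c 0 0 by rewrite !mxE.
  rewrite S2E [_^T 0 0]mxE.
  have -> (a b c : 'rV[R]_n) : (a + b + c) 0 m = a 0 m + b 0 m + c 0 m by rewrite !mxE.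
  have -> : (\row_m0 (w *m H *m (dJ m0)^T *m v^T) 0 0) 0 m = (w *m H *m (dJ m)^T *m v^T) 0 0.
    by rewrite mxE.
  by rewrite addrAC.
rewrite /lower_form E1 E2 -/w -/S2 mulmxDl mulmxBl -scalemxAl !scalerDr.
have -> : 2^-1 *: S1 + 2^-1 *: S1 = S1.
  by rewrite -scalerDl (_ : 2^-1 + 2^-1 = 1 :> R) ?scale1r//; field.
by rewrite opprD !addrA addrK.
Qed.

End lowered_acceleration.

Section christoffel_transformation.
Context {R : realType} {n : nat} {M : manifold R n} (g : metric M).
Implicit Types (c d : chart R M n) (x : M) (u v w : 'rV[R]_n).

Definition geodesic_term c v u : 'rV[R]_n :=
  \row_k \sum_(i < n) \sum_(j < n) christoffel g c k i j (cinv c u) * v 0 i * v 0 j.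

Definition lower_term (F : 'rV[R]_n -> 'M[R]_n) v u : 'rV[R]_n :=
  lower_form (fun i => dmx i F u) v.

Lemma geodesic_term_lower c v u : atlas c -> cimg c u ->
  geodesic_term c v u *m gmx g c u = lower_term (gmx g c) v u.
Proof.
move=> ac Uu; apply/rowP => m; rewrite !mxE.
pose D i j := dmx i (gmx g c) u j m.
transitivity (\sum_i \sum_j v 0 i * v 0 j * christoffel1 g c m i j u).
  under eq_bigr do rewrite mxE mulr_suml.
  rewrite exchange_big /=; apply: eq_bigr => i _.
  under eq_bigr do rewrite mulr_suml.
  rewrite exchange_big /=; apply: eq_bigr => j _.
  rewrite -(christoffel_lower g m i j ac Uu) mulr_sumr; apply: eq_bigr => k _.
  rewrite (gmx_sym g m k ac Uu); ring.
have E1 : \sum_i \sum_j v 0 i * v 0 j * D j i = \sum_i \sum_j v 0 i * v 0 j * D i j.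
  by rewrite exchange_big /=; do 2 (apply: eq_bigr => ? _); rewrite [v 0 _ * _]mulrC.
have -> : \sum_i \sum_j v 0 i * v 0 j * christoffel1 g c m i j u
    = 2^-1 * (\sum_i \sum_j v 0 i * v 0 j * D i j)
      + 2^-1 * (\sum_i \sum_j v 0 i * v 0 j * D j i)
      - 2^-1 * \sum_i \sum_j v 0 i * v 0 j * dmx m (gmx g c) u i j.
  rewrite !mulr_sumr -big_split -sumrB /=; apply: eq_bigr => i _.
  rewrite !mulr_sumr -big_split -sumrB /=; apply: eq_bigr => j _.
  rewrite -[christoffel1 _ _ _ _ _ _]/(2^-1 * (D i j + D j i - dmx m (gmx g c) u i j)).
  by move: (D i j) (D j i) (dmx m (gmx g c) u i j) => a b e; ring.
rewrite E1 -mulrDl (_ : 2^-1 + 2^-1 = 1 :> R) ?mul1r; last by field.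
congr (_ - _ * _).
  rewrite summxE; apply: eq_bigr => i _; rewrite !mxE mulr_sumr; apply: eq_bigr => j _.
  by rewrite mulrA.
rewrite exchange_big /=; apply: eq_bigr => j _.
rewrite mxE mulr_suml; apply: eq_bigr => i _.
by rewrite [v^T _ _]mxE mulrAC.
Qed.

Lemma partial_coords c d (f : 'rV[R]_n -> R) i u : atlas c -> atlas d -> overlap c d u ->
  smooth_on (cimg d) f ->
  partial i (f \o coords c d) u = \sum_a jac c d u i a * partial a f (coords c d u).
Proof.
move=> ac ad Ou sf.
have Od := overlap_sub (coords_img Ou).
have H := is_derive_chain (w := coords c d) (f := f) (p := u) (v := delta_mx 0 i)
  (fun a => smooth_derivable (smooth_coords a ac ad) Ou)
  (smooth_differentiable (open_cimg d) sf Od).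
rewrite -[LHS]/('D_(delta_mx 0 i) (f \o coords c d) u).
have [_ ->] := H.
by apply: eq_bigr => a _; rewrite mxE.
Qed.

Lemma dmx_coords c d p q (F : 'rV[R]_n -> 'M[R]_(p, q)) i u :
  atlas c -> atlas d -> overlap c d u -> smooth_mx (cimg d) F ->
  dmx i (F \o coords c d) u = \sum_a jac c d u i a *: dmx a F (coords c d u).
Proof.
move=> ac ad Ou sF; apply/matrixP => k l; rewrite [LHS]dmxE summxE.
have -> : (fun v => (F \o coords c d) v k l) = (fun v => F v k l) \o coords c d by [].
rewrite (partial_coords i ac ad Ou (sF k l)); apply: eq_bigr => a _.
by rewrite [RHS]mxE [dmx a F _ k l]dmxE.
Qed.

Definition second_order_term c d v u : 'rV[R]_n := \sum_i v 0 i *: (v *m dmx i (jac c d) u).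

Lemma dmx_jacC c d i j a u : atlas c -> atlas d -> overlap c d u ->
  dmx i (jac c d) u j a = dmx j (jac c d) u i a.
Proof.
move=> ac ad Ou; rewrite [LHS]dmxE [RHS]dmxE.
have E k : (fun v => jac c d v k a) = partial k (fun v => coords c d v 0 a).
  by apply/funext => v; rewrite mxE.
rewrite !E.
exact: (smooth_partialC (open_overlap c d) i j (smooth_coords a ac ad) Ou).
Qed.

Lemma lower_term_transform c d v u : atlas c -> atlas d -> overlap c d u ->
  let w := v *m jac c d u in
  lower_term (gmx g c) v u =
  (second_order_term c d v u *m gmx g d (coords c d u)
   + lower_term (gmx g d) w (coords c d u)) *m (jac c d u)^T.
Proof.
move=> ac ad Ou w; have oO := open_overlap c d.
have Od := overlap_sub (coords_img Ou).
pose J := jac c d; pose H := gmx g d \o coords c d.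
have sJ : smooth_mx (overlap c d) J by exact: smooth_jac.
have sJT := smooth_mx_tr oO sJ.
have sG : smooth_mx (overlap c d) (gmx g c).
  by move=> k l; apply: smooth_sub (smooth_gmx g ac k l) => z; exact: overlap_sub.
have JU z : overlap c d z -> J z \in unitmx by exact: (jac_unit g).
have sVJ := smooth_invmx oO JU sJ.
(* The pulled-back metric is smooth because it equals [J^-1 G J^-T], whose factors are known to be
   smooth. *)
have sH : smooth_mx (overlap c d) H.
  have sH' := smooth_mxM oO (smooth_mxM oO sVJ sG) (smooth_mx_tr oO sVJ).
  apply: (smooth_mx_eq oO _ sH') => z Oz; rewrite -[RHS]/(H z).
  rewrite (gmx_transform g ac ad Oz) -/(J z) -/(H z) trmx_inv !mulmxA mulVmx ?JU// mul1mx.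
  by rewrite mulmxK// unitmx_tr JU.
have DH i : dmx i H u = \sum_a J u i a *: dmx a (gmx g d) (coords c d u).
  by apply: dmx_coords => //; exact: smooth_gmx.
have DG i : dmx i (gmx g c) u
    = dmx i J u *m H u *m (J u)^T + J u *m (\sum_a J u i a *: dmx a (gmx g d) (coords c d u)) *m (J u)^T
      + J u *m H u *m (dmx i J u)^T.
  rewrite (@dmx_eq _ _ _ oO _ _ _ (fun z => J z *m H z *m (J z)^T) i u Ou); last first.
    by move=> z Oz; exact: gmx_transform.
  rewrite (dmxM oO _ (smooth_mxM oO sJ sH) sJT Ou) (dmxM oO _ sJ sH Ou).
  by rewrite (dmx_tr (R := R)) mulmxDl DH.
have HT : (H u)^T = H u by exact: gmx_tr.
exact: (lower_form_transform (dJ := fun i => dmx i J u) v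
  (fun i j a => dmx_jacC i j a ac ad Ou) HT DG).
Qed.

(** The transformation law of a connection contracted twice with [v], which is all that the geodesic
    equation sees. Metric and Jacobian are invertible and cancel from the lowered law. *)
Lemma geodesic_term_transform c d v u : atlas c -> atlas d -> overlap c d u ->
  geodesic_term c v u *m jac c d u =
  second_order_term c d v u + geodesic_term d (v *m jac c d u) (coords c d u).
Proof.
move=> ac ad Ou; have Uu := overlap_sub Ou; have Od := overlap_sub (coords_img Ou).
have Ju := jac_unit g ac ad Ou.
have Hu := gmx_unit g ad Od.
have JTu : (jac c d u)^T \in unitmx by rewrite unitmx_tr.
have := geodesic_term_lower v ac Uu.
rewrite (gmx_transform g ac ad Ou) (lower_term_transform v ac ad Ou).
rewrite -(geodesic_term_lower _ ad Od) -mulmxDl !mulmxA.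
by move=> /(can_inj (mulmxK JTu)) /(can_inj (mulmxK Hu)).
Qed.

End christoffel_transformation.

(** * Locally Lipschitz functions *)

Section local_lipschitz.
Context {R : realType}.

Definition lipschitz_at N (f : 'rV[R]_N -> R) (z : 'rV[R]_N) : Prop :=
  exists L r, [/\ 0 <= L, 0 < r & forall a b, `|a - z| < r -> `|b - z| < r ->
    `|f b - f a| <= L * `|b - a|].

Lemma lipschitz_atD N (f g : 'rV[R]_N -> R) z : lipschitz_at f z -> lipschitz_at g z ->
  lipschitz_at (fun x => f x + g x) z.
Proof.
move=> [L [r [L0 r0 H]]] [L' [r' [L'0 r'0 H']]].
exists (L + L'), (Num.min r r'); split; rewrite ?addr_ge0 ?lt_min ?r0//.
move=> a b; rewrite !lt_min => /andP[ar ar'] /andP[br br'].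
rewrite opprD addrACA mulrDl; apply: le_trans (ler_normD _ _) _.
by rewrite lerD// ?H ?H'.
Qed.

Lemma lipschitz_at_cst N (c : R) (z : 'rV[R]_N) : lipschitz_at (fun=> c) z.
Proof.
exists 0, 1; split=> // a b _ _; by rewrite subrr normr0 mul0r.
Qed.

Lemma lipschitz_atM N (f g : 'rV[R]_N -> R) z : lipschitz_at f z -> lipschitz_at g z ->
  lipschitz_at (fun x => f x * g x) z.
Proof.
move=> [L [r [L0 r0 H]]] [L' [r' [L'0 r'0 H']]].
pose F := `|f z| + L * r; pose G := `|g z| + L' * r'.
have F0 : 0 <= F by rewrite addr_ge0// mulr_ge0// ltW.
have G0 : 0 <= G by rewrite addr_ge0// mulr_ge0// ltW.
have bound (k : 'rV[R]_N -> R) K s : 0 <= K -> 0 < s ->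
    (forall a b, `|a - z| < s -> `|b - z| < s -> `|k b - k a| <= K * `|b - a|) ->
    forall a, `|a - z| < s -> `|k a| <= `|k z| + K * s.
  move=> K0 s0 kK a az; rewrite -[k a](subrK (k z)) addrC.
  apply: le_trans (ler_normD _ _) _; rewrite lerD2l.
  apply: le_trans (kK z a _ az) _; first by rewrite subrr normr0.
  by rewrite ler_wpM2l// ltW.
exists (L * G + F * L'), (Num.min r r'); split; rewrite ?addr_ge0 ?mulr_ge0 ?lt_min ?r0//.
move=> a b; rewrite !lt_min => /andP[ar ar'] /andP[br br'].
have -> : f b * g b - f a * g a = (f b - f a) * g b + f a * (g b - g a).
  by rewrite mulrBl mulrBr addrA subrK.
rewrite [leRHS]mulrDl; apply: le_trans (ler_normD _ _) _; rewrite !normrM.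
have h1 := H a b ar br; have h2 := H' a b ar' br'.
have h3 := bound g L' r' L'0 r'0 H' b br'; have h4 := bound f L r L0 r0 H a ar.
apply: lerD.
  by rewrite mulrAC ler_pM.
by rewrite -mulrA ler_pM.
Qed.

Lemma lipschitz_at_sum N (I : Type) (s : seq I) (f : I -> 'rV[R]_N -> R) z :
  (forall i, lipschitz_at (f i) z) -> lipschitz_at (fun x => \sum_(i <- s) f i x) z.
Proof.
move=> fz; elim: s => [|i s IH].
  have -> : (fun x => \sum_(i <- [::]) f i x) = fun=> 0.
    by apply/funext => x; rewrite big_nil.
  exact: lipschitz_at_cst.
have -> : (fun x => \sum_(j <- i :: s) f j x) = fun x => f i x + \sum_(j <- s) f j x.
  by apply/funext => x; rewrite big_cons.
exact: lipschitz_atD.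
Qed.

Lemma lipschitz_at_coord N i (z : 'rV[R]_N) : lipschitz_at (fun x => x 0 i) z.
Proof.
exists 1, 1; split=> // a b _ _; rewrite mul1r.
by have := coord_le_mx_norm (b - a) i; rewrite !mxE.
Qed.

Lemma lipschitz_at_comp N K (p : 'rV[R]_N -> 'rV[R]_K) (f : 'rV[R]_K -> R) z :
  (forall a b, `|p a - p b| <= `|a - b|) -> lipschitz_at f (p z) ->
  lipschitz_at (f \o p) z.
Proof.
move=> pl [L [r [L0 r0 H]]]; exists L, r; split=> // a b az bz /=.
apply: le_trans (H _ _ _ _) _; try exact: le_lt_trans (pl _ _) _.
by rewrite ler_wpM2l.
Qed.

Lemma lipschitz_at_row N K (F : 'rV[R]_N -> 'rV[R]_K) z :
  (forall i, lipschitz_at (fun x => F x 0 i) z) ->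
  exists L r, 0 < r /\ forall a b, `|a - z| < r -> `|b - z| < r ->
    `|F a - F b| <= L * `|a - b|.
Proof.
move=> /choice[L] /choice[r H].
exists (\sum_i L i), (\big[Num.min/1]_i r i); split.
  by apply: lt_bigmin => // i _; have [] := H i.
move=> a b az bz; have L0 i : 0 <= L i by have [] := H i.
apply: mx_norm_le_coord; first by rewrite mulr_ge0// sumr_ge0.
move=> i; rewrite !mxE; have [_ _ Hi] := H i.
apply: le_trans (Hi b a _ _) _.
- by apply: lt_le_trans bz _; exact: bigmin_le_cond.
- by apply: lt_le_trans az _; exact: bigmin_le_cond.
by rewrite ler_wpM2r// (bigD1 i)//= lerDl sumr_ge0.
Qed.

Lemma norm_lsubmx_le N K (a : 'rV[R]_(N + K)) : `|lsubmx a| <= `|a|.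
Proof. by apply: mx_norm_le_coord => // i; rewrite mxE coord_le_mx_norm. Qed.

End local_lipschitz.

(** * Existence of geodesics with given initial position and velocity *)

Section geodesics.
Context {R : realType} {n : nat} {M : manifold R n} (g : metric M).
Implicit Types (c d : chart R M n) (x : M) (u v : 'rV[R]_n).

(** The geodesic equation as a first-order system for position (left half) and velocity (right
    half). *)
Definition geodesic_field c (z : 'rV[R]_(n + n)) : 'rV[R]_(n + n) :=
  row_mx (rsubmx z) (- geodesic_term g c (rsubmx z) (lsubmx z)).

Lemma geodesic_field_lipschitz c u v : atlas c -> cimg c u ->
  exists L r, 0 < r /\ forall a b, `|a - row_mx u v| < r -> `|b - row_mx u v| < r ->
    `|geodesic_field c a - geodesic_field c b| <= L * `|a - b|.
Proof.
move=> ac Uu; apply: lipschitz_at_row => i; rewrite /geodesic_field.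
have lip_r j : lipschitz_at (fun z : 'rV[R]_(n + n) => rsubmx z 0 j) (row_mx u v).
  have -> : (fun z : 'rV[R]_(n + n) => rsubmx z 0 j) = fun z => z 0 (rshift n j).
    by apply/funext => z; rewrite mxE.
  exact: lipschitz_at_coord.
case: (splitP i) => j ij.
  have -> : i = lshift n j by exact: val_inj.
  have -> // : (fun z : 'rV[R]_(n + n) => row_mx (rsubmx z) (- geodesic_term g c (rsubmx z) (lsubmx z))
      0 (lshift n j)) = fun z => rsubmx z 0 j by apply/funext => z; rewrite row_mxEl.
have -> : i = rshift n j by exact: val_inj.
have -> : (fun z : 'rV[R]_(n + n) => row_mx (rsubmx z) (- geodesic_term g c (rsubmx z) (lsubmx z))
    0 (rshift n j)) = fun z => (-1) * \sum_a \sum_b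
      ((fun y => christoffel g c j a b (cinv c y)) \o lsubmx) z * rsubmx z 0 a * rsubmx z 0 b.
  by apply/funext => z; rewrite row_mxEr mulN1r !mxE.
apply: lipschitz_atM; first exact: lipschitz_at_cst.
apply: lipschitz_at_sum => a; apply: lipschitz_at_sum => b.
apply: lipschitz_atM => //; apply: lipschitz_atM => //.
apply: lipschitz_at_comp; first by move=> p q; rewrite -linearB norm_lsubmx_le.
rewrite row_mxKl; apply: class_C1_lipschitz (open_cimg c) Uu _.
exact: smooth_christoffel.
Qed.

(** [geodesic] requires the equation in every chart that meets the curve. A solution in [c] is
    therefore carried to each chart [d] by differentiating the coordinate change twice along it. *)
Lemma geodesic_exists c u v : atlas c -> cimg c u ->
  exists e (w p : R -> 'rV[R]_n), [/\ 0 < e, w 0 = u, p 0 = v,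
    geodesic g [set t | `|t| < e] (cinv c \o w) &
    forall t, `|t| < e -> [/\ cimg c (w t),
      forall k, is_derive t (1 : R) (fun s => w s 0 k) (p t 0 k) &
      forall k, is_derive t (1 : R) (fun s => p s 0 k) (- geodesic_term g c (p t) (w t) 0 k)]].
Proof.
move=> ac Uu.
have [L [r [r0 FL]]] := geodesic_field_lipschitz v ac Uu.
have [r' r'0 rU] : exists2 r', 0 < r' & forall y, `|y - u| < r' -> cimg c y.
  have : \forall y \near u, cimg c y by exact: (near_in_open (open_cimg c) Uu (fun v h => h)).
  move=> /nbhs_normP[r' /= r'0 H]; exists r' => // y yu; apply: H.
  by rewrite /ball_ /= distrC.
pose r2 := Num.min r r'.
have r20 : 0 < r2 by rewrite lt_min r0.
have FL2 a b : `|a - row_mx u v| < r2 -> `|b - row_mx u v| < r2 ->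
    `|geodesic_field c a - geodesic_field c b| <= L * `|a - b|.
  by rewrite !lt_min => /andP[? _] /andP[? _]; exact: FL.
have [z z0 [e e0 ze]] := picard_local r20 FL2.
pose w t := lsubmx (z t); pose p t := rsubmx (z t).
exists e, w, p.
have wU t : `|t| < e -> cimg c (w t).
  move=> te; have [zr _] := ze t te; apply: rU.
  move: zr; rewrite lt_min => /andP[_]; apply: le_lt_trans.
  have -> : w t - u = lsubmx (z t - row_mx u v) by rewrite linearB /= row_mxKl.
  exact: norm_lsubmx_le.
have wd t k : `|t| < e -> is_derive t (1 : R) (fun s => w s 0 k) (p t 0 k).
  move=> te; have [_ /(_ (lshift n k))] := ze t te.
  rewrite /geodesic_field row_mxEl.
  by have -> : (fun s => w s 0 k) = (fun s => z s 0 (lshift n k)) by apply/funext => s; rewrite mxE.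
have pd t k : `|t| < e ->
    is_derive t (1 : R) (fun s => p s 0 k) (- geodesic_term g c (p t) (w t) 0 k).
  move=> te; have [_ /(_ (rshift n k))] := ze t te.
  have -> : geodesic_field c (z t) 0 (rshift n k) = - geodesic_term g c (p t) (w t) 0 k.
    by rewrite /geodesic_field row_mxEr mxE.
  by have -> : (fun s => p s 0 k) = (fun s => z s 0 (rshift n k)) by apply/funext => s; rewrite mxE.
have wder s i : `|s| < e -> derivable (fun s => w s 0 i) s (1 : R).
  by move=> se; apply: ex_derive; exact: wd.
have wc t : `|t| < e -> {for t, continuous w}.
  move=> te; apply: continuous_row => i; apply: differentiable_continuous.
  by apply/derivable1_diffP; apply: ex_derive; exact: wd.
have near_e (t : R) : `|t| < e -> \forall s \near t, `|s| < e.
  by move=> te; apply: (@cvgr_norm_lt _ _ _ (nbhs t) _ id t).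
split=> //.
- by rewrite /w z0 row_mxKl.
- by rewrite /p z0 row_mxKr.
2: by move=> t te; split=> [|k|k]; [exact: wU|exact: wd|exact: pd].
split=> [t te|d t ad te dt /=].
  by apply: continuous_comp; [exact: wc|exact: cinv_continuous (wU t te)].
have Ot : overlap c d (w t) by apply/overlapE; split=> //; exact: wU.
have nearO : \forall s \near t, overlap c d (w s).
  exact: (wc t te) _ (near_in_open (open_overlap c d) Ot (fun v h => h)).
pose y k q := coords c d q 0 k.
have sy k : smooth_on (overlap c d) (y k) by exact: smooth_coords.
have D1 s k : `|s| < e -> overlap c d (w s) ->
    is_derive s (1 : R) (y k \o w) (\sum_i p s 0 i * partial i (y k) (w s)).
  move=> se Os.
  have := is_derive_chain (w := w) (f := y k) (p := s) (v := (1 : R))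
    (fun i => wder s i se) (smooth_differentiable (open_overlap c d) (sy k) Os).
  congr (is_derive _ _ _ _); apply: eq_bigr => i _; congr (_ * _).
  by have [_ ->] := wd s i se.
pose dy k s := \sum_i p s 0 i * partial i (y k) (w s).
(* The first derivative is needed near [t] and not only at [t], since it is differentiated once
   more. *)
have D1E k : \forall s \near t, dy k s = derive1 (y k \o w) s.
  near=> s; rewrite derive1E.
  have [||_ ->//] := D1 s k; first by near: s; exact: near_e.
  by near: s; exact: nearO.
have D2 k : is_derive t (1 : R) (dy k)
    (\sum_i (- geodesic_term g c (p t) (w t) 0 i * partial i (y k) (w t)
       + p t 0 i * \sum_j p t 0 j * partial j (partial i (y k)) (w t))).
  have -> : dy k = \sum_i ((fun s => p s 0 i) * (partial i (y k) \o w)).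
    by apply/funext => s; rewrite fct_sumE.
  apply: is_derive_sum => i.
  have := is_derive_chain (w := w) (f := partial i (y k)) (p := t) (v := (1 : R))
    (fun j => wder t j te)
    (smooth_differentiable (open_overlap c d) (smooth_partial i (sy k)) Ot).
  move=> H; have := is_deriveM (pd t i te) H.
  congr (is_derive _ _ _ _); rewrite addrC; congr (_ + _).
    by rewrite [LHS]mulrC.
  rewrite -[LHS]/(p t 0 i * _); congr (_ * _); apply: eq_bigr => j _; congr (_ * _).
  by have [_ ->] := wd t j te.
have D1t k : derive1 (y k \o w) t = (p t *m jac c d (w t)) 0 k.
  rewrite derive1E; have [_ ->] := D1 t k te Ot.
  by rewrite mxE; apply: eq_bigr => i _; rewrite [jac _ _ _ _ _]mxE.
have D2t k : is_derive t (1 : R) (derive1 (y k \o w))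
   ((- (geodesic_term g c (p t) (w t) *m jac c d (w t)) + second_order_term c d (p t) (w t)) 0 k).
  have := near_eq_is_derive (D1E k) (D2 k).
  congr (is_derive _ _ _ _); rewrite mxE big_split /=; congr (_ + _).
    rewrite [RHS]mxE [in RHS]mxE -sumrN; apply: eq_bigr => i _.
    by rewrite mulNr [jac _ _ _ _ _]mxE.
  rewrite /second_order_term summxE; apply: eq_bigr => i _; rewrite [RHS]mxE; congr (_ * _).
  rewrite [RHS]mxE; apply: eq_bigr => j _; congr (_ * _).
  rewrite dmxE; have -> : (fun v => jac c d v j k) = partial j (y k).
    by apply/funext => q; rewrite mxE.
  exact: (smooth_partialC (open_overlap c d) j i (sy k) Ot).
split=> [k|k].
  split; first by apply: ex_derive; exact: D1.
  by apply: ex_derive; exact: D2t.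
rewrite derive1E.
have [_ ->] := D2t k.
have -> : - (geodesic_term g c (p t) (w t) *m jac c d (w t)) + second_order_term c d (p t) (w t)
    = - geodesic_term g d (p t *m jac c d (w t)) (coords c d (w t)).
  by rewrite (geodesic_term_transform g _ ac ad Ot) opprD addrAC addNr add0r.
rewrite [X in X + _ = _]mxE.
apply/eqP; rewrite addrC subr_eq0; apply/eqP; rewrite [RHS]mxE.
apply: eq_bigr => i _; apply: eq_bigr => j _.
by rewrite (cinv_coords Ot) -!D1t.
Unshelve. all: by end_near. Qed.

End geodesics.

(** * The difference of two projectively related connections *)

Section pure_trace.
Context {R : realType} {n : nat}.

(** Polarisation on the test vectors [e_i] and [e_i + t e_j]. The factor [mu] depends on the test
    vector, so it is eliminated by comparing components for the same vector. *)
Lemma pure_trace_of_proportional (D : 'I_n -> 'I_n -> 'I_n -> R) :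
  (forall k i j, D k i j = D k j i) ->
  (forall v : 'rV[R]_n, exists mu, forall k,
     \sum_i \sum_j D k i j * v 0 i * v 0 j = mu * v 0 k) ->
  exists phi : 'I_n -> R, forall k i j,
    D k i j = (k == i)%:R * phi j + (k == j)%:R * phi i.
Proof.
move=> Ds Dv.
have diag k i : k != i -> D k i i = 0.
  move=> ki; have [mu /(_ k)] := Dv (delta_mx 0 i).
  rewrite (bigD1 i)//= (bigD1 i)//= !mxE !eqxx /= !mulr1 big1 ?addr0; last first.
    by move=> j ji; rewrite !mxE (negbTE ji) mulr0.
  rewrite big1 ?addr0 => [->|i' ii']; first by rewrite (negbTE ki) mulr0.
  by rewrite big1 // => j _; rewrite !mxE (negbTE ii') mulr0 mul0r.
have two i j t : i != j -> exists mu, forall k,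
    D k i i + 2 * t * D k i j + t ^+ 2 * D k j j = mu * ((k == i)%:R + t * (k == j)%:R).
  move=> ij; have [mu H] := Dv (delta_mx 0 i + t *: delta_mx 0 j).
  exists mu => k; have := H k; rewrite !mxE eqxx /= => <-.
  have ji : j != i by rewrite eq_sym.
  have inner a : \sum_b D k a b * (delta_mx 0 i + t *: delta_mx 0 j : 'rV[R]_n) 0 a
       * (delta_mx 0 i + t *: delta_mx 0 j : 'rV[R]_n) 0 b
     = (D k a i + t * D k a j) * (delta_mx 0 i + t *: delta_mx 0 j : 'rV[R]_n) 0 a.
    rewrite (bigD1 i)//= (bigD1 j)//= big1 ?addr0 => [|b /andP[bi bj]]; last first.
      by rewrite !mxE (negbTE bi) (negbTE bj) mulr0 addr0 mulr0.
    rewrite !mxE !eqxx (negbTE ij) (negbTE ji) /=; ring.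
  under eq_bigr do rewrite inner.
  rewrite (bigD1 i)//= (bigD1 j)//= big1 ?addr0 => [|b /andP[bi bj]]; last first.
    by rewrite !mxE (negbTE bi) (negbTE bj) mulr0 addr0 mulr0.
  rewrite !mxE !eqxx (negbTE ij) (negbTE ji) /= (Ds k j i); ring.
exists (fun i => D i i i / 2) => k i j.
have [->|ij] := eqVneq i j.
  have [->|kj] := eqVneq k j; last by rewrite diag// !mul0r addr0.
  by rewrite !mul1r -splitr.
(* Components [a] and [b] are compared for [t = 1] and for [t = -1]; adding the two results removes
   [D b b b] and [D a a b]. *)
have key a b : a != b -> D b a b = D a a a / 2.
  move=> ab; have ba : b != a by rewrite eq_sym.
  have [m1 H1] := two a b 1 ab; have [m2 H2] := two a b (-1) ab.
  have := H1 a; have := H1 b; have := H2 a; have := H2 b.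
  rewrite !eqxx (negbTE ab) (negbTE ba) (diag b a ba) (diag a b ab) (Ds a a b).
  rewrite !mulr1n !mulr0 !mulr1 !addr0 !add0r sqrrN expr1n !mul1r.
  move: (D b a b) (D b b b) (D a a a) (D a b a) => p q r s.
  move=> h1 h2 h3 h4; lra.
have [->|ki] := eqVneq k i.
  by rewrite (negbTE ij) mul1r mul0r addr0 Ds key// eq_sym.
have [->|kj] := eqVneq k j; first by rewrite mul1r mul0r add0r key.
have [mu /(_ k)] := two i j 1 ij.
rewrite (negbTE ki) (negbTE kj) (diag k i ki) (diag k j kj) !mul0r mulr0 !addr0 mulr0 add0r mulr1.
by rewrite addr0 mulr0 => /eqP; rewrite mulf_eq0 pnatr_eq0 /= => /eqP.
Qed.

End pure_trace.

Section projective_equivalence.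
Context {R : realType} {n : nat} {M : manifold R n} (g gbar : metric M).
Implicit Types (c d : chart R M n) (u v : 'rV[R]_n).

(** The [g]-geodesic with velocity [v] becomes a [gbar]-geodesic after the substitution [phi]. The
    substitution scales the acceleration by the square of [phi'] and adds [phi''] times [v], so the
    two equations differ by a multiple of [v]. *)
Lemma geodesic_terms_proportional c u v : geodesics_reparametrise g gbar ->
  atlas c -> cimg c u ->
  exists mu, geodesic_term gbar c v u - geodesic_term g c v u = mu *: v.
Proof.
move=> gg ac Uu.
have [e [w [p [e0 w0 p0 gw wp]]]] := geodesic_exists g v ac Uu.
have oI : open_interval [set t : R | `|t| < e].
  have -> : [set t : R | `|t| < e] = `](- e), e[%classic.
    by apply/seteqP; split=> t /=; rewrite in_itv /= -ltr_norml.
  split; first exact: interval_open.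
  - exact: interval_is_interval.
  - by exists 0; rewrite /= in_itv /= oppr_lt0 e0.
have [J [phi [[oJ iJ _] [phiJ dphi] gJ]]] := gg _ _ oI gw.
have [s0 Js0 phis0] : exists2 s0, J s0 & phi s0 = 0.
  have : [set t : R | `|t| < e] 0 by rewrite /= normr0.
  by rewrite -phiJ => -[s Js <-]; exists s.
have nJ : \forall s \near s0, J s by exact: open_nbhs_nbhs.
have phie s : J s -> `|phi s| < e.
  by move=> Js; have : [set t : R | `|t| < e] (phi s) by rewrite -phiJ; exists s.
have dc : cdom c ((cinv c \o w \o phi) s0).
  by rewrite /= phis0 w0; exact: cimg_dom.
have [_ /(_ c s0 ac Js0 dc)[_ geq]] := gJ.
have wE k : \forall s \near s0, (fun s => w s 0 k) (phi s) = cmap c ((cinv c \o w \o phi) s) 0 k.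
  by apply: filterS nJ => s Js; rewrite /= cinvK//; have [] := wp (phi s) (phie s Js).
have D1 s k : J s -> is_derive s (1 : R) ((fun s => w s 0 k) \o phi) (p (phi s) 0 k * derive1 phi s).
  move=> Js; have [_ wk _] := wp (phi s) (phie s Js).
  apply: is_derive_comp_scalar (wk k).
  by split; [have [] := dphi s Js|rewrite derive1E].
have D2 k : is_derive s0 (1 : R) (derive1 (fun s => cmap c ((cinv c \o w \o phi) s) 0 k))
    (- geodesic_term g c v u 0 k * derive1 phi s0 * derive1 phi s0 + v 0 k * derive1 (derive1 phi) s0).
  have E : \forall s \near s0, ((fun s => p s 0 k) \o phi) s * derive1 phi s =
      derive1 (fun s => cmap c ((cinv c \o w \o phi) s) 0 k) s.
    have nJ2 : \forall s \near s0, \forall s' \near s, J s'.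
      by apply: filterS nJ => s Js; exact: open_nbhs_nbhs.
    apply: filterS2 nJ nJ2 => s Js nJs.
    have [_ <-] := D1 s k Js; rewrite derive1E; apply: near_eq_derive.
    by apply: filterS nJs => s' Js'; rewrite /= cinvK//; have [] := wp (phi s') (phie s' Js').
  apply: (near_eq_is_derive E).
  have [_ _ pk] := wp (phi s0) (phie s0 Js0).
  have [d1 d2 _] := dphi s0 Js0.
  have F1 : is_derive s0 (1 : R) phi (derive1 phi s0) by split; [exact: d1|rewrite derive1E].
  have F2 : is_derive s0 (1 : R) (derive1 phi) (derive1 (derive1 phi) s0).
    by split; [exact: d2|rewrite [RHS]derive1E].
  have := is_deriveM (is_derive_comp_scalar F1 (pk k)) F2.
  rewrite /= phis0 p0 w0; congr (is_derive _ _ _ _).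
  by rewrite [LHS]addrC; congr (_ + _); rewrite [LHS]mulrC.
have D1E k : derive1 (fun s => cmap c ((cinv c \o w \o phi) s) 0 k) s0 = v 0 k * derive1 phi s0.
  rewrite derive1E -(near_eq_derive _ (wE k)); have [_ ->] := D1 s0 k Js0.
  by rewrite phis0 p0.
have [_ _ phi0] := dphi s0 Js0.
pose a := derive1 phi s0; pose b := derive1 (derive1 phi) s0.
(* The chain rule gives [mu = - phi'' / phi'^2] at the parameter [s0] of the initial point. *)
exists (- b / (a * a)); apply/rowP => k.
have := geq k; rewrite derive1E; have [_ ->] := D2 k.
have -> : \sum_(i < n) \sum_(j < n) christoffel gbar c k i j ((cinv c \o w \o phi) s0)
     * derive1 (fun s => cmap c ((cinv c \o w \o phi) s) 0 i) s0
     * derive1 (fun s => cmap c ((cinv c \o w \o phi) s) 0 j) s0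
   = geodesic_term gbar c v u 0 k * a * a.
  rewrite [geodesic_term gbar c v u 0 k]mxE !mulr_suml; apply: eq_bigr => i _.
  rewrite !mulr_suml; apply: eq_bigr => j _; rewrite !D1E /= phis0 w0 -/a.
  by move: (christoffel _ _ _ _ _ _) (v 0 i) (v 0 j) a => x y z t; ring.
rewrite -/a -/b.
have -> : (geodesic_term gbar c v u - geodesic_term g c v u) 0 k
  = geodesic_term gbar c v u 0 k - geodesic_term g c v u 0 k by rewrite [LHS]mxE [X in _ + X]mxE.
have -> : (- b / (a * a) *: v) 0 k = - b / (a * a) * v 0 k by rewrite mxE.
move: (geodesic_term gbar c v u 0 k) (geodesic_term g c v u 0 k) (v 0 k) => x y z.
have : a != 0 by []; clearbody a b; move: a b x y z; clear.
move=> a b x y z a0 E.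
apply: (mulIf a0); apply: (mulIf a0).
have -> : - b / (a * a) * z * a * a = - (z * b) by field.
by apply/eqP; rewrite -subr_eq0; apply/eqP; rewrite -E; ring.
Qed.

Lemma connection_difference c u : geodesics_reparametrise g gbar ->
  atlas c -> cimg c u ->
  exists phi : 'I_n -> R, forall k i j,
    christoffel gbar c k i j (cinv c u) = christoffel g c k i j (cinv c u)
      + (k == i)%:R * phi j + (k == j)%:R * phi i.
Proof.
move=> gg ac Uu.
have [||phi phiP] := @pure_trace_of_proportional R n (fun k i j =>
  christoffel gbar c k i j (cinv c u) - christoffel g c k i j (cinv c u)).
- move=> k i j.
  by rewrite (christoffel_sym gbar k i j ac Uu) (christoffel_sym g k i j ac Uu).
- move=> v; have [mu E] := geodesic_terms_proportional v gg ac Uu.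
  exists mu => k; have := congr1 (fun A : 'rV[R]_n => A 0 k) E.
  rewrite [RHS]mxE => <-; rewrite mxE [X in _ = _ + X]mxE [X in _ = X - _]mxE [X in _ = _ - X]mxE.
  rewrite -sumrB; apply: eq_bigr => i _; rewrite -sumrB; apply: eq_bigr => j _.
  by rewrite !mulrBl.
exists phi => k i j.
by rewrite -addrA -phiP addrC subrK.
Qed.

Definition upsilon c u := Upsilon g gbar c (cinv c u).

Lemma gmx_det_neq0 (h : metric M) c u : atlas c -> cimg c u -> \det (gmx h c u) != 0.
Proof. by move=> ac Uu; have := gmx_unit h ac Uu; rewrite unitmxE unitfE. Qed.

Lemma smooth_upsilon c : atlas c -> smooth_on (cimg c) (upsilon c).
Proof.
move=> ac; have oU := open_cimg c; apply: smoothZ => //.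
apply: smooth_ln_norm => //.
  by move=> u Uu; rewrite mulf_neq0 ?invr_neq0//; exact: gmx_det_neq0.
apply: smoothM => //; first exact: smooth_det (smooth_gmx gbar ac).
apply: smoothV => //; first by move=> u; exact: gmx_det_neq0.
exact: smooth_det (smooth_gmx g ac).
Qed.

(** Two of the three terms cancel by symmetry of the inverse metric; the remaining one is half the
    logarithmic derivative of the determinant. *)
Lemma christoffel_trace (h : metric M) c i u : atlas c -> cimg c u ->
  \sum_k christoffel h c k k i (cinv c u) =
  2^-1 * \tr (invmx (gmx h c u) *m dmx i (gmx h c) u).
Proof.
move=> ac Uu; set V := invmx (gmx h c u).
have VT a b : V a b = V b a.
  by rewrite /V -[in LHS](gmx_tr h ac Uu) -trmx_inv mxE.
under eq_bigr do rewrite (christoffelE h _ _ _ Uu) -/V.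
pose D a k l := dmx a (gmx h c) u k l.
pose S1 := \sum_k \sum_l V k l * D k i l.
have E0 : \sum_k \sum_l V k l * D l k i = S1.
  rewrite exchange_big; apply: eq_bigr => k _; apply: eq_bigr => l _.
  by rewrite VT; congr (_ * _); exact: dmx_gmx_sym.
transitivity (2^-1 * S1 + 2^-1 * (\sum_k \sum_l V k l * D i k l)
   - 2^-1 * \sum_k \sum_l V k l * D l k i).
  rewrite !mulr_sumr -big_split -sumrB; apply: eq_bigr => k _ /=.
  rewrite !mulr_sumr -big_split -sumrB; apply: eq_bigr => l _ /=.
  rewrite -[christoffel1 _ _ _ _ _ _]/(2^-1 * (D k i l + D i k l - D l k i)).
  by move: (D k i l) (D i k l) (D l k i) (V k l) => a b e f; ring.
rewrite E0 addrAC subrr add0r /mxtrace; congr (_ * _); apply: eq_bigr => k _.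
rewrite mxE; apply: eq_bigr => l _; congr (_ * _); exact: dmx_gmx_sym.
Qed.

Lemma partial_upsilon c i u : atlas c -> cimg c u ->
  partial i (upsilon c) u = (n%:R + 1)^-1 *
    (\sum_k christoffel gbar c k k i (cinv c u) - \sum_k christoffel g c k k i (cinv c u)).
Proof.
move=> ac Uu; have oU := open_cimg c.
have sl (h : metric M) : smooth_on (cimg c) (fun v => ln `|\det (gmx h c v)|).
  apply: smooth_ln_norm => //; first by move=> v; exact: gmx_det_neq0.
  exact: smooth_det (smooth_gmx h ac).
rewrite (partial_eq_on (g := fun v => (2 * (n%:R + 1))^-1 *
  (ln `|\det (gmx gbar c v)| - ln `|\det (gmx g c v)|)) i oU Uu); last first.
  move=> v Uv; rewrite /upsilon /Upsilon; congr (_ * _).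
  rewrite normf_div ln_div// posrE normr_gt0; exact: gmx_det_neq0.
rewrite (partialZ _ _ (smoothB oU (sl gbar) (sl g)) Uu) (partialB _ (sl gbar) (sl g) Uu).
have ld (h : metric M) := partial_ln_det oU i (smooth_gmx h ac) Uu (fun v => @gmx_unit _ _ _ h c v ac).
rewrite !ld !(christoffel_trace _ _ ac Uu).
by rewrite -mulrBr mulrA invfM [X in X * _ = _]mulrC.
Qed.

(** The trace of the difference is [n + 1] times the unknown covector, and each trace is half the
    derivative of ln |det|. Hence the constant [1 / (2 (n + 1))] in [Upsilon]. *)
Lemma christoffel_projective c k i j u : geodesics_reparametrise g gbar ->
  atlas c -> cimg c u ->
  christoffel gbar c k i j (cinv c u) = christoffel g c k i j (cinv c u)
    + (k == i)%:R * partial j (upsilon c) u + (k == j)%:R * partial i (upsilon c) u.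
Proof.
move=> gg ac Uu; have [phi phiP] := connection_difference gg ac Uu.
suff E a : partial a (upsilon c) u = phi a by rewrite phiP !E.
rewrite (partial_upsilon _ ac Uu) -sumrB.
under eq_bigr do rewrite phiP eqxx mul1r addrAC [X in X - _]addrC addrK.
rewrite big_split /= sumr_const card_ord (bigD1 a)//= eqxx mul1r big1 ?addr0; last first.
  by move=> b ba; rewrite (negbTE ba) mul0r.
have -> : phi a *+ n + phi a = (n%:R + 1) * phi a by rewrite mulrDl mul1r mulr_natl.
rewrite mulrA mulVf ?mul1r//.
Qed.

End projective_equivalence.

(** * Pointwise algebra *)

Section bilinear_algebra.
Context {R : realFieldType} {n : nat}.
Implicit Types (A G S : 'M[R]_n) (X Y Z : 'cV[R]_n) (t l k : 'rV[R]_n).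

Definition bil A X Y : R := (X^T *m A *m Y) 0 0.
Definition lin t X : R := (t *m X) 0 0.

Lemma bil_delta A i j : bil A (delta_mx i 0) (delta_mx j 0) = A i j.
Proof. by rewrite /bil trmx_delta -rowE -colE !mxE. Qed.

Lemma lin_delta t i : lin t (delta_mx i 0) = t 0 i.
Proof. by rewrite /lin -colE mxE. Qed.

Lemma lin_ext t l : (forall X, lin t X = lin l X) -> t = l.
Proof. by move=> H; apply/rowP => i; rewrite -!lin_delta H. Qed.

Lemma bil_ext A S : (forall X Y, bil A X Y = bil S X Y) -> A = S.
Proof. by move=> H; apply/matrixP => i j; rewrite -!bil_delta H. Qed.

Lemma lin0 X : lin 0 X = 0.
Proof. by rewrite /lin mul0mx mxE. Qed.

Lemma lin_neq0 t : t != 0 -> exists X, lin t X != 0.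
Proof.
move=> t0; apply: contrapT => H; move/eqP: t0; apply; apply: lin_ext => X.
by rewrite lin0; apply/eqP/negPn/negP => h; apply: H; exists X.
Qed.

Lemma linD t X Y : lin t (X + Y) = lin t X + lin t Y.
Proof. by rewrite /lin mulmxDr mxE. Qed.

Lemma linZ t a X : lin t (a *: X) = a * lin t X.
Proof. by rewrite /lin -scalemxAr mxE. Qed.

Lemma lin_add t l X : lin (t + l) X = lin t X + lin l X.
Proof. by rewrite /lin mulmxDl mxE. Qed.

Lemma lin_scale a t X : lin (a *: t) X = a * lin t X.
Proof. by rewrite /lin -scalemxAl mxE. Qed.

Lemma bil_add A S X Y : bil (A + S) X Y = bil A X Y + bil S X Y.
Proof. by rewrite /bil mulmxDr mulmxDl mxE. Qed.

Lemma bil_scale a A X Y : bil (a *: A) X Y = a * bil A X Y.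
Proof. by rewrite /bil -scalemxAr -scalemxAl mxE. Qed.

Lemma bil_lin t l X Y : bil (t^T *m l) X Y = lin t X * lin l Y.
Proof.
rewrite /bil mulmxA -mulmxA -trmx_mul.
by rewrite mxE big_ord1 mxE.
Qed.

Lemma bilC A X Y : A^T = A -> bil A X Y = bil A Y X.
Proof.
move=> As; have -> : bil A X Y = (X^T *m A *m Y)^T 0 0 by rewrite mxE.
by rewrite !trmx_mul trmxK As mulmxA.
Qed.

Lemma bil_nondegenerate G X : G \in unitmx -> (forall Y, bil G X Y = 0) -> X = 0.
Proof.
move=> Gu H; have E : X^T *m G = 0.
  by apply: lin_ext => Y; rewrite lin0; exact: H.
by rewrite -[X]trmxK -[X^T](mulmxK Gu) E mul0mx trmx0.
Qed.

(** Evaluate at [x, x, x], then at [x, x, y], then at [x, y, z]. [T] is an arbitrary type so that it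
    can also be the kernel of a covector. *)
Lemma symmetric_product_eq0 (T : Type) (th : T -> R) (h : T -> T -> R) :
  (forall x y, h x y = h y x) ->
  (forall x y z, th x * h y z + th y * h x z + th z * h x y = 0) ->
  (exists x, th x != 0) -> forall x y, h x y = 0.
Proof.
move=> hC H [x x0].
have three : (3 : R) != 0 by rewrite pnatr_eq0.
have two : (2 : R) != 0 by rewrite pnatr_eq0.
have hxx : h x x = 0.
  have := H x x x; have -> : th x * h x x + th x * h x x + th x * h x x = 3 * (th x * h x x) by ring.
  by move/eqP; rewrite !mulf_eq0 (negbTE three) (negbTE x0) => /eqP.
have hx y : h x y = 0.
  have := H x x y; rewrite hxx mulr0 addr0.
  have -> : th x * h x y + th x * h x y = 2 * (th x * h x y) by ring.
  by move/eqP; rewrite !mulf_eq0 (negbTE two) (negbTE x0) => /eqP.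
move=> y z; have := H x y z; rewrite !hx !mulr0 !addr0.
by move/eqP; rewrite mulf_eq0 (negbTE x0) => /eqP.
Qed.

Hypothesis n_ge3 : (2 < n)%N.

Lemma common_kernel t l : exists X, [/\ X != 0, lin t X = 0 & lin l X = 0].
Proof.
pose A : 'M[R]_(1 + 1, n) := col_mx t l.
have rA : (\rank (cokermx A) > 0)%N.
  by rewrite mxrank_coker subn_gt0 (leq_ltn_trans (rank_leq_row A)).
have : cokermx A != 0 by rewrite -mxrank_eq0 -lt0n.
move=> /eqP cA.
have [j cj] : exists j, col j (cokermx A) != 0.
  apply: contrapT => H; apply: cA; apply/matrixP => a b.
  have : col b (cokermx A) = 0 by apply/eqP/negPn/negP => h; apply: H; exists b.
  by move/matrixP => /(_ a 0); rewrite !mxE.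
exists (col j (cokermx A)); split=> //.
  have := mulmx_coker A; rewrite /A mul_col_mx => /eqP; rewrite col_mx_eq0 => /andP[/eqP E _].
  by rewrite /lin colE mulmxA E mul0mx mxE.
have := mulmx_coker A; rewrite /A mul_col_mx => /eqP; rewrite col_mx_eq0 => /andP[_ /eqP E].
by rewrite /lin colE mulmxA E mul0mx mxE.
Qed.

(** The kernel has dimension at least [n - 1], whereas a totally isotropic subspace has dimension at
    most [n / 2]; for [n >= 3] the former is larger. *)
Lemma kernel_not_isotropic G t : G \in unitmx ->
  exists X Y, [/\ lin t X = 0, lin t Y = 0 & bil G X Y != 0].
Proof.
move=> Gu; apply: contrapT => H.
pose K := cokermx t.
have KGK : K^T *m G *m K = 0.
  apply/matrixP => i j; rewrite [RHS]mxE; apply/eqP/negPn/negP => h; apply: H.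
  exists (col i K), (col j K).
  have tK a : lin t (col a K) = 0 by rewrite /lin colE mulmxA mulmx_coker mul0mx mxE.
  split=> //; have -> // : bil G (col i K) (col j K) = (K^T *m G *m K) i j.
  by rewrite -bil_delta /bil !colE trmx_mul !mulmxA.
have := mulmx0_rank_max KGK.
rewrite mxrankMfree ?row_free_unit// mxrank_tr mxrank_coker.
have := rank_leq_row t; move: (\rank t) => r r1; apply/negP; rewrite -ltnNge.
by lia.
Qed.

(** If [l] is nonzero, on its kernel only the product of [k] with [G] remains, which forces
    [k = c l]. The identity then reads as the product of [l] with [S + c G], contradicting [SG].
    With [l = 0] the same argument removes [k]. *)
Lemma symmetric_product2_eq0 G S l k : G \in unitmx -> G^T = G -> S^T = S ->
  (forall c, S != c *: G) ->
  (forall X Y Z, (lin l X * bil S Y Z + lin k X * bil G Y Z)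
     + (lin l Y * bil S X Z + lin k Y * bil G X Z)
     + (lin l Z * bil S X Y + lin k Z * bil G X Y) = 0) ->
  l = 0 /\ k = 0.
Proof.
move=> Gu Gs Ss SG H.
have bG X Y : bil G X Y = bil G Y X by exact: bilC.
have bS X Y : bil S X Y = bil S Y X by exact: bilC.
have G0 : exists X Y, bil G X Y != 0.
  by have [X [Y [_ _ h]]] := kernel_not_isotropic 0 Gu; exists X, Y.
have l0 : l = 0.
  apply/eqP/negPn/negP => /lin_neq0[X0 lX0].
  have kl Y : lin l Y = 0 -> lin k Y = 0.
    move=> lY; apply/eqP/negPn/negP => kY.
    have [X1 [Y1 [lX1 lY1 /negP]]] := kernel_not_isotropic l Gu; apply; apply/eqP.
    apply: (@symmetric_product_eq0 {X | lin l X = 0} (fun x => lin k (sval x))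
      (fun x y => bil G (sval x) (sval y)) _ _ _ (exist _ X1 lX1) (exist _ Y1 lY1)).
    - by move=> x y; exact: bG.
    - move=> [x lx] [y ly] [z lz] /=; have := H x y z.
      by rewrite lx ly lz !mul0r !add0r.
    - by exists (exist _ Y lY).
  pose c := lin k X0 / lin l X0.
  have kE Y : lin k Y = c * lin l Y.
    pose r := lin l Y / lin l X0.
    have : lin k (Y + (- r) *: X0) = 0.
      by apply: kl; rewrite linD linZ mulNr divfK// subrr.
    rewrite linD linZ => /eqP; rewrite mulNr subr_eq0 => /eqP ->.
    by rewrite /r /c mulrAC [RHS]mulrAC [lin l Y * _]mulrC.
  have := SG (- c); apply/negP/negPn/eqP; apply: bil_ext => X Y.
  rewrite bil_scale mulNr; apply/eqP; rewrite -addr_eq0; apply/eqP.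
  apply: (@symmetric_product_eq0 'cV[R]_n (lin l) (fun X Y => bil S X Y + c * bil G X Y)).
  - by move=> x y; rewrite bG bS.
  - move=> x y z; have := H x y z; rewrite !kE => <-.
    by clearbody c; ring.
  - by exists X0.
split=> //; apply/eqP/negPn/negP => /lin_neq0[X0 kX0].
have [X [Y /negP]] := G0; apply; apply/eqP.
apply: (@symmetric_product_eq0 'cV[R]_n (lin k) (bil G)) => //; last by exists X0.
by move=> x y z; have := H x y z; rewrite l0 !lin0 !mul0r !add0r.
Qed.

(** A nonzero vector killed by [l] and [k] is an eigenvector of [S] relative to [G], with eigenvalue
    [b]. It yields [k = - b l]; then the product of [l] with [S - b G] is totally symmetric, so
    [S - b G] is a multiple of the square of [l]. *)
Lemma total_symmetry_rank1 G S l k : G \in unitmx -> G^T = G -> S^T = S -> l != 0 ->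
  (forall X Y Z, lin l Z * bil S X Y + lin k Z * bil G X Y
                 = lin l X * bil S Y Z + lin k X * bil G Y Z) ->
  exists b e, S = b *: G + e *: (l^T *m l).
Proof.
move=> Gu Gs Ss l0 H.
have [Z0 lZ0] := lin_neq0 l0.
have [X [X0 lX kX]] := common_kernel l k.
pose b := - (lin k Z0 / lin l Z0).
have SX Y : bil S X Y = b * bil G X Y.
  have := H X Y Z0; rewrite lX kX !mul0r addr0 => /eqP; rewrite addr_eq0 => /eqP E.
  by apply: (mulfI lZ0); rewrite E /b !mulNr mulrN mulrA [lin l Z0 * _]mulrC divfK.
have kE Z : lin k Z = - (b * lin l Z).
  apply/eqP; rewrite -addr_eq0; apply/eqP/eqP/negPn/negP => h.
  move/eqP: X0; apply; apply: (bil_nondegenerate Gu) => Y.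
  apply: (mulfI h); rewrite mulr0.
  have := H X Y Z; rewrite lX kX SX !mul0r addr0 => <-.
  by rewrite mulrDl addrC mulrA [b * _]mulrC.
have hE X' Y Z : lin l Z * (bil S X' Y - b * bil G X' Y) = lin l X' * (bil S Y Z - b * bil G Y Z).
  have := H X' Y Z; rewrite !kE.
  move=> /eqP; rewrite -subr_eq0 => /eqP E.
  by clearbody b; apply/eqP; rewrite -subr_eq0; apply/eqP; rewrite -[RHS]E; ring.
pose h X Y := bil S X Y - b * bil G X Y.
exists b, (h Z0 Z0 / (lin l Z0 * lin l Z0)); apply: bil_ext => X' Y.
rewrite bil_add !bil_scale bil_lin.
have E1 : lin l Z0 * h X' Y = lin l X' * h Y Z0 by exact: hE.
have E2 : lin l Z0 * h Y Z0 = lin l Y * h Z0 Z0 by exact: hE.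
have E3 : h X' Y = h Z0 Z0 / (lin l Z0 * lin l Z0) * (lin l X' * lin l Y).
  apply: (mulfI lZ0); rewrite E1; apply: (mulfI lZ0); rewrite mulrCA E2.
  by field.
by rewrite -E3 /h addrC subrK.
Qed.

(** The cyclic sum of the hypothesis is a vanishing symmetric product with coefficients [2 l - al]
    and [2 k - be], so these are zero. What remains says that the product of [l] with [S] plus that
    of [k] with [G] is totally symmetric. *)
Lemma codazzi_rank1 G S l k al be : G \in unitmx -> G^T = G -> S^T = S -> l != 0 ->
  (forall c, S != c *: G) ->
  (forall X Y Z, lin l X * bil S Z Y + lin k X * bil G Z Y
     + (lin l Y * bil S X Z + lin k Y * bil G X Z)
     = lin al Z * bil S X Y + lin be Z * bil G X Y) ->
  exists b e, S = b *: G + e *: (l^T *m l).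
Proof.
move=> Gu Gs Ss l0 SG H.
have bG X Y : bil G X Y = bil G Y X by exact: bilC.
have bS X Y : bil S X Y = bil S Y X by exact: bilC.
have h1 X Y Z : lin l X * bil S Y Z + lin k X * bil G Y Z + (lin l Y * bil S X Z + lin k Y * bil G X Z)
     = lin al Z * bil S X Y + lin be Z * bil G X Y.
  by rewrite -H (bS Z Y) (bG Z Y).
have h3 X Y Z : lin l Y * bil S X Z + lin k Y * bil G X Z + (lin l Z * bil S X Y + lin k Z * bil G X Y)
     = lin al X * bil S Y Z + lin be X * bil G Y Z.
  by rewrite -H (bS Y X) (bG Y X) (bS X Z) (bG X Z).
have [E1 E2] : 2 *: l - al = 0 /\ 2 *: k - be = 0.
  apply: (symmetric_product2_eq0 Gu Gs Ss SG) => X Y Z.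
  have := H X Z Y; have := h3 X Y Z; have := h1 X Y Z.
  rewrite -scaleN1r -[- be]scaleN1r !lin_add !lin_scale.
  move: (lin l X) (lin l Y) (lin l Z) (lin k X) (lin k Y) (lin k Z) (lin al X) (lin al Y) (lin al Z)
    (lin be X) (lin be Y) (lin be Z) (bil S Y Z) (bil G Y Z) (bil S X Z) (bil G X Z)
    (bil S X Y) (bil G X Y); clear.
  by move=> ? ? ? ? ? ? ? ? ? ? ? ? ? ? ? ? ? ? h1 h2 h3; lra.
have alE X : lin al X = 2 * lin l X by move/eqP: E1; rewrite subr_eq0 -lin_scale => /eqP ->.
have beE X : lin be X = 2 * lin k X by move/eqP: E2; rewrite subr_eq0 -lin_scale => /eqP ->.
apply: (total_symmetry_rank1 (k := k) Gu Gs Ss l0) => X Y Z.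
have := h3 X Y Z; have := h1 X Y Z; rewrite !alE !beE.
move: (lin l X) (lin l Y) (lin l Z) (lin k X) (lin k Y) (lin k Z)
    (bil S Y Z) (bil G Y Z) (bil S X Z) (bil G X Z) (bil S X Y) (bil G X Y); clear.
by move=> ? ? ? ? ? ? ? ? ? ? ? ? h1 h2; lra.
Qed.

End bilinear_algebra.

(** Matrix products become atoms, so an identity linear in them is checked entrywise by [ring]
    without opening their sums. *)
Ltac mx_linear :=
  repeat match goal with |- context [@mulmx ?K ?p ?q ?r ?A ?B] =>
    let X := fresh "X" in set X := @mulmx K p q r A B; clearbody X end;
  let i := fresh "i" in let j := fresh "j" in
  apply/matrixP => i j; rewrite !mxE; ring.

(** * Symmetries of a curvature tensor and the quadratic equation for L *)

Section curvature_algebra.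
Context {R : realFieldType} {n : nat}.
Implicit Types (G L : 'M[R]_n) (V : 'I_n -> 'I_n -> 'M[R]_n).

Definition ecol (k : 'I_n) : 'cV[R]_n := delta_mx k 0.

(** The classical octahedron argument: four instances of the cyclic identity, reduced by the two
    skew symmetries to six unknowns. *)
Lemma pair_symmetry (F : 'I_n -> 'I_n -> 'I_n -> 'I_n -> R) :
  (forall i a l k, F i a l k = - F a i l k) ->
  (forall i a l k, F i a l k = - F i a k l) ->
  (forall i a l k, F i a l k + F i l k a + F i k a l = 0) ->
  forall i a l k, F i a l k = F l k i a.
Proof.
move=> F1 F2 F3 i a l k.
have b1 := F3 i a l k; have b2 := F3 a i l k; have b3 := F3 l k i a; have b4 := F3 k l i a.
have e1 : F a i l k = - F i a l k by rewrite F1.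
have e2 : F a l k i = - F a l i k by rewrite F2.
have e3 : F a k i l = - F k a i l by rewrite F1.
have e4 : F l i a k = F i l k a by rewrite F1 F2 opprK.
have e5 : F l a k i = F a l i k by rewrite F1 F2 opprK.
have e6 : F k l i a = - F l k i a by rewrite F1.
have e7 : F k i a l = - F i k a l by rewrite F1.
have e8 : F k a l i = - F k a i l by rewrite F2.
rewrite e1 e2 e3 in b2; rewrite e4 e5 in b3; rewrite e6 e7 e8 in b4.
clear e1 e2 e3 e4 e5 e6 e7 e8 F1 F2 F3.
move: (F i a l k) (F l k i a) (F i l k a) (F k a i l) (F i k a l) (F a l i k) b1 b2 b3 b4.
by clear; move=> A A' B B' C C' b1 b2 b3 b4; lra.
Qed.

(** Three swaps of each kind, taken alternately, return to the same entry with its sign reversed. *)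
Lemma symmetric_antisymmetric_eq0 (F : 'I_n -> 'I_n -> 'I_n -> R) :
  (forall i l k, F i l k = F l i k) -> (forall i l k, F i l k = - F i k l) ->
  forall i l k, F i l k = 0.
Proof.
move=> Fs Fa i l k.
have : F i l k = - F i l k.
  by rewrite {1}Fa Fs Fa opprK Fs Fa Fs.
lra.
Qed.

Lemma col_entry p (A : 'M[R]_(p, n)) k i : (A *m ecol k) i 0 = A i k.
Proof. by rewrite -colE mxE. Qed.

Section commuting.
Variables (G L : 'M[R]_n) (V : 'I_n -> 'I_n -> 'M[R]_n) (lam : 'cV[R]_n) (tau b : 'rV[R]_n).
Hypothesis G_unit : G \in unitmx.
Hypothesis G_sym : G^T = G.
Hypothesis GL_sym : (G *m L)^T = G *m L.
Hypothesis V_skew : forall l k, (G *m V l k)^T = - (G *m V l k).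
Hypothesis V_alt : forall l k, V l k = - V k l.
Hypothesis V_bianchi : forall l k a i, V l k i a + V k a i l + V a l i k = 0.
Hypothesis V_comm : forall l k, V l k *m L = L *m V l k.
Hypothesis V_lam : forall l k, V l k *m lam =
  tau 0 l *: ecol k - tau 0 k *: ecol l - b 0 l *: (L *m ecol k) + b 0 k *: (L *m ecol l).

Let F i a l k := (G *m V l k) i a.

Let F_pair i a l k : F i a l k = F l k i a.
Proof.
apply: pair_symmetry => {i a l k} i a l k.
- rewrite /F; have := congr1 (fun A : 'M[R]_n => A a i) (V_skew l k).
  by rewrite [LHS]mxE [RHS]mxE.
- by rewrite /F V_alt mulmxN mxE.
- rewrite /F !mxE -!big_split big1 // => c _ /=.
  by rewrite -!mulrDr V_bianchi mulr0.
Qed.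

Let GLV l k : L^T *m G *m V l k = G *m V l k *m L.
Proof. by rewrite -mulmxA -[in LHS]G_sym !mulmxA -trmx_mul GL_sym -!mulmxA V_comm. Qed.

(** [V_comm] concerns the endomorphism indices of [V]; pair symmetry transfers it to the form
    indices [l] and [k]. *)
Let slot_comm i a l k : \sum_c F i a l c * L c k = \sum_c F i a c k * L c l.
Proof.
under eq_bigr do rewrite F_pair.
under [RHS]eq_bigr do rewrite F_pair.
transitivity ((G *m V i a *m L) l k); first by rewrite mxE.
rewrite -GLV -mulmxA mxE; apply: eq_bigr => c _; rewrite mxE mulrC; congr (_ * _).
Qed.

Let N i l k := \sum_a F i a l k * lam a 0.

Let NE i l k : N i l k = G i k * tau 0 l - G i l * tau 0 k - b 0 l * (G *m L) i k + b 0 k * (G *m L) i l.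
Proof.
transitivity ((G *m V l k *m lam) i 0); first by rewrite mxE.
rewrite -mulmxA V_lam !mulmxDr !mulmxN -!scalemxAr !mulmxA.
by rewrite /ecol -!colE !mxE [G i k * _]mulrC [G i l * _]mulrC.
Qed.

(** Contract [slot_comm] with [lam] and insert [V_lam]. The tensor [S p - G q - Q b] is then
    symmetric in its first two indices and skew in its last two, hence zero, and a nonzero component
    of [b] allows one to solve for [Q = G L L]. *)
Lemma quadratic_of_curvature : b != 0 ->
  exists al be, L *m L = al *: L + be%:M.
Proof.
move=> b0; pose S := G *m L; pose Q := G *m L *m L.
have Ss i l : S i l = S l i by rewrite /S -[in LHS]GL_sym [LHS]mxE.
have Gs i l : G i l = G l i by rewrite -[in LHS]G_sym [LHS]mxE.
have Qs i l : Q i l = Q l i.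
  have QT : Q^T = Q by rewrite /Q trmx_mul GL_sym -[X in _ *m (X *m _)]G_sym mulmxA -trmx_mul GL_sym.
  by rewrite -[in LHS]QT [LHS]mxE.
pose p := tau + b *m L; pose q := tau *m L.
have contr i l k : \sum_c N i l c * L c k = S i k * tau 0 l - G i l * q 0 k - b 0 l * Q i k + (b *m L) 0 k * S i l.
  under eq_bigr do rewrite NE !mulrDl !mulNr.
  rewrite !big_split /= !sumrN; congr (_ - _ - _ + _).
  - rewrite [S i k]mxE mulr_suml; apply: eq_bigr => c _; ring.
  - rewrite [q 0 k]mxE mulr_sumr; apply: eq_bigr => c _; ring.
  - rewrite [Q i k]mxE mulr_sumr; apply: eq_bigr => c _; ring.
  - rewrite [(b *m L) 0 k]mxE mulr_suml; apply: eq_bigr => c _; rewrite -/S; ring.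
have contr' i l k : \sum_c N i c k * L c l = G i k * q 0 l - S i l * tau 0 k - (b *m L) 0 l * S i k + b 0 k * Q i l.
  under eq_bigr do rewrite NE !mulrDl !mulNr.
  rewrite !big_split /= !sumrN; congr (_ - _ - _ + _).
  - rewrite [q 0 l]mxE mulr_sumr; apply: eq_bigr => c _; ring.
  - rewrite [S i l]mxE mulr_suml; apply: eq_bigr => c _; ring.
  - rewrite [(b *m L) 0 l]mxE mulr_suml; apply: eq_bigr => c _; rewrite -/S; ring.
  - rewrite [Q i l]mxE mulr_sumr; apply: eq_bigr => c _; ring.
have contrE i l k : \sum_c N i l c * L c k = \sum_c N i c k * L c l.
  rewrite /N; under eq_bigr do rewrite mulr_suml.
  under [RHS]eq_bigr do rewrite mulr_suml.
  rewrite exchange_big [RHS]exchange_big /=; apply: eq_bigr => a _.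
  have := congr1 (fun x => x * lam a 0) (slot_comm i a l k).
  rewrite !mulr_suml => E; under eq_bigr do rewrite mulrAC.
  by under [RHS]eq_bigr do rewrite mulrAC.
have T0 i l k : S i l * p 0 k - G i l * q 0 k - Q i l * b 0 k = 0.
  move: i l k; apply: symmetric_antisymmetric_eq0 => i l k.
    by rewrite (Ss i l) (Gs i l) (Qs i l).
  have := contrE i l k; rewrite contr contr' /p !mxE.
  rewrite -![\sum_(j < n) b 0 j * _]/(_) => /eqP; rewrite -subr_eq0 => /eqP E.
  apply/eqP; rewrite -subr_eq0 opprK; apply/eqP; rewrite -[RHS]E; ring.
have [k bk] : exists k, b 0 k != 0.
  apply: contrapT => H; move/eqP: b0; apply; apply/rowP => k; rewrite mxE.
  by apply/eqP/negPn/negP => h; apply: H; exists k.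
exists (p 0 k / b 0 k), (- (q 0 k / b 0 k)).
apply: (can_inj (mulKmx G_unit)); rewrite mulmxDr -scalemxAr mul_mx_scalar mulmxA.
apply/matrixP => i l; rewrite [in RHS]mxE [(_ *: (G *m L)) i l]mxE [(_ *: G) i l]mxE.
rewrite -/S -/Q; apply: (mulfI bk); have := T0 i l k.
move: (S i l) (G i l) (Q i l) (p 0 k) (q 0 k) (b 0 k) bk.
move=> s g r y z x x0 /eqP; rewrite subr_eq0 => /eqP E.
by rewrite mulrC -E; field.
Qed.

End commuting.

End curvature_algebra.

Section matrix_expansion.
Context {R : comPzRingType}.
Implicit Types (a : R).

Lemma mul_scale_mx p q r a (A : 'M[R]_(p, q)) (B : 'M[R]_(q, r)) :
  (a *: A) *m B = a *: (A *m B).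
Proof. by rewrite -scalemxAl. Qed.

Lemma mul_mx_scale p q r a (A : 'M[R]_(p, q)) (B : 'M[R]_(q, r)) :
  A *m (a *: B) = a *: (A *m B).
Proof. by rewrite -scalemxAr. Qed.

Lemma trmxD p q (A B : 'M[R]_(p, q)) : (A + B)^T = A^T + B^T.
Proof. exact: linearD. Qed.

Lemma trmxN p q (A : 'M[R]_(p, q)) : (- A)^T = - A^T.
Proof. exact: linearN. Qed.

Lemma trmxZ p q a (A : 'M[R]_(p, q)) : (a *: A)^T = a *: A^T.
Proof. exact: linearZ. Qed.

Lemma scale_mxE p q a (A : 'M[R]_(p, q)) i j : (a *: A) i j = a * A i j.
Proof. by rewrite mxE. Qed.

End matrix_expansion.

Ltac mx_expand := rewrite ?(mulmxDl, mulmxDr, mulNmx, mulmxN, mul_scale_mx, mul_mx_scale,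
  trmx_mul, trmxK, trmxD, trmxN, trmxZ, mulmxA).

(** * The closed system for S and lambda in a chart *)

Section chart_calculus.
Context {R : realType} {n : nat} (U : set 'rV[R]_n).
Implicit Types (u v : 'rV[R]_n) (k l m : 'I_n).

Variables (G S : 'rV[R]_n -> 'M[R]_n) (Gam : 'I_n -> 'rV[R]_n -> 'M[R]_n).
Variables (lam : 'rV[R]_n -> 'cV[R]_n) (B rho : 'rV[R]_n -> R).
Hypothesis oU : open U.
Hypothesis sG : smooth_mx U G.
Hypothesis sS : smooth_mx U S.
Hypothesis sGam : forall k, smooth_mx U (Gam k).
Hypothesis slam : smooth_mx U lam.
Hypothesis sB : smooth_on U B.
Hypothesis srho : smooth_on U rho.
Hypothesis G_unit : forall u, U u -> G u \in unitmx.
Hypothesis G_sym : forall u, U u -> (G u)^T = G u.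
Hypothesis S_sym : forall u, U u -> (S u)^T = S u.
Hypothesis Gam_sym : forall k j i u, U u -> Gam k u i j = Gam j u i k.
Hypothesis dG : forall k u, U u -> dmx k G u = (Gam k u)^T *m G u + G u *m Gam k u.
Hypothesis dS : forall k u, U u -> dmx k S u =
  - (Gam k u *m S u) - S u *m (Gam k u)^T + ecol k *m (lam u)^T + lam u *m (ecol k)^T.
Hypothesis dlam : forall k u, U u -> dmx k lam u =
  - (Gam k u *m lam u) + rho u *: ecol k - B u *: (S u *m G u *m ecol k).

(** The commutator of covariant derivatives in directions [l] and [k], with entry (i, j) of [Gam k]
    standing for Gamma^i_kj. *)
Definition Riem l k u : 'M[R]_n :=
  dmx l (Gam k) u - dmx k (Gam l) u + Gam l u *m Gam k u - Gam k u *m Gam l u.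

(* [Riem] minus the curvature tensor of constant curvature [B]. *)
Definition Vcurv l k u : 'M[R]_n :=
  Riem l k u - B u *: (ecol l *m (ecol k)^T *m G u) + B u *: (ecol k *m (ecol l)^T *m G u).

Definition Lop u : 'M[R]_n := S u *m G u.
Definition flat u : 'rV[R]_n := (lam u)^T *m G u.

Lemma Vcurv_alt l k u : Vcurv l k u = - Vcurv k l u.
Proof.
rewrite /Vcurv /Riem; move: (dmx l _ u) (dmx k _ u) => A A'; mx_linear.
Qed.

Lemma Vcurv_bianchi l k a i u : U u -> Vcurv l k u i a + Vcurv k a u i l + Vcurv a l u i k = 0.
Proof.
move=> Uu.
have dsym m j p q : dmx m (Gam j) u p q = dmx m (Gam q) u p j.
  rewrite [LHS]dmxE [RHS]dmxE; apply: partial_eq_on oU Uu _ => v Uv; exact: Gam_sym.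
have prod m j q p : (Gam m u *m Gam j u) p q = (Gam m u *m Gam q u) p j.
  by rewrite !mxE; apply: eq_bigr => b _; rewrite (Gam_sym j q b Uu).
have gsym p q : G u p q = G u q p by rewrite -[in LHS](G_sym Uu) mxE.
have ee m j p q : (ecol m *m (ecol j)^T *m G u) p q = (p == m)%:R * G u j q.
  rewrite -mulmxA mxE big_ord1 /ecol trmx_delta -rowE !mxE eqxx andbT.
  by [].
have entry m j p q : Vcurv m j u p q = dmx m (Gam j) u p q - dmx j (Gam m) u p q
   + (Gam m u *m Gam j u) p q - (Gam j u *m Gam m u) p q
   - B u * ((p == m)%:R * G u j q) + B u * ((p == j)%:R * G u m q).
  rewrite -!ee /Vcurv /Riem.
  move: (dmx m (Gam j) u) (dmx j (Gam m) u) (Gam m u *m Gam j u) (Gam j u *m Gam m u)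
    (ecol m *m (ecol j)^T *m G u) (ecol j *m (ecol m)^T *m G u) => *; by rewrite !mxE.
rewrite !entry (dsym l k) (dsym l a) (dsym k a) (prod l k) (prod l a) (prod k a).
rewrite (gsym k a) (gsym l a) (gsym a l) (gsym k l).
rewrite (dsym a k i l) (prod a k l i).
move: (dmx l (Gam k) u i a) (dmx k (Gam l) u i a) (dmx a (Gam l) u i k) ((Gam l u *m Gam k u) i a)
  ((Gam k u *m Gam l u) i a) ((Gam a u *m Gam l u) i k) (G u a k) (G u l a) (G u l k)
  (i == l)%:R (i == k)%:R (i == a)%:R (B u) => *; ring.
Qed.

(** The Ricci identity for the parallel tensor [G]: its second partials, expanded by [dG],
    commute. *)
Lemma Riem_skew l k u : U u -> (G u *m Riem l k u)^T = - (G u *m Riem l k u).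
Proof.
move=> Uu; have H := dmxC oU l k sG Uu.
have D i j : dmx i (dmx j G) u = (dmx i (Gam j) u)^T *m G u + (Gam j u)^T *m dmx i G u
    + (dmx i G u *m Gam j u + G u *m dmx i (Gam j) u).
  rewrite (dmx_eq oU i Uu (fun v => @dG j v)).
  have st := smooth_mx_tr oU (sGam j).
  by rewrite (dmxD _ (smooth_mxM oU st sG) (smooth_mxM oU sG (sGam j)) Uu)
    (dmxM oU _ st sG Uu) (dmxM oU _ sG (sGam j) Uu) dmx_tr.
rewrite !D !dG// in H; move/eqP: H; rewrite -subr_eq0 => /eqP H.
apply/eqP; rewrite -addr_eq0; apply/eqP; rewrite -[RHS]H.
rewrite trmx_mul (G_sym Uu) /Riem.
move: (dmx l _ u) (dmx k _ u) => A A'; mx_expand; mx_linear.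
Qed.

Lemma Vcurv_skew l k u : U u -> (G u *m Vcurv l k u)^T = - (G u *m Vcurv l k u).
Proof.
move=> Uu; have H := Riem_skew l k Uu.
rewrite /Vcurv; move: (Riem l k u) H => Rm H.
by rewrite !mulmxDr !trmxD H; mx_expand; rewrite (G_sym Uu); mx_linear.
Qed.

Lemma Gam_swap i j u : U u -> Gam i u *m ecol j = Gam j u *m ecol i.
Proof. by move=> Uu; apply/colP => a; rewrite !col_entry Gam_sym. Qed.

Lemma Gam_swap_tr i j u p (X : 'M[R]_(p, 1)) : U u ->
  X *m (ecol j)^T *m (Gam i u)^T = X *m (ecol i)^T *m (Gam j u)^T.
Proof. by move=> Uu; rewrite -!mulmxA -!trmx_mul Gam_swap. Qed.

(** The Ricci identity for [S]. The [rho] terms cancel, and the [B] terms are exactly those that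
    turn [Riem] into [Vcurv]. *)
Lemma Vcurv_S l k u : U u -> Vcurv l k u *m S u = - (S u *m (Vcurv l k u)^T).
Proof.
move=> Uu; have H := dmxC oU l k sS Uu.
have D i j : dmx i (dmx j S) u =
   - (dmx i (Gam j) u *m S u + Gam j u *m dmx i S u)
   - (dmx i S u *m (Gam j u)^T + S u *m (dmx i (Gam j) u)^T)
   + ecol j *m (dmx i lam u)^T + dmx i lam u *m (ecol j)^T.
  rewrite (dmx_eq oU i Uu (fun v => @dS j v)).
  have st := smooth_mx_tr oU (sGam j); have sl := smooth_mx_tr oU slam.
  have se := smooth_mx_cst U (ecol j : 'cV[R]_n).
  have set := smooth_mx_cst U ((ecol j)^T : 'rV[R]_n).
  have s1 := smooth_mxM oU (sGam j) sS; have s2 := smooth_mxM oU sS st.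
  have s3 := smooth_mxM oU se sl; have s4 := smooth_mxM oU slam set.
  have s12 := smooth_mxB oU (smooth_mxN oU s1) s2.
  rewrite (dmxD _ (smooth_mxD oU s12 s3) s4 Uu) (dmxD _ s12 s3 Uu).
  rewrite (dmxB oU _ (smooth_mxN oU s1) s2 Uu) (dmxN _ s1 Uu).
  rewrite (dmxM oU _ (sGam j) sS Uu) (dmxM oU _ sS st Uu) (dmxM oU _ se sl Uu) (dmxM oU _ slam set Uu).
  by rewrite !dmx_cst !dmx_tr mul0mx mulmx0 add0r addr0.
rewrite !D !dS// !dlam// in H; move/eqP: H; rewrite -subr_eq0 => /eqP H.
apply/eqP; rewrite -addr_eq0; apply/eqP; rewrite -[RHS]oppr0 -[in RHS]H.
rewrite /Vcurv /Riem.
move: (dmx l _ u) (dmx k _ u) => A A'; mx_expand; rewrite (G_sym Uu) (S_sym Uu).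
rewrite (Gam_swap k l Uu) (Gam_swap_tr k l _ Uu); mx_linear.
Qed.

(** [Vcurv l k] is skew with respect to both [S] and [G], hence commutes with [S G]. *)
Lemma Vcurv_comm l k u : U u -> Vcurv l k u *m Lop u = Lop u *m Vcurv l k u.
Proof.
move=> Uu; rewrite /Lop mulmxA (Vcurv_S _ _ Uu) mulNmx.
have := Vcurv_skew l k Uu; rewrite trmx_mul (G_sym Uu) => H.
by rewrite -(mulmxA (S u) (Vcurv l k u)^T) H mulmxN opprK mulmxA.
Qed.

Lemma dLop k u : U u -> dmx k Lop u = Lop u *m Gam k u - Gam k u *m Lop u
  + lam u *m (ecol k)^T *m G u + ecol k *m flat u.
Proof.
move=> Uu; rewrite /Lop /flat (dmxM oU _ sS sG Uu) (dS _ Uu) (dG _ Uu).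
mx_expand; mx_linear.
Qed.

(** The Ricci identity for [lam]. One [B * flat] comes from differentiating [L], the other from
    replacing [Riem] by [Vcurv]. *)
Lemma Vcurv_lam l k u : U u -> let tau := \row_i (partial i rho u) + (B u *+ 2) *: flat u in
  Vcurv l k u *m lam u = tau 0 l *: ecol k - tau 0 k *: ecol l
    - partial l B u *: (Lop u *m ecol k) + partial k B u *: (Lop u *m ecol l).
Proof.
move=> Uu tau; have H := dmxC oU l k slam Uu.
have sL : smooth_mx U Lop by exact: smooth_mxM.
have D i j : dmx i (dmx j lam) u =
   - (dmx i (Gam j) u *m lam u + Gam j u *m dmx i lam u)
   + partial i rho u *: ecol j
   - (partial i B u *: (Lop u *m ecol j) + B u *: (dmx i Lop u *m ecol j)).
  rewrite (dmx_eq oU i Uu (fun v => @dlam j v)).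
  have se := smooth_mx_cst U (ecol j : 'cV[R]_n).
  have s1 := smooth_mxM oU (sGam j) slam.
  have s2 := smooth_mxZ oU srho se; have s3' := smooth_mxM oU sL se.
  have s3 := smooth_mxZ oU sB s3'.
  rewrite (dmxB oU _ (smooth_mxD oU (smooth_mxN oU s1) s2) s3 Uu).
  rewrite (dmxD _ (smooth_mxN oU s1) s2 Uu) (dmxN _ s1 Uu).
  rewrite (dmxM oU _ (sGam j) slam Uu) (dmxZ _ srho se Uu) (dmxZ _ sB s3' Uu).
  by rewrite (dmxM oU _ sL se Uu) !dmx_cst scaler0 addr0 mulmx0 addr0.
rewrite !D !dLop// !dlam// -!/(Lop u) in H; move/eqP: H; rewrite -subr_eq0 => /eqP H.
have fe (j i : 'I_n) : ecol i *m (lam u)^T *m G u *m ecol j = flat u 0 j *: ecol i.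
  rewrite -(mulmxA (ecol i)) -mulmxA -/(flat u); have -> : flat u *m ecol j = (flat u 0 j)%:M.
    by apply/matrixP => p q; rewrite !ord1 col_entry [RHS]mxE eqxx mulr1n.
  by rewrite mul_mx_scalar.
have gl i : (ecol i)^T *m G u *m lam u = (flat u 0 i)%:M.
  apply/matrixP => p q; rewrite !ord1 [RHS]mxE eqxx mulr1n -(col_entry (flat u)) /flat.
  have -> : ((lam u)^T *m G u *m ecol i) = ((ecol i)^T *m G u *m lam u)^T.
    by mx_expand; rewrite (G_sym Uu).
  by rewrite [RHS]mxE.
have ge i j : lam u *m (ecol i)^T *m G u *m ecol j = lam u *m (ecol j)^T *m G u *m ecol i.
  rewrite -!mulmxA; congr (_ *m _); apply/matrixP => p q; rewrite !ord1.
  have -> : (ecol i)^T *m (G u *m ecol j) = ((ecol j)^T *m (G u *m ecol i))^T.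
    by mx_expand; rewrite (G_sym Uu).
  by rewrite mxE.
have glc (i j : 'I_n) : ecol j *m (ecol i)^T *m G u *m lam u = flat u 0 i *: ecol j.
  by rewrite -!mulmxA (mulmxA (ecol i)^T) gl mul_mx_scalar.
apply/eqP; rewrite -subr_eq0; apply/eqP; rewrite -[RHS]oppr0 -[in RHS]H.
have tauE i : tau 0 i = partial i rho u + (B u *+ 2) * flat u 0 i.
  by rewrite /tau mxE [X in X + _]mxE [X in _ + X]mxE.
rewrite !tauE /Vcurv /Riem; clear H tauE tau D.
move: (dmx l _ u) (dmx k _ u) (Lop u) => A A' L.
mx_expand; rewrite !glc !fe (ge k l) (Gam_swap k l Uu).
rewrite -(mulmxA L (Gam l u)) -(mulmxA L (Gam k u)) (Gam_swap k l Uu).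
move: (flat u) (partial l rho u) (partial k rho u) (partial l B u) (partial k B u) (B u) (rho u).
move=> fl r1 r2 b1 b2 b r; mx_linear.
Qed.

Lemma partial_tr p (F : 'rV[R]_n -> 'M[R]_p) k u : smooth_mx U F -> U u ->
  partial k (fun v => \tr (F v)) u = \tr (dmx k F u).
Proof.
move=> sF Uu; rewrite /mxtrace (partial_sum oU) //; apply: eq_bigr => i _.
by rewrite dmxE.
Qed.

Lemma smooth_tr p (F : 'rV[R]_n -> 'M[R]_p) : smooth_mx U F -> smooth_on U (fun v => \tr (F v)).
Proof. by move=> sF; apply: smooth_sum. Qed.

Definition traceless (F : 'rV[R]_n -> 'M[R]_n) u : 'M[R]_n :=
  F u - (n%:R^-1 * \tr (F u)) *: 1%:M.

Lemma smooth_traceless F : smooth_mx U F -> smooth_mx U (traceless F).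
Proof.
move=> sF; apply: smooth_mxB => //; apply: smooth_mxZ => //.
  by apply: smoothZ => //; exact: smooth_tr.
exact: smooth_mx_cst.
Qed.

Lemma dmx_traceless F k u : smooth_mx U F -> U u ->
  dmx k (traceless F) u = dmx k F u - (n%:R^-1 * \tr (dmx k F u)) *: 1%:M.
Proof.
move=> sF Uu; have s1 := smoothZ n%:R^-1 oU (smooth_tr sF).
have s2 := smooth_mx_cst U (1%:M : 'M[R]_n).
rewrite (dmxB oU _ sF (smooth_mxZ oU s1 s2) Uu) (dmxZ _ s1 s2 Uu) dmx_cst scaler0 addr0.
by rewrite (partialZ _ _ (smooth_tr sF) Uu) (partial_tr _ sF Uu).
Qed.

(** Here [Riem] applied to [lam] is a pure trace as well, so its tracefree part [Wlam] vanishes. *)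
Definition trace_like u := exists th : 'rV[R]_n, forall l k,
  Vcurv l k u *m lam u = th 0 l *: ecol k - th 0 k *: ecol l.

Let dBrow u : 'rV[R]_n := \row_i partial i B u.

Lemma trace_like_of_critical u : U u -> dBrow u = 0 -> trace_like u.
Proof.
move=> Uu b0; have bk k : partial k B u = 0.
  by have := congr1 (fun A : 'rV[R]_n => A 0 k) b0; rewrite !mxE.
exists (\row_i (partial i rho u) + (B u *+ 2) *: flat u) => l k.
by rewrite (Vcurv_lam l k Uu) !bk !scale0r subr0 addr0.
Qed.

Lemma trace_like_of_scalar u c : U u -> Lop u = c *: 1%:M -> trace_like u.
Proof.
move=> Uu Lc; pose tau := \row_i (partial i rho u) + (B u *+ 2) *: flat u.
exists (tau - c *: dBrow u) => l k.
rewrite (Vcurv_lam l k Uu) -/tau Lc !mul_scale_mx !mul1mx.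
have E i : (tau - c *: dBrow u) 0 i = tau 0 i - c * partial i B u.
  by rewrite [LHS]mxE [X in _ + X]mxE [X in _ - X]mxE [dBrow _ _ _]mxE.
rewrite !E; move: (tau 0 l) (tau 0 k) (partial l B u) (partial k B u) => a a' b b'.
mx_linear.
Qed.

Hypothesis n_ge3 : (2 < n)%N.

Let n0 : (n%:R : R) != 0.
Proof. by rewrite pnatr_eq0 -lt0n; apply: leq_trans n_ge3. Qed.

Let L0 := traceless Lop.

Let sL : smooth_mx U Lop.
Proof. exact: smooth_mxM. Qed.

Let sL0 : smooth_mx U L0.
Proof. exact: smooth_traceless. Qed.

Let tr_L0 u : \tr (L0 u) = 0.
Proof.
rewrite /L0 /traceless mxtraceD -scaleN1r !mxtraceZ mxtrace1 mulN1r mulrAC mulVf//.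
by rewrite mul1r subrr.
Qed.

Let GLop_sym u : U u -> (G u *m Lop u)^T = G u *m Lop u.
Proof. by move=> Uu; rewrite /Lop; mx_expand; rewrite (G_sym Uu) (S_sym Uu). Qed.

Let GL0_sym u : U u -> (G u *m L0 u)^T = G u *m L0 u.
Proof.
move=> Uu; rewrite /L0 /traceless mulmxDr mulmxN mul_mx_scale mulmx1 trmxD trmxN trmxZ.
by rewrite (GLop_sym Uu) (G_sym Uu).
Qed.

Let L0_nonscalar u : U u -> ~ trace_like u -> forall c, L0 u != c *: 1%:M.
Proof.
move=> Uu ng c; apply/eqP => E; apply: ng; move: E; rewrite /L0 /traceless => /eqP.
by rewrite subr_eq -scalerDl => /eqP; exact: trace_like_of_scalar.
Qed.

(** The traceless part of a quadratic equation for [L]. As [L0] has trace zero, taking traces fixes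
    the scalar coefficient, and only [al] stays unknown. *)
Let L0_quadratic u : U u -> ~ trace_like u ->
  exists al, L0 u *m L0 u = al *: L0 u + (n%:R^-1 * \tr (L0 u *m L0 u)) *: 1%:M.
Proof.
move=> Uu ng.
have b0 : dBrow u != 0 by apply/eqP => h; apply: ng; exact: trace_like_of_critical.
pose tau := \row_i (partial i rho u) + (B u *+ 2) *: flat u.
have [|||||al [be E]] := @quadratic_of_curvature R n (G u) (Lop u) (fun l k => Vcurv l k u)
  (lam u) tau (dBrow u) (G_unit Uu) (G_sym Uu) (GLop_sym Uu) _ _ _ _ _ b0.
- by move=> l k; exact: Vcurv_skew.
- by move=> l k; exact: Vcurv_alt.
- by move=> l k a i; exact: Vcurv_bianchi.
- by move=> l k; exact: Vcurv_comm.
- by move=> l k; rewrite (Vcurv_lam l k Uu) -/tau /dBrow ![(\row_i _) 0 _]mxE.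
pose t := n%:R^-1 * \tr (Lop u).
have LE : Lop u = L0 u + t *: 1%:M by rewrite /L0 /traceless subrK.
have E2 : L0 u *m L0 u = (al - t - t) *: L0 u + (al * t + be - t * t) *: 1%:M.
  have : L0 u *m L0 u = Lop u *m Lop u - t *: L0 u - t *: L0 u - (t * t) *: 1%:M.
    rewrite LE; clearbody t; move: (L0 u) => X; mx_expand; rewrite !mulmx1 !mul1mx.
    by move: (1%:M : 'M[R]_n) => I1; mx_linear.
  rewrite E {1}LE -[be%:M]scalemx1 => ->; clearbody t.
  move: (1%:M : 'M[R]_n) (L0 u) => I1 X; mx_linear.
exists (al - t - t); rewrite {1}E2; congr (_ + _ *: _).
have := congr1 mxtrace E2.
rewrite mxtraceD (mxtraceZ _ (L0 u)) tr_L0 mulr0 add0r mxtraceZ mxtrace1 => ->.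
by rewrite [RHS]mulrCA mulVf ?mulr1.
Qed.

(** The covariant derivative of [L] in the direction [Z]. *)
Definition Kmx (Z : 'cV[R]_n) u : 'M[R]_n := lam u *m Z^T *m G u + Z *m flat u.

Let lin_flat u Z : U u -> lin (flat u) Z = \tr (lam u *m Z^T *m G u).
Proof.
move=> Uu; rewrite -mxtrace_tr; mx_expand; rewrite (G_sym Uu) mxtrace_mulC mulmxA.
by rewrite /lin /mxtrace big_ord1.
Qed.

Let tr_Kmx u Z : U u -> \tr (Kmx Z u) = lin (flat u) Z *+ 2.
Proof.
move=> Uu; rewrite mxtraceD -lin_flat// mxtrace_mulC mulr2n; congr (_ + _).
by rewrite /lin /mxtrace big_ord1.
Qed.

Let dL0 k u : U u -> dmx k L0 u = L0 u *m Gam k u - Gam k u *m L0 u + Kmx (ecol k) u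
   - (n%:R^-1 * (flat u 0 k *+ 2)) *: 1%:M.
Proof.
move=> Uu; rewrite (dmx_traceless k sL Uu) (dLop k Uu).
have -> : \tr (Lop u *m Gam k u - Gam k u *m Lop u + lam u *m (ecol k)^T *m G u + ecol k *m flat u)
   = flat u 0 k *+ 2.
  rewrite -(lin_delta (flat u)) -/(ecol k) -(tr_Kmx _ Uu) /Kmx.
  by rewrite -addrA mxtraceD raddfB /= [\tr (Gam k u *m _)]mxtrace_mulC subrr add0r.
rewrite /Kmx /L0 /traceless; move: (n%:R^-1 * \tr (Lop u)) (n%:R^-1 * _) => a b.
by mx_expand; rewrite !mulmx1 !mul1mx; move: (1%:M : 'M[R]_n) => I1; mx_linear.
Qed.

(** * Exclusion of an open set of points that are not trace-like *)

Section open_non_trace_like.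

Variable O : set 'rV[R]_n.
Hypothesis oO : open O.
Hypothesis OU : forall u, O u -> U u.
Hypothesis O_non_trace_like : forall u, O u -> ~ trace_like u.

Let Msq u := traceless (fun v => L0 v *m L0 v) u.

Let Msq_prop u : O u -> exists al, Msq u = al *: L0 u.
Proof.
move=> Ou; have [al E] := L0_quadratic (OU Ou) (O_non_trace_like Ou).
by exists al; rewrite /Msq /traceless {1}E addrK.
Qed.

Let L0_entry_neq0 u : O u -> exists p q, L0 u p q != 0.
Proof.
move=> Ou; apply: contrapT => H.
have := L0_nonscalar (OU Ou) (O_non_trace_like Ou) 0; rewrite scale0r => /eqP; apply.
apply/matrixP => p q; rewrite [RHS]mxE; apply/eqP/negPn/negP => h.
by apply: H; exists p, q.
Qed.

(* On an open set of non-[trace_like] points, [Msq] is proportional to [L0]: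
   this identity is the derivative of that proportionality. *)
Lemma codazzi_identity u : O u -> exists al (a z : 'rV[R]_n), forall m,
  Kmx (ecol m) u *m L0 u + L0 u *m Kmx (ecol m) u - al *: Kmx (ecol m) u
  = a 0 m *: L0 u + z 0 m *: 1%:M.
Proof.
move=> Ou; have Uu := OU Ou.
have sLL := smooth_mxM oU sL0 sL0.
have sM : smooth_mx U Msq by exact: smooth_traceless.
have [al ME] := Msq_prop Ou.
have [p [q pq]] := L0_entry_neq0 Ou.
have [al' E2] := L0_quadratic Uu (O_non_trace_like Ou).
pose y := n%:R^-1 * \tr (L0 u *m L0 u).
have {}E2 : L0 u *m L0 u = al *: L0 u + y *: 1%:M.
  by have := ME; rewrite /Msq /traceless => /eqP; rewrite subr_eq => /eqP.
pose Dm m := dmx m Msq u - al *: dmx m L0 u.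
have wedge_alg (a b c d e f : R) : a * f + al * e * d = b * e + al * f * c ->
    (a - al * c) * f = (b - al * d) * e.
  move=> /eqP; rewrite -subr_eq0 => /eqP E.
  by apply/eqP; rewrite -subr_eq0; apply/eqP; rewrite -[RHS]E; ring.
(* The factor between [Msq] and [L0] is only known to exist at each point, so the proportionality is
   differentiated in cross-multiplied form against a nonzero entry of [L0]. *)
have wedge m i j : Dm m i j * L0 u p q = Dm m p q * L0 u i j.
  have E : partial m (fun v => Msq v i j * L0 v p q) u = partial m (fun v => Msq v p q * L0 v i j) u.
    apply: partial_eq_on oO Ou _ => v Ov; have [b ->] := Msq_prop Ov.
    by rewrite !scale_mxE mulrAC.
  rewrite (partialM _ (sM i j) (sL0 p q) Uu) (partialM _ (sM p q) (sL0 i j) Uu) in E.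
  move: E; rewrite -!dmxE ME !scale_mxE.
  have DmE a b : Dm m a b = dmx m Msq u a b - al * dmx m L0 u a b.
    by rewrite /Dm; move: (dmx m Msq u) (dmx m L0 u) => X Y; rewrite !mxE.
  by rewrite !DmE => /wedge_alg.
pose b m := Dm m p q / L0 u p q.
have DE m : Dm m = b m *: L0 u.
  apply/matrixP => i j; rewrite [RHS]scale_mxE; apply: (mulIf pq); rewrite wedge /b.
  by rewrite mulrAC divfK.
pose f m := n%:R^-1 * (flat u 0 m *+ 2).
pose w m := n%:R^-1 * \tr (dmx m (fun v => L0 v *m L0 v) u).
exists al, (\row_m (b m + f m + f m)), (\row_m (w m - al * f m)) => m; rewrite ![(\row__ _) 0 m]mxE.
have := DE m; rewrite /Dm (dmx_traceless m sLL Uu) -/(w m) (dmxM oU _ sL0 sL0 Uu) (dL0 m Uu) -/(f m).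
move: (Kmx (ecol m) u) (Gam m u) (f m) (w m) (b m) => K Ga fm wm bm.
move: E2; move: (L0 u) => X E2.
move=> /eqP; rewrite subr_eq => /eqP H.
(* The quadratic equation makes the connection terms of both derivatives cancel. *)
have X2G : X *m X *m Ga = al *: (X *m Ga) + y *: Ga.
  by rewrite E2; mx_expand; rewrite mul1mx.
have GX2 : Ga *m X *m X = al *: (Ga *m X) + y *: Ga.
  by rewrite -mulmxA E2; mx_expand; rewrite mulmx1.
move: H; mx_expand; rewrite X2G GX2 !mulmx1 !mul1mx.
move=> /eqP; rewrite -subr_eq0 => /eqP H.
apply/eqP; rewrite -subr_eq0; apply/eqP; rewrite -[RHS]H.
move: (1%:M : 'M[R]_n) => I1; mx_linear.
Qed.

(** Lowering an index and extending from [ecol m] to all [Z] by linearity brings [codazzi_identity]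
    into the shape required by [codazzi_rank1]. *)
Lemma codazzi_forms u : O u -> exists al (a z : 'rV[R]_n),
  let k := (L0 u *m lam u)^T *m G u - al *: flat u in
  forall X Y Z,
    lin (flat u) X * bil (G u *m L0 u) Z Y + lin k X * bil (G u) Z Y
    + (lin (flat u) Y * bil (G u *m L0 u) X Z + lin k Y * bil (G u) X Z)
    = lin a Z * bil (G u *m L0 u) X Y + lin z Z * bil (G u) X Y.
Proof.
move=> Ou; have Uu := OU Ou; have [al [a [z H]]] := codazzi_identity Ou.
exists al, a, z => k X Y Z.
have HZ : Kmx Z u *m L0 u + L0 u *m Kmx Z u - al *: Kmx Z u
    = lin a Z *: L0 u + lin z Z *: 1%:M.
  have ZE : Z = \sum_m Z m 0 *: ecol m.
    by rewrite {1}[Z]matrix_sum_delta; apply: eq_bigr => m _; rewrite big_ord1.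
  have KE : Kmx Z u = \sum_m Z m 0 *: Kmx (ecol m) u.
    rewrite /Kmx; under [RHS]eq_bigr do rewrite scalerDr.
    rewrite big_split /=; congr (_ + _).
      rewrite {1}ZE linear_sum /= mulmx_sumr mulmx_suml; apply: eq_bigr => m _.
      by rewrite linearZ /= -scalemxAr -scalemxAl.
    by rewrite {1}ZE mulmx_suml; apply: eq_bigr => m _; rewrite -scalemxAl.
  have linE (t : 'rV[R]_n) : lin t Z = \sum_m Z m 0 * t 0 m.
    by rewrite /lin mxE; apply: eq_bigr => m _; rewrite mulrC.
  rewrite KE !linE mulmx_suml mulmx_sumr scaler_sumr -big_split -sumrB /=.
  rewrite !scaler_suml -big_split /=; apply: eq_bigr => m _.
  rewrite -!scalerA -scalerDr -H; move: (Kmx (ecol m) u) (L0 u) => K1 X1.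
  by mx_expand; mx_linear.
have := congr1 (fun A : 'M[R]_n => bil (G u *m A) X Y) HZ.
have bilE (p : 'cV[R]_n) (s : 'rV[R]_n) : bil (p *m s) X Y = (X^T *m p) 0 0 * lin s Y.
  by rewrite /bil mulmxA -mulmxA mxE big_ord1.
have fl : (G u *m lam u)^T = flat u by rewrite trmx_mul (G_sym Uu).
have flL : flat u *m L0 u = (L0 u *m lam u)^T *m G u.
  rewrite /flat -mulmxA -[G u *m L0 u](GL0_sym Uu) trmx_mul (G_sym Uu).
  by rewrite trmx_mul -!mulmxA.
have XG (p : 'cV[R]_n) : (X^T *m (G u *m p)) 0 0 = lin ((G u *m p)^T) X.
  have -> : X^T *m (G u *m p) = ((G u *m p)^T *m X)^T by rewrite trmx_mul trmxK.
  by rewrite mxE.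
have XGl : (X^T *m (G u *m lam u)) 0 0 = lin (flat u) X by rewrite XG fl.
have XGLl : (X^T *m (G u *m (L0 u *m lam u))) 0 0 = lin ((L0 u *m lam u)^T *m G u) X.
  by rewrite XG trmx_mul (G_sym Uu).
rewrite /k -scaleNr.
have e1 : bil (G u *m (Kmx Z u *m L0 u)) X Y
    = lin (flat u) X * bil (G u *m L0 u) Z Y + bil (G u) X Z * lin ((L0 u *m lam u)^T *m G u) Y.
  have -> : G u *m (Kmx Z u *m L0 u)
      = (G u *m lam u) *m (Z^T *m (G u *m L0 u)) + (G u *m Z) *m (flat u *m L0 u).
    by rewrite /Kmx mulmxDl mulmxDr !mulmxA.
  by rewrite bil_add !bilE XGl flL /bil /lin !mulmxA.
have e2 : bil (G u *m (L0 u *m Kmx Z u)) X Y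
    = lin ((L0 u *m lam u)^T *m G u) X * bil (G u) Z Y + bil (G u *m L0 u) X Z * lin (flat u) Y.
  have -> : G u *m (L0 u *m Kmx Z u)
      = (G u *m (L0 u *m lam u)) *m (Z^T *m G u) + (G u *m L0 u *m Z) *m flat u.
    by rewrite /Kmx; move: (L0 u) (flat u) => XX ff; rewrite !mulmxDr !mulmxA.
  by rewrite bil_add !bilE XGLl /bil /lin !mulmxA.
have e3 : bil (G u *m Kmx Z u) X Y = lin (flat u) X * bil (G u) Z Y + bil (G u) X Z * lin (flat u) Y.
  have -> : G u *m Kmx Z u = (G u *m lam u) *m (Z^T *m G u) + (G u *m Z) *m flat u.
    by rewrite /Kmx; move: (flat u) => ff; rewrite !mulmxDr !mulmxA.
  by rewrite bil_add !bilE XGl /bil /lin !mulmxA.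
move=> E; move: E e1 e2 e3; clear.
move: (Kmx Z u) (L0 u) ((L0 u *m lam u)^T *m G u) (flat u) (lin a Z) (lin z Z) => K X0 r ff aZ zZ.
rewrite -!scaleNr !mulmxDr !mul_mx_scale mulmx1 !bil_add !bil_scale => E e1 e2 e3.
move: E; rewrite e1 e2 e3 => <-; clear.
rewrite !lin_add !lin_scale.
move: (lin ff X) (lin ff Y) (lin r X) (lin r Y) (bil (G u *m X0) Z Y) (bil (G u *m X0) X Z)
  (bil (G u) X Z) (bil (G u) Z Y) => *; ring.
Qed.

(** [codazzi_rank1] gives [L0 = b + e (lam flat)]. Applied to [lam], commutation with V says that V
    lam times [flat lam] equals [lam] times [flat V lam], which is zero by skewness. So
    [flat lam = 0], as otherwise V lam would vanish, and the trace of [L0] then gives [b = 0]. *)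
Lemma L0_rank1 u : O u -> exists e, [/\ e != 0, L0 u = e *: (lam u *m flat u),
  flat u *m lam u = 0 & flat u != 0].
Proof.
move=> Ou; have Uu := OU Ou.
have z0 j : (0 : 'rV[R]_n) 0 j = 0 by rewrite mxE.
have lam0 : lam u != 0.
  apply/eqP => l0; apply: (O_non_trace_like Ou); exists 0 => l k.
  by rewrite l0 mulmx0 !z0 !scale0r subrr.
have fl0 : flat u != 0.
  apply/eqP => f0; move/eqP: lam0; apply.
  by rewrite -[lam u]trmxK -[(lam u)^T](mulmxK (G_unit Uu)) -/(flat u) f0 mul0mx trmx0.
have SG c : G u *m L0 u != c *: G u.
  apply/eqP => E; have := L0_nonscalar Uu (O_non_trace_like Ou) c; move/eqP; apply.
  by apply: (can_inj (mulKmx (G_unit Uu))); rewrite E mul_mx_scale mulmx1.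
have [al [a [z H]]] := codazzi_forms Ou.
have [b [e E]] := codazzi_rank1 n_ge3 (G_unit Uu) (G_sym Uu) (GL0_sym Uu) fl0 SG H.
have flT : (flat u)^T = G u *m lam u by rewrite /flat trmx_mul trmxK (G_sym Uu).
have {}E : L0 u = b *: 1%:M + e *: (lam u *m flat u).
  apply: (can_inj (mulKmx (G_unit Uu))); rewrite E mulmxDr !mul_mx_scale mulmx1.
  by rewrite flT; congr (_ + _ *: _); rewrite -[LHS]mulmxA.
have e0 : e != 0.
  apply/eqP => e0; have := L0_nonscalar Uu (O_non_trace_like Ou) b.
  by rewrite E e0 scale0r addr0 eqxx.
have q0 : flat u *m lam u = 0.
  apply: contrapT => q0.
  apply: (O_non_trace_like Ou); exists 0 => l k; rewrite !z0 !scale0r subrr.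
  (* [Lop] is a scalar plus [e] times the rank-one part, and [e] is nonzero. *)
  have C : Vcurv l k u *m (lam u *m flat u) = (lam u *m flat u) *m Vcurv l k u.
    have LE : Lop u = (b + n%:R^-1 * \tr (Lop u)) *: 1%:M + e *: (lam u *m flat u).
      by have /eqP := E; rewrite /L0 /traceless subr_eq addrAC -scalerDl => /eqP.
    have := Vcurv_comm l k Uu; rewrite LE.
    move: (Vcurv l k u) (lam u *m flat u) (b + _) => V F t.
    rewrite mulmxDr mulmxDl !mul_mx_scale !mul_scale_mx mulmx1 mul1mx.
    by move=> /addrI/(scalerI e0).
  have K0 : flat u *m Vcurv l k u *m lam u = 0.
    have T : (flat u *m Vcurv l k u *m lam u)^T = - (flat u *m Vcurv l k u *m lam u).
      have := Vcurv_skew l k Uu; rewrite trmx_mul (G_sym Uu) => HV.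
      rewrite /flat; move: (Vcurv l k u) (lam u) HV => V x HV.
      have -> : (x^T *m G u *m V *m x)^T = x^T *m (V^T *m G u) *m x.
        by mx_expand; rewrite (G_sym Uu).
      by rewrite HV mulmxN mulNmx !mulmxA.
    apply/matrixP => i j; rewrite !ord1 [RHS]mxE.
    have := congr1 (fun A : 'M[R]_1 => A 0 0) T; rewrite [LHS]mxE [RHS]mxE.
    by move: ((flat u *m Vcurv l k u *m lam u) 0 0) => x; lra.
  have qq : flat u *m lam u = ((flat u *m lam u) 0 0)%:M.
    by apply/matrixP => i j; rewrite !ord1 [RHS]mxE eqxx mulr1n.
  move: q0 C K0 qq; move: (Vcurv l k u) (lam u) (flat u) => V x f q0 C K0 qq.
  have : V *m x *m (f *m x) = 0.
    by rewrite mulmxA -[V *m x *m f]mulmxA C -!mulmxA [f *m (_ *m _)]mulmxA K0 mulmx0.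
  rewrite qq mul_mx_scalar => /eqP.
  rewrite scaler_eq0 => /orP[/eqP h|/eqP //].
  by exfalso; apply: q0; rewrite qq h raddf0.
have b0 : b = 0.
  have := tr_L0 u; rewrite E mxtraceD !mxtraceZ mxtrace1 mxtrace_mulC q0 mxtrace0 mulr0 addr0.
  by move=> /eqP; rewrite mulf_eq0 (negbTE n0) orbF => /eqP.
by exists e; split=> //; rewrite E b0 scale0r add0r.
Qed.

(** [L0] squares to zero because [lam] is null. In the derivative of this equation both sides are
    multiples of [lam flat], with coefficients [2 e f] and [4 e f / n] for a nonzero component [f]
    of [flat], which forces [n = 2]. *)
Lemma no_open_non_trace_like u : ~ O u.
Proof.
move=> Ou; have Uu := OU Ou.
have sq v : O v -> L0 v *m L0 v = 0.
  move=> Ov; have [e [_ -> q0 _]] := L0_rank1 Ov.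
  rewrite mul_scale_mx mul_mx_scale -mulmxA [flat v *m (_ *m _)]mulmxA q0 mul0mx mulmx0.
  by rewrite !scaler0.
have [e [e0 LE q0 fl0]] := L0_rank1 Ou.
have D m : Kmx (ecol m) u *m L0 u + L0 u *m Kmx (ecol m) u
    = (n%:R^-1 * (flat u 0 m *+ 4)) *: L0 u.
  have : dmx m (fun v => L0 v *m L0 v) u = 0.
    by rewrite (dmx_eq oO m Ou (G := fun=> 0)) ?dmx_cst.
  rewrite (dmxM oU _ sL0 sL0 Uu) (dL0 m Uu); have := sq u Ou.
  move: (L0 u) (Kmx (ecol m) u) (Gam m u) => X K Ga X2.
  mx_expand; rewrite -[Ga *m X *m X]mulmxA X2 mulmx0 mul0mx !mulmx1 !mul1mx.
  move=> /eqP; rewrite -subr_eq0 => /eqP H; apply/eqP; rewrite -subr_eq0; apply/eqP.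
  rewrite -[RHS]H.
  mx_linear.
have [m fm] : exists m, flat u 0 m != 0.
  apply: contrapT => H; move/eqP: fl0; apply; apply/rowP => m; rewrite [RHS]mxE.
  by apply/eqP/negPn/negP => h; apply: H; exists m.
have gl : (ecol m)^T *m G u *m lam u = (flat u 0 m)%:M.
  have -> : (ecol m)^T *m G u *m lam u = (flat u *m ecol m)^T.
    by rewrite /flat; mx_expand; rewrite (G_sym Uu).
  by apply/matrixP => i j; rewrite !ord1 [LHS]mxE col_entry [RHS]mxE eqxx mulr1n.
have := D m; rewrite LE /Kmx mulmxDl mulmxDr !mul_mx_scale !mul_scale_mx.
have -> : lam u *m (ecol m)^T *m G u *m (lam u *m flat u) = flat u 0 m *: (lam u *m flat u).
  move: (flat u) (flat u 0 m) gl => f t gl.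
  by rewrite !mulmxA -(mulmxA (lam u)) -(mulmxA (lam u)) gl mul_mx_scalar mul_scale_mx.
have -> : ecol m *m flat u *m (lam u *m flat u) = 0.
  by move: (flat u) (lam u) q0 => f x q0; rewrite -mulmxA [f *m (_ *m _)]mulmxA q0 mul0mx mulmx0.
have -> : lam u *m flat u *m (lam u *m (ecol m)^T *m G u) = 0.
  by move: (flat u) (lam u) q0 => f x q0; rewrite -!mulmxA [f *m (x *m _)]mulmxA q0 mul0mx mulmx0.
have -> : lam u *m flat u *m (ecol m *m flat u) = flat u 0 m *: (lam u *m flat u).
  have : flat u *m ecol m = (flat u 0 m)%:M.
    by apply/matrixP => i j; rewrite !ord1 col_entry [RHS]mxE eqxx mulr1n.
  move: (flat u) (flat u 0 m) => f t fe.
  by rewrite -mulmxA [f *m (_ *m _)]mulmxA fe mul_scalar_mx mul_mx_scale.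
rewrite !scaler0 addr0 add0r !scalerA -scalerDl => /eqP.
rewrite -subr_eq0 -scalerBl scaler_eq0 => /orP[/eqP h|/eqP h].
  have : e * flat u 0 m * (2 * n%:R - 4) = 0.
    have -> : e * flat u 0 m * (2 * n%:R - 4) =
      n%:R * (e * flat u 0 m + e * flat u 0 m - n%:R^-1 * (flat u 0 m *+ 4) * e).
      by field.
    by rewrite h mulr0.
  move=> /eqP; rewrite !mulf_eq0 (negbTE e0) (negbTE fm) /= subr_eq0 => /eqP h2.
  have : (2 * n)%:R = 4%:R :> R by rewrite natrM.
  move/eqP; rewrite eqr_nat; move: n_ge3; lia.
have := L0_nonscalar Uu (O_non_trace_like Ou) 0; rewrite LE h scaler0 scale0r eqxx //.
Qed.

End open_non_trace_like.

(** The Schouten tensor with [lam] in its first slot, so that [Wlam] is the projective Weyl tensor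
    applied to [lam]. *)
Definition pcontr j u : R := (n%:R - 1)^-1 * \sum_a (Riem a j u *m lam u) a 0.

Definition Wlam j k u : 'cV[R]_n :=
  Riem j k u *m lam u + pcontr j u *: ecol k - pcontr k u *: ecol j.

(** If [Riem j k] sends [lam] to [eta_j e_k - eta_k e_j], contraction gives [pcontr = - eta], and
    the Schouten terms cancel the curvature term. *)
Lemma Wlam_trace_like j k u : U u -> trace_like u -> Wlam j k u = 0.
Proof.
move=> Uu [th thE].
have RE l m : Riem l m u *m lam u
    = (th 0 l - B u * flat u 0 l) *: ecol m - (th 0 m - B u * flat u 0 m) *: ecol l.
  have fe (i q : 'I_n) : ecol q *m (ecol i)^T *m G u *m lam u = flat u 0 i *: ecol q.
    have gl : (ecol i)^T *m G u *m lam u = (flat u 0 i)%:M.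
      have -> : (ecol i)^T *m G u *m lam u = (flat u *m ecol i)^T.
        by rewrite /flat; mx_expand; rewrite (G_sym Uu).
      by apply/matrixP => p r; rewrite !ord1 [LHS]mxE col_entry [RHS]mxE eqxx mulr1n.
    by rewrite -!mulmxA (mulmxA (ecol i)^T) gl mul_mx_scalar.
  have := thE l m; rewrite /Vcurv; move: (Riem l m u) => X.
  mx_expand; rewrite !fe; move: (flat u 0 l) (flat u 0 m) (th 0 l) (th 0 m) => a b c d.
  move=> /eqP; rewrite -subr_eq0 => /eqP H; apply/eqP; rewrite -subr_eq0; apply/eqP.
  by rewrite -[RHS]H; mx_linear.
pose eta i := th 0 i - B u * flat u 0 i.
have PE l : pcontr l u = - eta l.
  rewrite /pcontr; under eq_bigr => a _.
    rewrite RE -!/(eta _).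
    have -> : (eta a *: ecol l - eta l *: ecol a : 'cV[R]_n) a 0
       = eta a * (a == l)%:R - eta l.
      by rewrite !mxE !eqxx !andbT mulr1.
    over.
  rewrite sumrB sumr_const card_ord (bigD1 l) //= eqxx mulr1 big1 ?addr0; last first.
    by move=> a /negbTE ->; rewrite mulr0.
  have n1 : (n%:R - 1 : R) != 0.
    by rewrite subr_eq0 pnatr_eq1; apply/eqP; move: n_ge3; lia.
  by rewrite -mulr_natr; field.
by rewrite /Wlam RE !PE -!/(eta _); mx_linear.
Qed.

Let smooth_Wlam j k : smooth_mx U (Wlam j k).
Proof.
have sR l m : smooth_mx U (Riem l m).
  apply: smooth_mxB => //; last exact: smooth_mxM.
  apply: smooth_mxD => //; last exact: smooth_mxM.
  by apply: smooth_mxB => //; exact: smooth_dmx.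
have sP l : smooth_on U (pcontr l).
  apply: smoothZ => //; apply: smooth_sum => // a _.
  by apply: smooth_mxM.
apply: smooth_mxB => //; last by apply: smooth_mxZ => //; exact: smooth_mx_cst.
apply: smooth_mxD => //; first exact: smooth_mxM.
by apply: smooth_mxZ => //; exact: smooth_mx_cst.
Qed.

Lemma Wlam_eq0 j k u : U u -> Wlam j k u = 0.
Proof.
move=> Uu; apply/colP => i; rewrite [RHS]mxE; apply/eqP/negPn/negP => W0.
(* The complement of the trace-like points is not evidently open. This set is, by continuity of
   [Wlam], and it contains no trace-like point. *)
pose O := U `&` [set v | Wlam j k v i 0 != 0].
apply: (@no_open_non_trace_like O _ _ _ u) => //.
- rewrite openE => v [Uv Wv]; apply: filterI; first exact: open_nbhs_nbhs.
  have cW : {for v, continuous (fun v => Wlam j k v i 0)}.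
    exact: (smooth_continuous (smooth_Wlam j k i 0) Uv).
  have : \forall y \near Wlam j k v i 0, y != 0 by exact: open_nbhs_nbhs (conj (@open_neq R 0) Wv).
  by move/cW.
- by move=> v [].
- move=> v [Uv Wv] gv; move/eqP: Wv; apply.
  by rewrite (Wlam_trace_like _ _ Uv gv) mxE.
Qed.

End chart_calculus.

Opaque gmx christoffel.

(** * The system attached to two projectively related metrics *)

Section connection_matrices.
Context {R : realType} {n : nat} {M : manifold R n} (h : metric M).
Implicit Types (c d : chart R M n) (u v : 'rV[R]_n) (i j k l s : 'I_n).

Definition conn c k u : 'M[R]_n := \matrix_(i, j) christoffel h c i k j (cinv c u).

Lemma connE c k u i j : conn c k u i j = christoffel h c i k j (cinv c u).
Proof. by rewrite mxE. Qed.

Opaque conn.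

Lemma smooth_conn c k : atlas c -> smooth_mx (cimg c) (conn c k).
Proof.
move=> ac i j; apply: smooth_eq (open_cimg c) _ (smooth_christoffel h i k j ac).
by move=> u _; rewrite connE.
Qed.

Lemma conn_sym c k j i u : atlas c -> cimg c u -> conn c k u i j = conn c j u i k.
Proof. by move=> ac Uu; rewrite !connE christoffel_sym. Qed.

Lemma dmx_gmx c k u : atlas c -> cimg c u ->
  dmx k (gmx h c) u = (conn c k u)^T *m gmx h c u + gmx h c u *m conn c k u.
Proof.
move=> ac Uu; apply/matrixP => i j.
have E a b : (gmx h c u *m conn c k u) a b = christoffel1 h c a k b u.
  rewrite -christoffel_lower// [LHS]mxE; apply: eq_bigr => m _; by rewrite connE.
have -> : (conn c k u)^T *m gmx h c u = (gmx h c u *m conn c k u)^T.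
  by rewrite trmx_mul (gmx_tr h ac Uu).
rewrite [RHS]mxE [X in X + _]mxE !E /christoffel1.
have s1 := dmx_gmx_sym h i k j ac Uu; have s2 := dmx_gmx_sym h j k i ac Uu.
have s3 := dmx_gmx_sym h k j i ac Uu.
move: s1 s2 s3; move: (dmx i (gmx h c) u) (dmx j (gmx h c) u) (dmx k (gmx h c) u) => X Y Z.
by move=> -> -> ->; field.
Qed.

Lemma riemann_conn c i s j k u : cimg c u ->
  riemann h c i s j k (cinv c u) = Riem (conn c) j k u i s.
Proof.
move=> Uu; rewrite /riemann !(pdE _ _ Uu) /Riem.
have pE a b : partial a (fun v => christoffel h c i b s (cinv c v)) u = dmx a (conn c b) u i s.
  by rewrite dmxE; congr (partial a _ u); apply/funext => v; rewrite connE.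
rewrite !pE sumrB; move: (dmx j (conn c k) u) (dmx k (conn c j) u) => X Y.
have mE a b : \sum_e christoffel h c i a e (cinv c u) * christoffel h c e b s (cinv c u)
    = (conn c a u *m conn c b u) i s.
  by rewrite [RHS]mxE; apply: eq_bigr => e _; rewrite !connE.
rewrite !mE; move: (conn c j u *m conn c k u) (conn c k u *m conn c j u) => Z T.
by rewrite [in RHS]mxE [in RHS]mxE [in RHS]mxE [X in _ = _ + X + _ + _]mxE [X in _ = _ + X]mxE addrA.
Qed.

Lemma ricci_conn c s j u : cimg c u ->
  ricci h c s j (cinv c u) = \sum_a Riem (conn c) a j u a s.
Proof. by move=> Uu; apply: eq_bigr => a _; exact: riemann_conn. Qed.

Lemma weyl_conn c (lam : 'rV[R]_n -> 'cV[R]_n) i j k u : cimg c u ->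
  \sum_s lam u s 0 * weyl h c i s j k (cinv c u) = Wlam (conn c) lam j k u i 0.
Proof.
move=> Uu.
have RE a b e : (Riem (conn c) a b u *m lam u) e 0
    = \sum_s lam u s 0 * riemann h c e s a b (cinv c u).
  by rewrite [LHS]mxE; apply: eq_bigr => s _; rewrite riemann_conn// mulrC.
have PE b : pcontr (conn c) lam b u = \sum_s lam u s 0 * schouten h c s b (cinv c u).
  rewrite /pcontr /schouten /ricci.
  under eq_bigr do rewrite RE.
  rewrite exchange_big mulr_sumr; apply: eq_bigr => s _.
  by rewrite -mulr_sumr mulrCA.
rewrite /Wlam; have -> (A : 'cV[R]_n) a b :
  (A + a *: ecol k - b *: ecol j) i 0 = A i 0 + (i == k)%:R * a - (i == j)%:R * b.
  by rewrite !mxE !eqxx !andbT ![_ * _%:R]mulrC.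
rewrite RE !PE !mulr_sumr -big_split -sumrB /=; apply: eq_bigr => s _.
rewrite /weyl; move: (riemann _ _ _ _ _ _ _) (schouten _ _ _ _ _) (schouten _ _ _ _ _) => x y z.
move: (_ == _)%:R (_ == _)%:R (lam u s 0) => a b e; ring.
Qed.

End connection_matrices.

(** * Derivation of the closed system from projective equivalence and the Schouten hypothesis *)

Section projectively_related.
Context {R : realType} {n : nat} {M : manifold R n} (g gbar : metric M).
Hypothesis gg : geodesics_reparametrise g gbar.
Variable c : chart R M n.
Hypothesis ac : atlas c.
Implicit Types (u v : 'rV[R]_n) (i j k l s : 'I_n).

Let U := cimg c.
Let oU : open U := open_cimg c.

Definition phi u : 'rV[R]_n := \row_i partial i (upsilon g gbar c) u.
(** The tensor S. The derivative of the factor [e^(2 Upsilon)] cancels the term [- 2 phi_k S] coming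
    from the part [phi_k] times identity of the connection difference. *)
Definition bar_inverse u : 'M[R]_n :=
  expR (2 * upsilon g gbar c u) *: invmx (gmx gbar c u).
Definition lambda_col u : 'cV[R]_n := - (bar_inverse u *m (phi u)^T).

Lemma phiE u i : phi u 0 i = partial i (upsilon g gbar c) u.
Proof. by rewrite mxE. Qed.

Opaque phi.

Lemma smooth_phi : smooth_mx U phi.
Proof.
move=> a i; apply: smooth_eq (oU) _ (smooth_partial i (smooth_upsilon g gbar ac)).
by move=> u _; rewrite ord1 phiE.
Qed.

Lemma lambda_colE u s : U u -> lambda_col u s 0 = lambda g gbar c s (cinv c u).
Proof.
move=> Uu; rewrite /lambda /lambda_col /bar_inverse mul_scale_mx.
have -> (a : R) (A : 'M[R]_n) : (- (a *: (A *m (phi u)^T))) s 0 = - a * \sum_i A s i * phi u 0 i.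
  rewrite mulNr [LHS]mxE scale_mxE [(A *m _) _ _]mxE; congr (- (_ * _)).
  by apply: eq_bigr => i _; rewrite [_^T _ _]mxE.
by congr (_ * _); apply: eq_bigr => i _; rewrite phiE pdE.
Qed.

Lemma conn_bar k u : U u ->
  conn gbar c k u = conn g c k u + phi u 0 k *: 1%:M + ecol k *m phi u.
Proof.
move=> Uu; apply/matrixP => i j.
have -> (A : 'M[R]_n) (a : R) (r : 'rV[R]_n) :
    (A + a *: 1%:M + ecol k *m r) i j = A i j + (i == j)%:R * a + (i == k)%:R * r 0 j.
  rewrite mxE [X in X + _]mxE scale_mxE mulrC [1%:M _ _]mxE; congr (_ + _).
  by rewrite mxE big_ord1 [ecol _ _ _]mxE eqxx andbT.
rewrite !connE (christoffel_projective _ _ _ gg ac Uu) !phiE.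
by rewrite [RHS]addrAC.
Qed.

(** [Phi m] is the covariant derivative of [phi] along [m] minus [phi_m phi]. Since [phi] is a
    gradient, no multiple of the identity appears in the change of curvature. *)
Lemma Riem_bar (Phi : 'I_n -> 'rV[R]_n) l k u : U u ->
  (forall m, dmx m phi u - phi u *m conn g c m u - phi u 0 m *: phi u = Phi m) ->
  Riem (conn gbar c) l k u = Riem (conn g c) l k u + ecol k *m Phi l - ecol l *m Phi k.
Proof.
move=> Uu PhiE; rewrite /Riem.
have sp := smooth_phi; have sG k' := smooth_conn g k' ac.
have D a b : dmx a (conn gbar c b) u
    = dmx a (conn g c b) u + dmx a phi u 0 b *: 1%:M + ecol b *m dmx a phi u.
  rewrite (dmx_eq oU a Uu (@conn_bar b)).
  have s1 := smooth_mx_cst U (1%:M : 'M[R]_n); have se := smooth_mx_cst U (ecol b : 'cV[R]_n).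
  rewrite (dmxD _ (smooth_mxD oU (sG b) (smooth_mxZ oU (sp 0 b) s1)) (smooth_mxM oU se sp) Uu).
  rewrite (dmxD _ (sG b) (smooth_mxZ oU (sp 0 b) s1) Uu) (dmxZ _ (sp 0 b) s1 Uu).
  by rewrite (dmxM oU _ se sp Uu) !dmx_cst mul0mx scaler0 addr0 add0r -dmxE.
have C : dmx l phi u 0 k = dmx k phi u 0 l.
  rewrite [LHS]dmxE [RHS]dmxE.
  have E a : (fun v => phi v 0 a) = partial a (upsilon g gbar c) by apply/funext => v; rewrite phiE.
  by rewrite (E l) (E k); exact: (smooth_partialC oU l k (smooth_upsilon g gbar ac) Uu).
have sw : conn g c l u *m ecol k = conn g c k u *m ecol l.
  by apply/colP => a; rewrite !col_entry conn_sym.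
have pe m p (X : 'M[R]_(p, 1)) : X *m phi u *m ecol m = phi u 0 m *: X.
  rewrite -mulmxA; have -> : phi u *m ecol m = (phi u 0 m)%:M.
    by apply/matrixP => a b; rewrite !ord1 col_entry [RHS]mxE eqxx mulr1n.
  by rewrite mul_mx_scalar.
rewrite (D l k) (D k l).
rewrite (conn_bar l Uu) (conn_bar k Uu).
rewrite -(PhiE l) -(PhiE k); move: C.
move: (dmx l (conn g c k) u) (dmx k (conn g c l) u) (dmx l phi u) (dmx k phi u) => A A' F F' C.
move: (conn g c l u) (conn g c k u) sw => Gl Gk sw.
mx_expand; rewrite !pe sw !mulmx1 !mul1mx C !mul_scale_mx.
move: (phi u) (phi u 0 l) (phi u 0 k) (F' 0 l) (1%:M : 'M[R]_n) => p pl pk t I1.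
mx_linear.
Qed.

Opaque Riem.

Variables B Bbar : 'rV[R]_n -> R.
Hypothesis n_ge2 : (2 <= n)%N.
Hypothesis P_eq : forall u i j, U u ->
  schouten g c i j (cinv c u) - B u * gmx g c u i j
  = schouten gbar c i j (cinv c u) - Bbar u * gmx gbar c u i j.

(** Contracting [Riem_bar] multiplies [Phi k] by [1 - n], so the Schouten tensors differ exactly by
    [Phi], and [P_eq] expresses [Phi] through the two metrics. *)
Lemma dphi k u : U u -> dmx k phi u =
  phi u *m conn g c k u + phi u 0 k *: phi u
  + (ecol k)^T *m (B u *: gmx g c u - Bbar u *: gmx gbar c u).
Proof.
move=> Uu; have [Phi PhiE] : exists Phi : 'I_n -> 'rV[R]_n, forall m : 'I_n,
    dmx m phi u - phi u *m conn g c m u - phi u 0 m *: phi u = Phi m.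
  by exists (fun m : 'I_n => dmx m phi u - phi u *m conn g c m u - phi u 0 m *: phi u).
have n1 : (n%:R - 1 : R) != 0 by rewrite subr_eq0 pnatr_eq1; apply/eqP; move: n_ge2; lia.
have SE s : schouten gbar c s k (cinv c u) = schouten g c s k (cinv c u) - Phi k 0 s.
  rewrite /schouten !(ricci_conn _ _ _ Uu).
  have RE a : Riem (conn gbar c) a k u a s
      = Riem (conn g c) a k u a s + ((a == k)%:R * Phi a 0 s - Phi k 0 s).
    rewrite (Riem_bar a k Uu PhiE).
    move: (Riem (conn g c) a k u) (Phi a) (Phi k) => X r t.
    have e (b : 'I_n) (q : 'rV[R]_n) : (ecol b *m q) a s = (a == b)%:R * q 0 s.
      by rewrite mxE big_ord1 [ecol _ _ _]mxE eqxx andbT.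
    by rewrite [LHS]mxE [X in X + _]mxE [X in _ + X]mxE !e eqxx mul1r addrA.
  have SRE : \sum_(a < n) Riem (conn gbar c) a k u a s
      = \sum_(a < n) Riem (conn g c) a k u a s + (1 - n%:R) * Phi k 0 s.
    transitivity (\sum_(a < n) (Riem (conn g c) a k u a s + ((a == k)%:R * Phi a 0 s - Phi k 0 s))).
      by apply: eq_bigr => a _; exact: RE.
    rewrite big_split; congr (_ + _).
    rewrite sumrB sumr_const card_ord (bigD1 k) //= eqxx mul1r big1 ?addr0; last first.
      by move=> a /negbTE ->; rewrite mul0r.
    by rewrite -mulr_natl; ring.
  apply: (etrans (congr1 (fun t => (n%:R - 1)^-1 * t) SRE)).
  by move: (\sum_(a < n) _) (Phi k 0 s) => x y; field.
apply/rowP => s; have := P_eq s k Uu; rewrite SE.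
have -> : Phi k 0 s = dmx k phi u 0 s - (phi u *m conn g c k u) 0 s - phi u 0 k * phi u 0 s.
  rewrite -PhiE; move: (dmx k phi u) (phi u *m conn g c k u) (phi u 0 k) (phi u) => X Y t p.
  by rewrite !mxE.
have E (A : 'M[R]_n) : ((ecol k)^T *m A) 0 s = A k s.
  by rewrite /ecol trmx_delta -rowE mxE.
move: (dmx k phi u) (phi u *m _) => X Y.
have E2 (Y1 p Z : 'rV[R]_n) t : (Y1 + t *: p + Z) 0 s = Y1 0 s + t * p 0 s + Z 0 s by rewrite !mxE.
have E3 (A1 A2 : 'M[R]_n) t b : (t *: A1 - b *: A2) k s = t * A1 k s - b * A2 k s by rewrite !mxE.
rewrite E2 E E3.
rewrite (gmx_sym g s k ac Uu) (gmx_sym gbar s k ac Uu).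
move: (schouten _ _ _ _ _) (gmx g c u k s) (gmx gbar c u k s) (X 0 s) (Y 0 s) => x y z a b.
by move=> H; lra.
Qed.

Let e2u u : R := expR (2 * upsilon g gbar c u).

Let su := smooth_upsilon g gbar ac.

Let smooth_e2u : smooth_on U e2u.
Proof. by apply: smooth_expR => //; exact: smoothZ. Qed.

Let partial_e2u k u : U u -> partial k e2u u = 2 * phi u 0 k * e2u u.
Proof.
move=> Uu; rewrite (partial_comp_scalar k (smoothZ 2 oU su) Uu (is_derive_expR _)).
by rewrite (partialZ 2 k su Uu) phiE -/(e2u u) mulrC.
Qed.

Let bar_unit u : U u -> gmx gbar c u \in unitmx.
Proof. exact: gmx_unit. Qed.

Let smooth_inv : smooth_mx U (fun u => invmx (gmx gbar c u)).
Proof. exact: (smooth_invmx oU bar_unit (smooth_gmx gbar ac)). Qed.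

Lemma smooth_bar_inverse : smooth_mx U bar_inverse.
Proof. exact: smooth_mxZ. Qed.

Lemma bar_inverse_tr u : U u -> (bar_inverse u)^T = bar_inverse u.
Proof. by move=> Uu; rewrite /bar_inverse trmxZ trmx_inv (gmx_tr gbar ac Uu). Qed.

Lemma dbar_inverse k u : U u -> dmx k bar_inverse u =
  - (conn g c k u *m bar_inverse u) - bar_inverse u *m (conn g c k u)^T
  + ecol k *m (lambda_col u)^T + lambda_col u *m (ecol k)^T.
Proof.
move=> Uu; have Gu := bar_unit Uu; have St := bar_inverse_tr Uu.
have D : dmx k (fun v => invmx (gmx gbar c v)) u =
   - (invmx (gmx gbar c u) *m (conn gbar c k u)^T) - conn gbar c k u *m invmx (gmx gbar c u).
  rewrite (dmx_invmx oU k bar_unit (smooth_gmx gbar ac) Uu) (dmx_gmx gbar k ac Uu).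
  move: (gmx gbar c u) (conn gbar c k u) Gu => H X Gu.
  by mx_expand; rewrite -[invmx H *m X^T *m H *m _]mulmxA mulmxV // mulmx1 mulVmx // mul1mx opprD.
rewrite (dmxZ k smooth_e2u smooth_inv Uu) (partial_e2u k Uu) -scalerA D.
rewrite /lambda_col trmxN trmx_mul trmxK St.
have -> : e2u u *: (- (invmx (gmx gbar c u) *m (conn gbar c k u)^T)
     - conn gbar c k u *m invmx (gmx gbar c u))
  = - (bar_inverse u *m (conn gbar c k u)^T) - conn gbar c k u *m bar_inverse u.
  by rewrite /bar_inverse mul_scale_mx mul_mx_scale scalerDr !scalerN.
rewrite -/(bar_inverse u) conn_bar//.
move: (bar_inverse u) (conn g c k u) (phi u) (phi u 0 k) => S1 X p t.
mx_expand; rewrite trmx1 mulmx1 mul1mx; mx_linear.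
Qed.

(** The coefficient of [ecol k] in the derivative of [lambda_col]: [Bbar] enters through
    [S gbar = e^(2 Upsilon)], the other term through the derivative of S. *)
Definition rho u : R := Bbar u * e2u u - (phi u *m lambda_col u) 0 0.

Lemma smooth_lambda_col : smooth_mx U lambda_col.
Proof.
apply: smooth_mxN => //; apply: smooth_mxM => //; first exact: smooth_bar_inverse.
by apply: smooth_mx_tr => //; exact: smooth_phi.
Qed.

Lemma dlambda_col k u : U u -> dmx k lambda_col u =
  - (conn g c k u *m lambda_col u) + rho u *: ecol k
  - B u *: (bar_inverse u *m gmx g c u *m ecol k).
Proof.
move=> Uu; have St := smooth_mx_tr oU smooth_phi.
have sS := smooth_bar_inverse.
rewrite (dmxN k (smooth_mxM oU sS St) Uu) (dmxM oU k sS St Uu) dmx_tr.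
rewrite (dbar_inverse k Uu) (dphi k Uu).
have SG : bar_inverse u *m gmx gbar c u = e2u u *: 1%:M.
  by rewrite /bar_inverse mul_scale_mx mulVmx ?bar_unit.
have rE : phi u *m lambda_col u = (Bbar u * e2u u - rho u)%:M.
  apply/matrixP => i j; rewrite !ord1 [RHS]mxE eqxx mulr1n /rho; ring.
have lE : bar_inverse u *m (phi u)^T = - lambda_col u by rewrite opprK.
have pE : (ecol k)^T *m (phi u)^T = (phi u 0 k)%:M.
  rewrite -trmx_mul; apply/matrixP => i j; rewrite !ord1 [LHS]mxE col_entry [RHS]mxE eqxx mulr1n //.
have lpE : (lambda_col u)^T *m (phi u)^T = (Bbar u * e2u u - rho u)%:M.
  by rewrite -trmx_mul rE tr_scalar_mx.
move: SG lE lpE; clear rE; move: (Bbar u) (e2u u) (rho u) (lambda_col u) (bar_inverse u).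
move=> b e r l S1 SG lE lpE; mx_expand; rewrite (gmx_tr g ac Uu) (gmx_tr gbar ac Uu) SG.
rewrite -[_ *m l^T *m _]mulmxA lpE -[_ *m (ecol k)^T *m _]mulmxA pE.
rewrite -[conn g c k u *m _ *m _]mulmxA lE !mul_mx_scalar.
rewrite mul_scale_mx mul1mx mulmxN.
mx_linear.
Qed.

Lemma Wlam_projective j k u : (2 < n)%N -> smooth_on U B -> smooth_on U Bbar -> U u ->
  Wlam (conn g c) lambda_col j k u = 0.
Proof.
move=> n_ge3 sB sBb Uu.
apply: (Wlam_eq0 oU (smooth_gmx g ac) smooth_bar_inverse (fun k => smooth_conn g k ac)
  smooth_lambda_col sB (rho := rho) _ (fun v => @gmx_unit _ _ _ g c v ac)
  (fun v => @gmx_tr _ _ _ g c v ac) bar_inverse_tr _ _ dbar_inverse dlambda_col n_ge3 j k Uu).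
- apply: smoothB => //; first exact: smoothM.
  by apply: smooth_mxM => //; [exact: smooth_phi|exact: smooth_lambda_col].
- by move=> a b i v Uv; exact: conn_sym.
- by move=> a v Uv; exact: dmx_gmx.
Qed.

End projectively_related.

(** * Chart independence of lambda, and the set where dUpsilon is nonzero *)

Section conformal_vector.
Context {R : realType} {n : nat} {M : manifold R n} (g gbar : metric M).
Implicit Types (c d : chart R M n) (u v : 'rV[R]_n) (i j k l s : 'I_n).

Lemma det_ratio_coords c d u : atlas c -> atlas d -> overlap c d u ->
  \det (gmx gbar c u) / \det (gmx g c u)
  = \det (gmx gbar d (coords c d u)) / \det (gmx g d (coords c d u)).
Proof.
move=> ac ad Ou; have J0 := jac_unit g ac ad Ou.
rewrite unitmxE unitfE in J0.
rewrite !(gmx_transform _ ac ad Ou) !det_mulmx det_tr.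
have h0 := gmx_det_neq0 g ad (overlap_sub (coords_img Ou)).
move: (\det (jac c d u)) (\det (gmx g d _)) (\det (gmx gbar d _)) J0 h0 => a b e a0 b0.
by field; rewrite b0.
Qed.

Lemma upsilon_coords c d u : atlas c -> atlas d -> overlap c d u ->
  upsilon g gbar c u = upsilon g gbar d (coords c d u).
Proof.
by move=> ac ad Ou; rewrite /upsilon /Upsilon -!/(gmx _ _ _) (det_ratio_coords ac ad Ou).
Qed.

Lemma phi_coords c d u : atlas c -> atlas d -> overlap c d u ->
  phi g gbar c u = phi g gbar d (coords c d u) *m (jac c d u)^T.
Proof.
move=> ac ad Ou; apply/rowP => i; rewrite phiE.
rewrite (partial_eq_on (g := upsilon g gbar d \o coords c d) i (open_overlap c d) Ou); last first.
  by move=> v Ov; exact: upsilon_coords.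
rewrite (partial_coords i ac ad Ou (smooth_upsilon g gbar ad)) [RHS]mxE.
by apply: eq_bigr => a _; rewrite phiE [_^T _ _]mxE mulrC.
Qed.

(** This allows the chart expressions to be assembled into one [tangent] vector. *)
Lemma lambda_col_coords c d u : atlas c -> atlas d -> overlap c d u ->
  lambda_col g gbar d (coords c d u) = (jac c d u)^T *m lambda_col g gbar c u.
Proof.
move=> ac ad Ou; have Ju := jac_unit g ac ad Ou.
have Hu := gmx_unit gbar ad (overlap_sub (coords_img Ou)).
rewrite /lambda_col /bar_inverse (upsilon_coords ac ad Ou) (phi_coords ac ad Ou).
rewrite (gmx_transform gbar ac ad Ou).
move: (jac c d u) (phi _ _ _ _) (gmx _ _ _) (expR _) Ju Hu => J p H e Ju Hu.
have JTu : J^T \in unitmx by rewrite unitmx_tr.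
have -> : invmx (J *m H *m J^T) = invmx J^T *m (invmx H *m invmx J).
  apply: (can_inj (mulKmx (_ : J *m H *m J^T \in unitmx))).
    by rewrite !unitmx_mul Ju Hu.
  rewrite mulmxV ?unitmx_mul ?Ju ?Hu // !mulmxA -[J *m H *m J^T *m _]mulmxA mulmxV // mulmx1.
  by rewrite -[J *m H *m _]mulmxA mulmxV // mulmx1 mulmxV.
mx_expand; rewrite mulmxV // mul1mx.
by rewrite -[_ *m invmx J *m J]mulmxA mulVmx // mulmx1.
Qed.

Lemma lambda_col_neq0 c u : atlas c -> cimg c u -> phi g gbar c u != 0 -> lambda_col g gbar c u != 0.
Proof.
move=> ac Uu p0; rewrite oppr_eq0 /bar_inverse mul_scale_mx scaler_eq0 gt_eqF ?expR_gt0 //=.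
apply: contra p0 => /eqP E; rewrite -trmx_eq0.
by rewrite -[X in X == 0](mulKVmx (gmx_unit gbar ac Uu)) E mulmx0.
Qed.

Lemma dUpsilonE c i x : pd c i (Upsilon g gbar c) x = phi g gbar c (cmap c x) 0 i.
Proof. by rewrite phiE. Qed.

Lemma dUpsilon_neq0E x : dUpsilon_neq0 g gbar x <->
  exists c, [/\ atlas c, cdom c x & phi g gbar c (cmap c x) != 0].
Proof.
split=> [[c [i [ac xc]]]|[c [ac xc p0]]].
  rewrite dUpsilonE => p0; exists c; split=> //; apply: contra p0 => /eqP ->.
  by rewrite mxE.
suff [i pi] : exists i, phi g gbar c (cmap c x) 0 i != 0 by exists c, i; rewrite dUpsilonE.
apply: contrapT => H; move/eqP: p0; apply; apply/rowP => i; rewrite [RHS]mxE.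
by apply/eqP/negPn/negP => h; apply: H; exists i.
Qed.

Lemma open_dUpsilon_neq0 : open (dUpsilon_neq0 g gbar).
Proof.
rewrite openE => x [c [i [ac xc p0]]]; rewrite /interior.
have Ux := cimg_cmap xc.
have cp : {for cmap c x, continuous (partial i (upsilon g gbar c))}.
  exact: (smooth_continuous (smooth_partial i (smooth_upsilon g gbar ac)) Ux).
have nb : \forall v \near cmap c x, partial i (upsilon g gbar c) v != 0.
  exact: cp (open_nbhs_nbhs (conj (@open_neq R 0) p0)).
have nc : \forall y \near x, cdom c y by exact: open_nbhs_nbhs (conj (cdom_open c) xc).
have := cmap_continuous xc nb; apply: filterS2 nc => y yc py.
by exists c, i.
Qed.

Lemma dUpsilon_neq0_nonempty : geodesics_reparametrise g gbar ->
  ~ affinely_equivalent g gbar -> dUpsilon_neq0 g gbar !=set0.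
Proof.
move=> gg na; apply: contrapT => H; apply: na => c x k i j ac xc.
have p0 a : partial a (upsilon g gbar c) (cmap c x) = 0.
  apply/eqP/negPn/negP => h; apply: H; exists x; exists c, a; split=> //.
have := christoffel_projective k i j gg ac (cimg_cmap xc).
by rewrite cmapK // !p0 !mulr0 !addr0.
Qed.

End conformal_vector.

(** * Vanishing of the projective Weyl tensor in dimension two *)

Lemma ord2_other n (p q a : 'I_n) : n = 2%N -> p != q -> a != p -> a = q.
Proof.
move=> n2; rewrite -!(inj_eq val_inj) /= => pq ap; apply/val_inj => /=.
have := ltn_ord p; have := ltn_ord q; have := ltn_ord a; lia.
Qed.

(** [riemann] vanishes when its last two indices agree, so the Ricci sum keeps a single term; as
    [n - 1 = 1], the Schouten terms cancel the curvature. *)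
Lemma weyl_dim2 (R : realType) (n : nat) (M : manifold R n) (g : metric M) c i s j k x :
  n = 2%N -> atlas c -> weyl g c i s j k x = 0.
Proof.
move=> n2 ac.
have alt a e p q : riemann g c a e p q x = - riemann g c a e q p x.
  by rewrite /riemann !sumrB opprD !opprB.
have alt0 a e p : riemann g c a e p p x = 0.
  have := alt a e p p; move: (riemann _ _ _ _ _ _ _) => t h; lra.
rewrite /weyl; have [->|jk] := eqVneq k j; first by rewrite alt0 add0r subrr.
have P2 p q (pq : p != q) e : schouten g c e p x = riemann g c q e q p x.
  rewrite /schouten /ricci (bigD1 p) //= (bigD1 q) 1?eq_sym //= big1 ?addr0 ?alt0 ?add0r.
    have -> : (n%:R - 1 : R) = 1 by rewrite n2; ring.
    by rewrite invr1 mul1r.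
  by move=> a /andP[ap /eqP aq]; case: aq; exact: ord2_other ap.
have kj : j != k by rewrite eq_sym.
rewrite (P2 j k kj) (P2 k j jk).
have [->|ij] := eqVneq i j.
  by rewrite eq_sym (negbTE jk) /= mul0r addr0 mul1r subrr.
rewrite (ord2_other n2 (p := j) (q := k) kj ij).
by rewrite eqxx mul0r subr0 mul1r alt addNr.
Qed.

Theorem theorem4p37 (R : realType) (n : nat) (M : manifold R n)
    (g gbar : metric M) (B Bbar : M -> R)
    (n_ge2 : (2 <= n)%N)
    (g_gbar : projectively_equivalent g gbar)
    (B_smooth : smooth_fun B) (Bbar_smooth : smooth_fun Bbar)
    (P_eq : forall (c : chart R M n) (x : M) (i j : 'I_n),
      atlas c -> cdom c x ->
      schouten g c i j x - B x * g c x i j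
      = schouten gbar c i j x - Bbar x * gbar c x i j) :
  (forall (c : chart R M n) (x : M) (i j k : 'I_n), atlas c -> cdom c x ->
     \sum_(s < n) lambda g gbar c s x * weyl g c i s j k x = 0) /\
  (~ affinely_equivalent g gbar ->
     [/\ open (dUpsilon_neq0 g gbar),
         dUpsilon_neq0 g gbar !=set0
       & forall x, dUpsilon_neq0 g gbar x -> weyl_nullity g x]).

Proof.
have gg := g_gbar.1.
have W0 c x i j k : atlas c -> cdom c x ->
    \sum_(s < n) lambda g gbar c s x * weyl g c i s j k x = 0.
  move=> ac xc.
  (* The algebra of [codazzi_rank1] and the final count of coefficients require [n > 2]. *)
  have [n2|n2] := eqVneq n 2%N.
    by rewrite big1 // => s _; rewrite weyl_dim2 ?mulr0.
  have n3 : (2 < n)%N by rewrite ltn_neqAle eq_sym n2.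
  have Ux := cimg_cmap xc.
  rewrite -{1}[x](cmapK xc); under eq_bigr do rewrite -{2}[x](cmapK xc) -(lambda_colE g gbar _ Ux).
  rewrite (weyl_conn g (lambda_col g gbar c) i j k Ux).
  rewrite (Wlam_projective gg ac (B := fun u => B (cinv c u)) (Bbar := fun u => Bbar (cinv c u))
    n_ge2 _ j k n3 (B_smooth c ac) (Bbar_smooth c ac) Ux) ?mxE //.
  by move=> u a b Uu; apply: P_eq => //; exact: cimg_dom.
split=> [c x i j k|na]; first exact: W0.
split; [exact: open_dUpsilon_neq0|exact: dUpsilon_neq0_nonempty|].
move=> x /dUpsilon_neq0E[c0 [ac0 xc0 p0]].
pose v c := (lambda_col g gbar c (cmap c x))^T.
have vT c d : atlas c -> atlas d -> cdom c x -> cdom d x -> v d = v c *m transition c d x.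
  move=> ac ad xc xd; rewrite (transition_jac ac ad xc xd).
  have Ou : overlap c d (cmap c x) by exists x.
  have := lambda_col_coords g gbar ac ad Ou; rewrite /coords (cmapK xc) => E.
  by rewrite /v E trmx_mul trmxK.
exists (Tangent vT) => c ac xc /=; split.
  (* [dUpsilon] is known to be nonzero in the chart [c0]; the transformation law carries a zero of
     [v c] back to [c0]. *)
  apply/eqP => v0; have := lambda_col_neq0 ac0 (cimg_cmap xc0) p0.
  by rewrite -trmx_eq0 -/(v c0) (vT c c0) // v0 mul0mx eqxx.
move=> i k l; rewrite -[RHS](W0 c x i k l ac xc); apply: eq_bigr => s _.
by rewrite mulrC /v mxE lambda_colE ?cmapK //; exact: cimg_cmap.
Qed.
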